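(* Let $f$ be a continuous bundle random dynamical system on a compact metric space $X$ over $(\Omega,\mathcal{F},\mathbb{P},\vartheta)$, and let $\mu\in\mathcal{M}^1_{\mathbb{P}}(\Omega\times X,f)$. Let $\alpha^{(1)},\alpha^{(2)}$ be two finite measurable partitions of $\Omega\times X$ and let $\mathbf a=(a_1,a_2)\in\mathbb{R}^2$ with $a_1>0$ and $a_2\ge0$. Then for $\mu$-almost every $(\omega,x)$, $$\lim_{N\to\infty}\frac1NI_{\mu_\omega}\Big(\bigvee_{n=0}^{\lceil a_1N\rceil-1}(f^n_\omega)^{-1}\alpha^{(1)}_{\vartheta^n\omega}\vee\bigvee_{n=0}^{\lceil(a_1+a_2)N\rceil-1}(f^n_\omega)^{-1}\alpha^{(2)}_{\vartheta^n\omega}\Big)(x)=a_1\mathbb{E}_\mu(F_1\mid\mathcal{I}_\mu)(\omega,x)+a_2\mathbb{E}_\mu(F_2\mid\mathcal{I}_\mu)(\omega,x),$$ where $$F_1(\omega,x)=I_{\mu_\omega}\Big(\alpha^{(1)}_\omega\vee\alpha^{(2)}_\omega\,\Big|\,\bigvee_{n=1}^\infty(f^n_\omega)^{-1}(\alpha^{(1)}_{\vartheta^n\omega}\vee\alpha^{(2)}_{\vartheta^n\omega})\Big)(x),\qquad F_2(\omega,x)=I_{\mu_\omega}\Big(\alpha^{(2)}_\omega\,\Big|\,\bigvee_{n=1}^\infty(f^n_\omega)^{-1}\alpha^{(2)}_{\vartheta^n\omega}\Big)(x),$$ and $\mathcal{I}_\mu=\{B\in\mathcal{F}\times\mathcal{B}:\mu(B\triangle\Theta^{-1}B)=0\}$.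 In addition, if $\mu$ is ergodic, then for $\mu$-almost every $(\omega,x)$, $$\lim_{N\to\infty}\frac1NI_{\mu_\omega}\Big(\bigvee_{n=0}^{\lceil a_1N\rceil-1}(f^n_\omega)^{-1}\alpha^{(1)}_{\vartheta^n\omega}\vee\bigvee_{n=0}^{\lceil(a_1+a_2)N\rceil-1}(f^n_\omega)^{-1}\alpha^{(2)}_{\vartheta^n\omega}\Big)(x)=a_1h_\mu^{(r)}(f,\alpha^{(1)}\vee\alpha^{(2)})+a_2h_\mu^{(r)}(f,\alpha^{(2)}).$$
   Context: **Base system.** $(\Omega,\mathcal{F},\mathbb{P},\vartheta)$ is a Polish probability space together with an invertible ergodic $\mathbb{P}$-preserving transformation $\vartheta$. **RDS.** $X$ is a compact metric space with Borel $\sigma$-algebra $\mathcal{B}$. A continuous bundle random dynamical system $f$ on $X$ over $(\Omega,\mathcal{F},\mathbb{P},\vartheta)$ is a family of maps $f_\omega:X\to X$, $\omega\in\Omega$, such that $(\omega,x)\mapsto f_\omega x$ is measurable and $x\mapsto f_\omega x$ is continuous for $\mathbb{P}$-a.e. $\omega$. Put $f_\omega^0=\mathrm{Id}$ and $f_\omega^n=f_{\vartheta^{n-1}\omega}\circ\cdots\circ f_{\vartheta\omega}\circ f_\omega$ for $n>0$. The skew product is $\Theta(\omega,x)=(\vartheta\omega,f_\omega x)$ on $\Omega\times X$. **Measures.** $\mathcal{M}^1_{\mathbb{P}}(\Omega\times X,f)$ is the set of $\Theta$-invariant probability measures on $\Omega\times X$ with marginal $\mathbb{P}$ on $\Omega$.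 Such a $\mu$ disintegrates as $d\mu(\omega,x)=d\mu_\omega(x)\,d\mathbb{P}(\omega)$. ''Ergodic'' means ergodic for $\Theta$. **Partitions, information, entropy.** For a finite measurable partition $\alpha$ of $\Omega\times X$, $\alpha_\omega=\{A_\omega:A\in\alpha\}$ with $A_\omega=\{x\in X:(\omega,x)\in A\}$, a partition of $X$. For a finite partition $\xi$ of $X$ and a sub-$\sigma$-algebra $\mathcal{A}$ of $\mathcal{B}$, $I_{\mu_\omega}(\xi\mid\mathcal{A})(x)=-\sum_{A\in\xi}\chi_A(x)\log\mu_\omega(A\mid\mathcal{A})(x)$ is the conditional information, and $I_{\mu_\omega}(\xi)(x)=-\log\mu_\omega(\xi(x))$, with $\xi(x)$ the atom of $\xi$ containing $x$; an infinite join of partitions stands for the $\sigma$-algebra it generates. $\mathbb{E}_\mu(\cdot\mid\mathcal{I}_\mu)$ is conditional expectation. $\lceil u\rceil$ is the least integer not less than $u$. With $\pi_\Omega:\Omega\times X\to\Omega$ the projection, $H_\mu(\mathcal{Q}\mid\pi_\Omega^{-1}\mathcal{F})=\int H_{\mu_\omega}(\mathcal{Q}_\omega)\,d\mathbb{P}(\omega)$ for a finite measurable partition $\mathcal{Q}$ of $\Omega\times X$, and $h_\mu^{(r)}(f,\mathcal{Q})=\lim_{n\to\infty}\frac1nH_\mu\big(\bigvee_{i=0}^{n-1}(\Theta^i)^{-1}\mathcal{Q}\mid\pi_\Omega^{-1}\mathcal{F}\big)$. *)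

(* Defs.v *)
From HB Require Import structures.
From mathcomp Require Import all_boot all_order all_algebra.
From mathcomp Require Import all_classical all_reals all_analysis.
From mathcomp Require Import measurable_realfun.

Set Implicit Arguments.
Unset Strict Implicit.
Unset Printing Implicit Defensive.

Import Order.TTheory GRing.Theory Num.Theory.
Import numFieldNormedType.Exports.

Local Open Scope classical_set_scope.
Local Open Scope ring_scope.
Local Open Scope ereal_scope.

(* Measurable types in MathComp-Analysis are pointed, hence nonempty; this is no
   restriction for spaces carrying a probability measure. *)
#[short(type="pointedMetricType")]
HB.structure Definition PointedMetric (R : numDomainType) :=
  {T of Pointed T & Metric R T}.

#[short(type="completeMetricType")]
HB.structure Definition CompleteMetric (R : numDomainType) :=
  {T of Complete T & Pointed T & Metric R T}.

Definition separable (T : topologicalType) :=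
  exists2 D : set T, countable D & dense D.

Notation borel T := (g_sigma_algebraType (@open T)).

Section measure_preserving_systems.
Context d (T : measurableType d) (R : realType) (mu : probability T R).
Implicit Type S : T -> T.

Definition invariant_measure S :=
  forall A, measurable A -> mu (S @^-1` A) = mu A.

Definition invertible S :=
  exists2 S' : T -> T, measurable_fun setT S' & cancel S S' /\ cancel S' S.

Definition ergodic S :=
  forall A, measurable A -> S @^-1` A = A -> mu A = 0 \/ mu A = 1.

(* the sigma-algebra of sets that are invariant modulo mu *)
Definition ae_invariant_sets S : set (set T) :=
  [set B | measurable B /\ mu (B `+` S @^-1` B) = 0].

End measure_preserving_systems.

Section partitions.
Context {T U : Type}.
Implicit Types xi eta : set (set T).

(* Atoms are allowed to be empty: the fiber over w of an atom of a partition of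
   Om * X may be empty. *)
Definition is_partition xi := cover xi id = setT /\ trivIset xi id.

Definition pjoin xi eta : set (set T) := [set A `&` B | A in xi & B in eta].

Definition pullback (S : U -> T) xi : set (set U) := [set S @^-1` A | A in xi].

Definition atom xi (x : T) : set T := \bigcup_(A in [set A | xi A /\ A x]) A.

End partitions.

(* [set setT] is the trivial partition, neutral for pjoin *)
Notation "\pjoin_ ( i < n ) F" := (\big[pjoin/[set setT]]_(i < n) F)
  (at level 41, F at level 41, i, n at level 50,
   format "'[' \pjoin_ ( i  <  n ) '/  '  F ']'").

Definition finite_measurable_partition d (T : measurableType d)
    (xi : set (set T)) :=
  [/\ finite_set xi, xi `<=` measurable & is_partition xi].

Definition fiber {Om X : Type} (alpha : set (set (Om * X))) (w : Om) :
    set (set X) :=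
  [set xsection A w | A in alpha].

Section information.
Context d (T : measurableType d) (R : realType).
Variable nu : {measure set T -> \bar R}.
Implicit Types (xi G : set (set T)) (f g : T -> \bar R).

(* In \bar R, lne 0 = -oo and 0 * -oo = 0, so that null atoms do not contribute
   to the sums below. *)
Definition info xi x : \bar R := - lne (nu (atom xi x)).

Definition entropy xi : \bar R := - \sum_(A \in xi) nu A * lne (nu A).

Definition is_condexp G f g :=
  (forall B : set (\bar R), measurable B -> G (g @^-1` B)) /\
  (forall A, G A -> \int[nu]_(x in A) g x = \int[nu]_(x in A) f x).

(* a version of the conditional expectation of f given the sigma-algebra G *)
Definition condexp G f : T -> \bar R := xget (cst 0) (is_condexp G f).

Definition condprob A G : T -> \bar R := condexp G (fun x => (\1_A x)%:E).

Definition cond_info xi G x : \bar R :=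
  - \sum_(A \in xi) (\1_A x)%:E * lne (condprob A G x).

End information.

Section skew_product.
Context {Om X : Type} (theta : Om -> Om) (f : Om -> X -> X).

Fixpoint rds_iter n w : X -> X :=
  if n is m.+1 then f (iter m theta w) \o rds_iter m w else id.

Definition skew_product (z : Om * X) : Om * X := (theta z.1, f z.1 z.2).

(* (f_w^n)^-1 xi_(theta^n w), for a family of partitions xi_w of X *)
Definition rds_pullback (xi : Om -> set (set X)) n w : set (set X) :=
  pullback (rds_iter n w) (xi (iter n theta w)).

(* the sigma-algebra generated by all (f_w^n)^-1 xi_(theta^n w), n >= 1 *)
Definition rds_future (xi : Om -> set (set X)) w : set (set X) :=
  <<s \bigcup_(n in [set n | (0 < n)%N]) rds_pullback xi n w >>.

End skew_product.

Section random_dynamics.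
Context d d' (Om : measurableType d) (X : measurableType d') (R : realType).
Variables (P : probability Om R) (mu_ : R.-pker Om ~> X).
Implicit Type Q : set (set (Om * X)).

Definition has_marginal (mu : probability (Om * X)%type R) :=
  forall A, measurable A -> mu (fst @^-1` A) = P A.

(* d mu(w, x) = d mu_w(x) d P(w) *)
Definition disintegration (mu : probability (Om * X)%type R) :=
  forall A, measurable A -> mu A = \int[P]_w mu_ w (xsection A w).

(* A function (w, x) |-> h w x in which each h w is a version chosen up to a
   mu_w-null set (such as a conditional information function) need not be jointly
   measurable; this is the jointly measurable function, unique mu-almost
   everywhere, whose sections agree mu_w-almost everywhere with h w for
   P-almost every w. *)
Definition joint_version (h : Om -> X -> \bar R) : Om * X -> \bar R :=
  xget (cst 0) [set F | measurable_fun setT F /\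
    {ae P, forall w, {ae mu_ w, forall x, F (w, x) = h w x}}].

Definition fiber_entropy Q : \bar R := \int[P]_w entropy (mu_ w) (fiber Q w).

Definition rds_entropy (theta : Om -> Om) (f : Om -> X -> X) Q : \bar R :=
  limn (fun n => (n%:R^-1)%:E *
    fiber_entropy (\pjoin_(i < n) pullback (iter i (skew_product theta f)) Q)).

(* the functions F_1 and F_2 are rds_cond_info for the families of partitions
   w |-> alpha1_w \/ alpha2_w and w |-> alpha2_w *)
Definition rds_cond_info (theta : Om -> Om) (f : Om -> X -> X)
    (xi : Om -> set (set X)) : Om * X -> \bar R :=
  joint_version (fun w => cond_info (mu_ w) (xi w) (rds_future theta f xi w)).

End random_dynamics.

Definition continuous_bundle_rds (R : realType) (Om : ptopologicalType)
    (X : pointedMetricType R) (P : probability (borel Om) R)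
    (f : Om -> X -> X) :=
  measurable_fun [set: borel Om * borel X]
    (fun z => f z.1 z.2 : borel X) /\
  {ae P, forall w, continuous (f w)}.

(* Main.v *)
Require Import Defs.
From HB Require Import structures.
From mathcomp Require Import all_boot all_order all_algebra.
From mathcomp Require Import all_classical all_reals all_analysis.
From mathcomp Require Import measurable_realfun.
From mathcomp Require Import ring lra zify.

Set Implicit Arguments.
Unset Strict Implicit.
Unset Printing Implicit Defensive.

Import Order.TTheory GRing.Theory Num.Theory.
Import numFieldNormedType.Exports.

Local Open Scope classical_set_scope.
Local Open Scope ring_scope.

(** Name the atoms of the partitions by natural numbers, and let J_N (w, x) be the
    mu_w-mass of the atom of x in the joined partition. As mu is invariant and
    theta is invertible, mu_(theta w) is the image of mu_w under f_w for almost
    every w ([kernel_equivariant]), so that J_N factors along the orbit into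
    conditional probabilities of a label given the later ones
    ([label_mass_cons]). With A1 and A2 the two lengths of observation, the first
    A1 factors concern the label xi of alpha1 \/ alpha2, and the following A2 - A1
    ones the label eta of alpha2. Each factor is conditioned on a finite future
    that depends on N and on its position, so that Birkhoff's theorem does not
    apply to - ln J_N as it stands. Following Algoet and Cover, - ln J_N is
    enclosed between Birkhoff sums.

    Upper bound ([info_upper_bound]). Conditioning each label on the next m ones
    only defines another law of the labels. Its likelihood ratio to the true law
    has mean at most 1; by Markov's inequality and the Borel-Cantelli lemma it is
    eventually at most (N + 1)(N + 2). Hence - ln J_N is at most the sum of the
    informations [cinfo] of order m along the orbit, up to O(m + ln N).

    Lower bound ([info_lower_bound]). Conditioning on the whole infinite future
    gives a product to which J_N has a ratio of mean at most 1, as Fatou's lemma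
    shows from futures of finite length. Hence - ln J_N is at least the sum of
    the informations [cinfo_lim], up to O(ln N).

    After division by N, Birkhoff's theorem gives the limits of both bounds. By
    Levy's upward theorem in the fibres ([label_cprob_cvg]), [cinfo] of order m
    converges to [cinfo_lim] almost everywhere, and in L1 since it is bounded in
    L2 ([integral_cinfo_sqr]); thus the two limits coincide ([info_cvg]).

    It remains to name the limit: a Birkhoff limit is a conditional expectation
    given the sets that are invariant modulo mu ([condexp_invariant]), [cinfo_lim]
    is a jointly measurable version of the conditional information given the
    future ([rds_cond_info_cinfo_lim]), and its integral is the fibre entropy
    ([rds_entropy_cinfo_lim]). *)

(** * Countable labels and conditional probabilities given a label *)

Section countable_labels.
Context d (T : measurableType d).

(** A countable measurable partition is represented by the function that names
    the block of a point: joins and pull-backs then become pairing and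
    composition. *)
Definition mlabel (L : countType) (r : T -> L) :=
  forall S : set L, measurable (r @^-1` S).

Lemma mlabelP (L : countType) (r : T -> L) :
  (forall l, measurable (r @^-1` [set l])) -> mlabel r.
Proof.
move=> mr S.
rewrite (_ : _ @^-1` _ = \bigcup_(l in S) r @^-1` [set l]).
  rewrite bigcup_mkcond; apply: countable_bigcupT_measurable => // l.
  by case: ifPn.
by rewrite -preimage_bigcup bigcup_imset1 image_id.
Qed.

Lemma mlabel_comp (L L' : countType) (g : L -> L') (r : T -> L) :
  mlabel r -> mlabel (g \o r).
Proof. by move=> mr S; exact: (mr (g @^-1` S)). Qed.

Lemma mlabel_pair (L L' : countType) (r : T -> L) (s : T -> L') :
  mlabel r -> mlabel s -> mlabel (fun x => (r x, s x)).
Proof.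
move=> mr ms; apply: mlabelP => -[l l'].
rewrite (_ : _ @^-1` _ = r @^-1` [set l] `&` s @^-1` [set l']).
  exact: measurableI.
by apply/seteqP; split=> x /= [-> ->].
Qed.

Lemma mlabel_glue (L : countType) (r : T -> L) d' (U : measurableType d')
    (F : L -> T -> U) :
  mlabel r -> (forall l, measurable_fun setT (F l)) ->
  measurable_fun setT (fun x => F (r x) x).
Proof.
move=> mr mF _ B mB; rewrite setTI.
rewrite (_ : _ @^-1` _ = \bigcup_l (r @^-1` [set l] `&` F l @^-1` B)).
  apply: countable_bigcupT_measurable => // l; apply: measurableI => //.
  by rewrite -[X in measurable X]setTI; exact: mF.
apply/seteqP; split=> x /=; first by exists (r x).
by move=> [l _ [/= <-]].
Qed.

Definition adapted (L : Type) (r : T -> L) (V : Type) (h : T -> V) :=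
  forall x y, r x = r y -> h x = h y.

Lemma adapted_measurable (L : countType) (r : T -> L) d' (U : measurableType d')
    (h : T -> U) : mlabel r -> adapted r h -> measurable_fun setT h.
Proof.
move=> mr rh _ B mB; rewrite setTI.
rewrite (_ : _ @^-1` _ = r @^-1` (r @` (h @^-1` B))); first exact: mr.
apply/seteqP; split=> x /=; first by exists x.
by move=> [y /= By /rh <-].
Qed.

End countable_labels.

Lemma mlabel_fun d d' (T : measurableType d) (U : measurableType d')
    (L : countType) (r : U -> L) (g : T -> U) :
  mlabel r -> measurable_fun setT g -> mlabel (r \o g).
Proof.
move=> mr mg S; rewrite comp_preimage -[X in measurable X]setTI.
exact: mg.
Qed.

Section conditional_probability_given_a_label.
Context d (T : measurableType d) (R : realType) (nu : probability T R).

Definition same_label (L : Type) (r : T -> L) x := [set y | r y = r x].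

(** Equal to 0 on the null blocks of r, since x / 0 = 0. *)
Definition cprob (L : Type) (A : set T) (r : T -> L) x : R :=
  fine (nu (A `&` same_label r x)) / fine (nu (same_label r x)).

Lemma cprob_adapted (L : Type) A (r : T -> L) : adapted r (cprob A r).
Proof. by move=> x y rxy; rewrite /cprob /same_label rxy. Qed.

Lemma measurable_same_label (L : countType) (r : T -> L) x :
  mlabel r -> measurable (same_label r x).
Proof. by move=> mr; exact: (mr [set r x]). Qed.

Lemma cprob_itv (L : countType) (A : set T) (r : T -> L) x :
  mlabel r -> measurable A -> 0 <= cprob A r x <= 1.
Proof.
move=> mr mA; have mC := measurable_same_label x mr.
rewrite /cprob divr_ge0 ?fine_ge0//=.
have [->|C0] := eqVneq (fine (nu (same_label r x))) 0.
  by rewrite invr0 mulr0.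
rewrite ler_pdivrMr ?mul1r; last by rewrite lt0r C0 fine_ge0.
apply: fine_le; [exact: fin_num_measure (measurableI _ _ mA mC)
  |exact: fin_num_measure|].
by apply: le_measure; rewrite ?inE//; exact: measurableI.
Qed.

Lemma integral_by_label (L : countType) (r : T -> L) (f : T -> \bar R) :
  mlabel r -> measurable_fun setT f -> (forall x, 0 <= f x)%E ->
  (\int[nu]_x f x =
   \sum_(n <oo) \int[nu]_(x in (pickle \o r) @^-1` [set n]) f x)%E.
Proof.
move=> mr mf f0.
have cover : \bigcup_n (pickle \o r) @^-1` [set n] = setT :> set T.
  by apply/seteqP; split=> // x _; exists (pickle (r x)).
rewrite -ge0_integral_bigcup ?cover//.
- by move=> n; exact: (mlabel_comp pickle mr).
- exact: trivIset_preimage1.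
Qed.

(** Both integrals split into integrals over the blocks of r, where h and
    cprob A r are constant. *)
Lemma ge0_cprobE (L : countType) (r : T -> L) (A : set T) (h : T -> R) :
  mlabel r -> measurable A -> adapted r h -> (forall x, 0 <= h x) ->
  (\int[nu]_x (\1_A x * h x)%:E = \int[nu]_x (cprob A r x * h x)%:E)%E.
Proof.
move=> mr mA rh h0.
have mh : measurable_fun setT h := adapted_measurable mr rh.
have mc : measurable_fun setT (cprob A r) :=
  adapted_measurable mr (@cprob_adapted _ A r).
have c0 x : 0 <= cprob A r x by have /andP[] := cprob_itv x mr mA.
have mch : measurable_fun setT (fun x => (cprob A r x * h x)%:E).
  by apply/measurable_EFinP/measurable_funM.
have mAh : measurable_fun setT (fun x => (\1_A x * h x)%:E).
  by apply/measurable_EFinP/measurable_funM => //; exact: measurable_indic.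
rewrite (integral_by_label mr mAh); last by move=> x; rewrite lee_fin mulr_ge0.
rewrite (integral_by_label mr mch); last by move=> x; rewrite lee_fin mulr_ge0.
apply: eq_eseriesr => n _.
set F := _ @^-1` _.
have mF : measurable F by exact: (mlabel_comp pickle mr).
have [[x0 /= Fx0]|F0] := pselect (F !=set0); last first.
  suff -> : F = set0 by rewrite !integral_set0.
  by apply/seteqP; split=> // x Fx; exfalso; apply: F0; exists x.
have FE : F = same_label r x0.
  apply/seteqP; split=> x /=; last by rewrite /F/= => ->.
  by rewrite /F/= -Fx0 => /(pcan_inj pickleK).
have FF x : F x -> r x = r x0 by rewrite FE.
transitivity (\int[nu]_(x in F) ((h x0)%:E * (\1_A x)%:E))%E.
  apply: eq_integral => x /set_mem/FF/rh ->.
  by rewrite -EFinM mulrC.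
have mAF : measurable_fun F (fun x => (\1_A x : R)%:E).
  by apply/measurable_EFinP; exact: measurable_indic.
rewrite ge0_integralZl ?lee_fin//.
transitivity (\int[nu]_(x in F) (cst ((cprob A r x0 * h x0)%:E) x))%E; last first.
  apply: eq_integral => x /set_mem/FF rx.
  by rewrite (rh _ _ rx) (cprob_adapted A rx).
rewrite integral_cst// integral_indic// FE.
have fA : nu (A `&` same_label r x0) \is a fin_num.
  by apply: fin_num_measure; rewrite -FE; exact: measurableI.
have fC : nu (same_label r x0) \is a fin_num.
  by apply: fin_num_measure; rewrite -FE.
rewrite /cprob -[X in (_ * X = _)%E](fineK fA) -[X in (_ = _ * X)%E](fineK fC).
rewrite -!EFinM; congr (_%:E).
rewrite [RHS]mulrAC mulrC; congr (_ * _).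
have [C0|C0] := eqVneq (fine (nu (same_label r x0))) 0; last by rewrite mulfVK.
rewrite C0 mulr0.
apply/eqP; rewrite eq_le fine_ge0// andbT -C0; apply: fine_le => //.
by apply: le_measure; rewrite ?inE// -FE//; exact: measurableI.
Qed.

End conditional_probability_given_a_label.

Section bounded_measurable_functions.
Context d (T : measurableType d) (R : realType) (nu : probability T R).
Implicit Types g h : T -> R.

Lemma probability_mass : (nu : {measure set T -> \bar R}) [set: T] = 1%E.
Proof. exact: probability_setT. Qed.

(** A class of integrable functions that is closed under products. *)
Definition bounded_measurable h :=
  measurable_fun setT h /\ exists M, forall x, `|h x| <= M.

Lemma bm_integrable h : bounded_measurable h -> nu.-integrable setT (EFin \o h).
Proof.
move=> [mh [M hM]]; apply: measurable_bounded_integrable => //.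
  by rewrite (le_lt_trans (probability_le1 nu measurableT))// ltry.
by exists M; split; [exact: num_real|move=> B MB x _; exact: le_trans (hM x) (ltW MB)].
Qed.

Lemma bmD g h : bounded_measurable g -> bounded_measurable h ->
  bounded_measurable (fun x => g x + h x).
Proof.
move=> [mg [M gM]] [mh [N hN]]; split; first exact: measurable_funD.
by exists (M + N) => x; rewrite (le_trans (ler_normD _ _))// lerD.
Qed.

Lemma bmB g h : bounded_measurable g -> bounded_measurable h ->
  bounded_measurable (fun x => g x - h x).
Proof.
move=> [mg [M gM]] [mh [N hN]]; split; first exact: measurable_funB.
by exists (M + N) => x; rewrite (le_trans (ler_normB _ _))// lerD.
Qed.

Lemma bmM g h : bounded_measurable g -> bounded_measurable h ->
  bounded_measurable (fun x => g x * h x).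
Proof.
move=> [mg [M gM]] [mh [N hN]]; split; first exact: measurable_funM.
by exists (M * N) => x; rewrite normrM ler_pM.
Qed.

Lemma bm_cst c : bounded_measurable (fun=> c).
Proof. by split=> //; exists `|c|. Qed.

Lemma bm_indic A : measurable A -> bounded_measurable (\1_A : T -> R).
Proof.
move=> mA; split; first exact: measurable_indic.
by exists 1 => x; rewrite indicE ger0_norm// lern1 leq_b1.
Qed.

Lemma bm_cprob (L : countType) (r : T -> L) A :
  mlabel r -> measurable A -> bounded_measurable (cprob nu A r).
Proof.
move=> mr mA; split; first exact: adapted_measurable mr (@cprob_adapted _ _ _ _ _ A r).
exists 1 => x; have /andP[c0 c1] := cprob_itv nu x mr mA.
by rewrite ger0_norm.
Qed.

Lemma bm_RintegralD g h : bounded_measurable g -> bounded_measurable h ->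
  \int[nu]_x (g x + h x) = \int[nu]_x g x + \int[nu]_x h x.
Proof. by move=> bg bh; rewrite RintegralD//; exact: bm_integrable. Qed.

Lemma bm_RintegralB g h : bounded_measurable g -> bounded_measurable h ->
  \int[nu]_x (g x - h x) = \int[nu]_x g x - \int[nu]_x h x.
Proof. by move=> bg bh; rewrite RintegralB//; exact: bm_integrable. Qed.

Lemma bm_RintegralE h : bounded_measurable h ->
  ((\int[nu]_x h x)%:E = \int[nu]_x (h x)%:E)%E.
Proof.
by move=> bh; rewrite /Rintegral fineK//; exact: integrable_fin_num (bm_integrable bh).
Qed.

Lemma bm_le_Rintegral g h : bounded_measurable g -> bounded_measurable h ->
  (forall x, g x <= h x) -> \int[nu]_x g x <= \int[nu]_x h x.
Proof. by move=> bg bh gh; apply: le_Rintegral => //; exact: bm_integrable. Qed.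

(** A bounded h becomes nonnegative after the addition of a constant. *)
Lemma Rintegral_cprob (L : countType) (r : T -> L) (A : set T) h :
  mlabel r -> measurable A -> adapted r h -> bounded_measurable h ->
  \int[nu]_x (cprob nu A r x * h x) = \int[nu]_x (\1_A x * h x).
Proof.
move=> mr mA rh bh; have [_ [M hM]] := bh.
have bA := bm_indic mA.
have bc := bm_cprob mr mA.
have bM := bm_cst M.
have pos g : adapted r g -> bounded_measurable g -> (forall x, 0 <= g x) ->
    \int[nu]_x (cprob nu A r x * g x) = \int[nu]_x (\1_A x * g x).
  move=> rg bg g0; apply/EFin_inj; rewrite !bm_RintegralE; last 2 first.
  - exact: bmM.
  - exact: bmM.
  by rewrite (ge0_cprobE nu mr mA rg g0).
have := pos (fun x => h x + M).
have -> : \int[nu]_x (cprob nu A r x * (h x + M)) =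
    \int[nu]_x (cprob nu A r x * h x) + \int[nu]_x (cprob nu A r x * M).
  rewrite -bm_RintegralD; [|exact: bmM|exact: bmM].
  by apply: eq_Rintegral => x _; rewrite mulrDr.
have -> : \int[nu]_x (\1_A x * (h x + M)) =
    \int[nu]_x (\1_A x * h x) + \int[nu]_x (\1_A x * M).
  rewrite -bm_RintegralD; [|exact: bmM|exact: bmM].
  by apply: eq_Rintegral => x _; rewrite mulrDr.
rewrite (pos (fun=> M))//; last first.
  by move=> x; rewrite (le_trans _ (hM x)).
move=> /(_ _ _ _)/addIr; apply.
- by move=> x y rxy; rewrite (rh _ _ rxy).
- exact: bmD.
- by move=> x; rewrite -lerBlDr sub0r; have := hM x; rewrite ler_norml => /andP[].
Qed.

End bounded_measurable_functions.

(** * Convergence along increasing partitions *)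

Section upward_convergence.
Context d (T : measurableType d) (R : realType) (nu : probability T R).
Variables (L : countType) (r : nat -> T -> L).
Hypothesis mr : forall n, mlabel (r n).
Hypothesis refine : forall n x y, r n.+1 x = r n.+1 y -> r n x = r n y.
Variables (A : set T) (mA : measurable A).

Let c n := cprob nu A (r n).
Let bc n : bounded_measurable (c n) := bm_cprob nu (mr n) mA.
Let rc n : adapted (r n) (c n).
Proof. exact: cprob_adapted. Qed.

Lemma refine_le m n x y : (m <= n)%N -> r n x = r n y -> r m x = r m y.
Proof.
elim: n => [|n IH]; first by rewrite leqn0 => /eqP ->.
by rewrite leq_eqVlt => /predU1P[-> //|/IH{}IH /refine].
Qed.

(** The martingale property. *)
Let c_tower m n h : (m <= n)%N -> adapted (r m) h -> bounded_measurable h ->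
  \int[nu]_x (c n x * h x) = \int[nu]_x (c m x * h x).
Proof.
move=> mn rh bh; rewrite !Rintegral_cprob//.
by move=> x y /(refine_le mn)/rh.
Qed.

Let e n := \int[nu]_x (c n x ^+ 2).

Let bsq (h : T -> R) : bounded_measurable h -> bounded_measurable (fun x => h x ^+ 2).
Proof. by move=> bh; exact: bmM. Qed.

(** Orthogonality of martingale increments. *)
Let c_sq m n : (m <= n)%N -> \int[nu]_x ((c n x - c m x) ^+ 2) = e n - e m.
Proof.
move=> mn.
transitivity (\int[nu]_x (c n x ^+ 2 - (c n x * c m x + c n x * c m x - c m x * c m x))).
  by apply: eq_Rintegral => x _; ring.
have b1 : bounded_measurable (fun x => c n x * c m x) by exact: bmM.
have b2 : bounded_measurable (fun x => c m x * c m x) by exact: bmM.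
have b3 := bmD b1 b1.
rewrite bm_RintegralB ?bm_RintegralB ?bm_RintegralD//; [|exact: bsq|exact: bmB].
rewrite (@c_tower m n)// /e; congr (_ - _).
rewrite (_ : \int[nu]_x (c m x ^+ 2) = \int[nu]_x (c m x * c m x)) ?addrK//.
Qed.

Let e_nd : nondecreasing_seq e.
Proof.
move=> m n mn; rewrite -subr_ge0 -c_sq//; apply: Rintegral_ge0 => x _.
exact: sqr_ge0.
Qed.

Let e_cvg : cvgn e.
Proof.
apply: (nondecreasing_is_cvgn e_nd); exists 1 => _ [n _ <-].
have -> : (1 : R) = \int[nu]_x (1 : R).
  by rewrite /Rintegral integral_cst// mul1e probability_mass.
apply: bm_le_Rintegral; [exact: bsq|exact: bm_cst|move=> x].
have /andP[c0 c1] := cprob_itv nu x (mr n) mA.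
by rewrite exprn_ile1.
Qed.

Let U (m n : nat) (lam : R) : set T :=
  \bigcup_(k in [set k | (m <= k <= n)%N]) [set x | lam <= `|c k x - c m x|].

Let mU m n lam : measurable (U m n lam).
Proof.
apply: bigcup_measurable => k _.
rewrite -[X in measurable X]setTI.
apply: (@measurable_fun_le _ _ _ setT (cst lam) (fun x => `|c k x - c m x|)) => //.
apply: measurableT_comp => //.
by apply: measurable_funB; [case: (bc k)|case: (bc m)].
Qed.

Let U_adapted m n lam : adapted (r n) (\1_(U m n lam) : T -> R).
Proof.
have UU x y : r n x = r n y -> U m n lam x -> U m n lam y.
  move=> rxy [k /= /andP[mk kn] ck]; exists k => /=; first by rewrite mk.
  by rewrite -(rc (refine_le kn rxy)) -(rc (refine_le (leq_trans mk kn) rxy)).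
move=> x y rxy; rewrite !indicE; congr (nat_of_bool _)%:R.
by apply/idP/idP => /set_mem/UU h; apply/mem_set/h.
Qed.

(** Kolmogorov's inequality. By induction on n: the integral over the old set
    grows, as the increments are orthogonal, and each point that enters at the
    last step contributes at least lam^2. *)
Let maximal m n (lam : R) : 0 < lam -> (m <= n)%N ->
  lam ^+ 2 * fine (nu (U m n lam)) <=
  \int[nu]_x (\1_(U m n lam) x * (c n x - c m x) ^+ 2).
Proof.
move=> lam0; have E1 B : measurable B -> fine (nu B) = \int[nu]_x (\1_B x : R).
  by move=> mB; rewrite /Rintegral integral_indic// setIT.
have bU k : bounded_measurable (\1_(U m k lam) : T -> R) by exact: bm_indic.
elim: n => [|n IH].
  rewrite leqn0 => /eqP m0; rewrite (_ : U _ _ _ = set0).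
    rewrite measure0 mulr0; apply: Rintegral_ge0 => x _.
    by rewrite mulr_ge0// sqr_ge0.
  apply/seteqP; split=> // x [k /= /andP[_]]; rewrite leqn0 m0 => /eqP ->.
  by rewrite subrr normr0 leNgt lam0.
rewrite leq_eqVlt => /predU1P[mn|mn].
  rewrite (_ : U _ _ _ = set0).
    rewrite measure0 mulr0; apply: Rintegral_ge0 => x _.
    by rewrite mulr_ge0// sqr_ge0.
  apply/seteqP; split=> // x [k /=]; rewrite -mn -eqn_leq => /eqP ->.
  by rewrite subrr normr0 leNgt lam0.
have {}mn : (m <= n)%N by [].
have {}IH := IH mn.
have bd k : bounded_measurable (fun x => c k x - c m x) by exact: bmB.
have bUd j k : bounded_measurable (fun x => \1_(U m j lam) x * (c k x - c m x) ^+ 2).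
  by apply: bmM => //; exact: bsq.
(* the martingale property makes the mixed term vanish *)
have step : \int[nu]_x (\1_(U m n lam) x * (c n x - c m x) ^+ 2) <=
    \int[nu]_x (\1_(U m n lam) x * (c n.+1 x - c m x) ^+ 2).
  pose h x := \1_(U m n lam) x * (c n x - c m x) *+ 2.
  have bh : bounded_measurable h.
    rewrite (_ : h = fun x => \1_(U m n lam) x * (c n x - c m x)
                            + \1_(U m n lam) x * (c n x - c m x)).
      by apply: bmD; exact: bmM.
    by apply/funext => x; rewrite /h mulr2n mulrDr.
  have rh : adapted (r n) h.
    move=> x y rxy; rewrite /h (U_adapted m lam rxy) (rc rxy).
    by rewrite (rc (refine_le mn rxy)).
  have := c_tower (leqnSn n) rh bh.
  move=> /eqP; rewrite -subr_eq0 -bm_RintegralB; [|exact: bmM|exact: bmM].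
  move=> /eqP h0; rewrite -[leLHS]addr0 -h0 -bm_RintegralD; [|by []|].
    apply: bm_le_Rintegral => //.
      by apply: bmD => //; apply: bmB; exact: bmM.
    move=> x; rewrite /h.
    have : (0 : R) <= \1_(U m n lam) x * (c n.+1 x - c n x) ^+ 2.
      by rewrite mulr_ge0// sqr_ge0.
    rewrite -mulr_natl; lra.
  by apply: bmB; exact: bmM.
have bl k : bounded_measurable (fun x => lam ^+ 2 * \1_(U m k lam) x).
  by apply: bmM => //; exact: bm_cst.
have scale k : \int[nu]_x (lam ^+ 2 * \1_(U m k lam) x) =
    lam ^+ 2 * fine (nu (U m k lam)).
  by rewrite RintegralZl ?E1//; exact: bm_integrable.
have : \int[nu]_x (\1_(U m n lam) x * (c n.+1 x - c m x) ^+ 2 +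
          (lam ^+ 2 * \1_(U m n.+1 lam) x - lam ^+ 2 * \1_(U m n lam) x)) <=
    \int[nu]_x (\1_(U m n.+1 lam) x * (c n.+1 x - c m x) ^+ 2).
  apply: bm_le_Rintegral => //; first by apply: bmD => //; exact: bmB.
  move=> x; rewrite !indicE.
  have [Unx|Unx] := pselect (U m n lam x).
    rewrite (mem_set Unx) (_ : x \in U m n.+1 lam); first by rewrite !mul1r subrr addr0.
    apply/mem_set; case: Unx => k /= /andP[mk kn] ck.
    by exists k => //=; rewrite mk (leq_trans kn).
  rewrite (memNset Unx) mul0r add0r mulr0 subr0.
  have [Ux|Ux] := pselect (U m n.+1 lam x); last by rewrite (memNset Ux) mulr0 mul0r.
  rewrite (mem_set Ux) mulr1 mul1r.
  case: Ux => k /= /andP[mk]; rewrite leq_eqVlt ltnS => /predU1P[->|kn] ck.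
    by rewrite -[leRHS]real_normK ?num_real// ler_sqr ?nnegrE// ltW.
  by exfalso; apply: Unx; exists k => //=; rewrite mk.
rewrite bm_RintegralD ?bm_RintegralB ?scale//; last by apply: bmB.
by move: IH step; lra.
Qed.

Let unsettled (lam : R) : set T :=
  \bigcap_m \bigcup_(n in [set n | (m <= n)%N]) [set x | lam <= `|c n x - c m x|].

Let measurable_unsettled lam : measurable (unsettled lam).
Proof.
apply: bigcap_measurable => // m _; apply: bigcup_measurable => n _.
rewrite -[X in measurable X]setTI.
apply: (@measurable_fun_le _ _ _ setT (cst lam)) => //.
apply: measurableT_comp => //.
by apply: measurable_funB; [case: (bc n)|case: (bc m)].
Qed.

Let unsettled0 (lam : R) : 0 < lam -> nu (unsettled lam) = 0%E.
Proof.
move=> lam0.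
have mV m : measurable (\bigcup_n U m n lam) by exact: bigcup_measurable.
have Uunsettled m : unsettled lam `<=` \bigcup_n U m n lam.
  move=> x /(_ m I)[n /= mn cx]; exists n => //; exists n => //=.
  by rewrite mn leqnn.
have mW := measurable_unsettled lam.
have bound m : (nu (unsettled lam) <= ((limn e - e m) / lam ^+ 2)%:E)%E.
  apply: (@le_trans _ _ (nu (\bigcup_n U m n lam))).
    by apply: le_measure; rewrite ?inE.
  have nd : nondecreasing_seq (U m ^~ lam).
    move=> k n kn; apply/subsetPset => x [j /= /andP[mj jk] cj].
    by exists j => //=; rewrite mj (leq_trans jk).
  have cvgU := @nondecreasing_cvg_mu _ _ _ nu _ (fun n => mU m n lam) (mV m) nd.
  rewrite -(cvg_lim _ cvgU)//; apply: lime_le; first exact: cvgP cvgU.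
  exists m => // n /= mn; rewrite -[leLHS]fineK ?fin_num_measure// lee_fin.
  rewrite ler_pdivlMr ?exprn_gt0// mulrC.
  apply: (le_trans (maximal lam0 mn)).
  apply: (@le_trans _ _ (e n - e m)); last first.
    by rewrite lerD2r; exact: nondecreasing_cvgn_le.
  rewrite -c_sq//; apply: bm_le_Rintegral.
  - by apply: bmM; [exact: bm_indic|apply: bsq; exact: bmB].
  - by apply: bsq; exact: bmB.
  - by move=> x; rewrite ler_piMl ?sqr_ge0// indicE lern1 leq_b1.
have lim0 : ((limn e - e m) / lam ^+ 2) @[m --> \oo] --> (0 : R).
  rewrite -[X in _ --> X](mul0r (lam ^+ 2)^-1); apply: cvgMr_tmp.
  by rewrite -[X in _ --> X](subrr (limn e)); apply: cvgB => //; exact: cvg_cst.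
apply/eqP; rewrite eq_le measure_ge0 andbT -[leLHS]fineK ?fin_num_measure// lee_fin.
rewrite -(cvg_lim _ lim0)//; apply: limr_ge; first exact: cvgP lim0.
by near=> m; rewrite -lee_fin fineK ?fin_num_measure.
Unshelve. all: by end_near. Qed.

(** The squared L2 norms e n are bounded and increasing, so that the
    martingale moves little in L2 after a late time m; by the maximal
    inequality it then rarely oscillates by more than a given amount. *)
Lemma cprob_cvg_ae : {ae nu, forall x, cvgn (c ^~ x)}.
Proof.
have N0 : nu.-negligible (\bigcup_k unsettled k.+1%:R^-1).
  apply: negligible_bigcup => k; exists (unsettled k.+1%:R^-1); split=> //.
  by apply: unsettled0; rewrite invr_gt0.
apply: negligibleS N0 => x /=.
apply: contra_notP => xU; apply/cauchy_cvgP/cauchy_exP => eps eps0.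
have [k keps] : exists k, k.+1%:R^-1 < eps.
  by exists (Num.truncn eps^-1); rewrite invf_plt ?posrE// truncnS_gt.
have : ~ unsettled k.+1%:R^-1 x by move=> xk; apply: xU; exists k.
move=> /asboolPn/existsp_asboolPn[m].
move=> /asboolPn/imply_asboolPn[_ small].
exists (c m x); exists m => // n /= mn; rewrite /ball/=.
have [le_n|lt_n] := leP k.+1%:R^-1 `|c n x - c m x|.
  by exfalso; apply: small; exists n.
by rewrite distrC (lt_trans lt_n).
Qed.

End upward_convergence.

(** * Versions of conditional expectations *)

Lemma ae_countable d (T : measurableType d) (R : realType)
    (mu : {measure set T -> \bar R}) (C : countType) (P : C -> T -> Prop) :
  (forall c, {ae mu, forall x, P c x}) -> {ae mu, forall x, forall c, P c x}.
Proof.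
move=> aeP.
have : {ae mu, forall x, forall n : nat,
    if unpickle n is Some c then P c x else True}.
  by apply/ae_foralln => n; case: unpickle => [c|]; [exact: aeP|exact: aeW].
by apply: filterS => x Px c; have := Px (pickle c); rewrite pickleK.
Qed.

Section conditional_expectation.
Context d (T : measurableType d) (R : realType) (nu : probability T R).
Variable G : set (set T).
Hypotheses (Gm : G `<=` measurable) (GT : G setT) (GI : setI_closed G).
Implicit Types f g : T -> \bar R.

Lemma is_condexp_measurable f g : is_condexp nu G f g -> measurable_fun setT g.
Proof. by move=> [mg _] _ B mB; rewrite setTI; apply/Gm/mg. Qed.

Lemma is_condexp_integrable f g : nu.-integrable setT f -> is_condexp nu G f g ->
  nu.-integrable setT g.
Proof.
move=> intf cg; apply/integrableP.
have mg := is_condexp_measurable cg.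
split=> //; apply/abse_integralP => //; rewrite cg.2// -ge0_fin_numE//.
by rewrite fin_num_abs; have := integrable_fin_num measurableT intf; rewrite fin_num_abs abse_id.
Qed.

(** For rationals q < q', the set where g1 <= q and q' <= g2 belongs to G; as
    g1 and g2 have the same integral over it, it is a null set. *)
Lemma is_condexp_le f g1 g2 : nu.-integrable setT f ->
  is_condexp nu G f g1 -> is_condexp nu G f g2 -> {ae nu, forall x, (g2 x <= g1 x)%E}.
Proof.
move=> intf c1 c2.
have i1 := is_condexp_integrable intf c1.
have i2 := is_condexp_integrable intf c2.
have slice (q : rat * rat) : {ae nu, forall x, ratr q.1 < ratr q.2 :> R ->
    (g1 x <= (ratr q.1)%:E)%E -> ((ratr q.2)%:E <= g2 x)%E -> False}.
  have [lt_q|] := boolP (ratr q.1 < ratr q.2 :> R); last by move=> ?; exact: aeW.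
  pose A := [set x | (g1 x <= (ratr q.1)%:E)%E] `&` [set x | ((ratr q.2)%:E <= g2 x)%E].
  have GA : G A.
    apply: GI.
      have -> : [set x | (g1 x <= (ratr q.1)%:E)%E] = g1 @^-1` [set` `]-oo, (ratr q.1)%:E]].
        by apply/seteqP; split=> x; rewrite /= in_itv.
      by apply: c1.1; exact: emeasurable_itv.
    have -> : [set x | ((ratr q.2)%:E <= g2 x)%E] = g2 @^-1` [set` `[(ratr q.2)%:E, +oo[].
      by apply/seteqP; split=> x; rewrite /= in_itv/= andbT.
    by apply: c2.1; exact: emeasurable_itv.
  have mA := Gm GA.
  have : ((ratr q.2)%:E * nu A <= (ratr q.1)%:E * nu A)%E.
    rewrite -!integral_cst//.
    apply: (@le_trans _ _ (\int[nu]_(x in A) g2 x)%E).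
      apply: le_integral => //; first exact: finite_measure_integrable_cst.
        exact: integrableS i2.
      by move=> x /set_mem[].
    rewrite (c2.2 _ GA) -(c1.2 _ GA).
    apply: le_integral => //; last by move=> x /set_mem[].
      exact: integrableS i1.
    exact: finite_measure_integrable_cst.
  have fA : nu A \is a fin_num by exact: fin_num_measure.
  rewrite -(fineK fA) -!EFinM lee_fin -subr_le0 -mulrBl pmulr_rle0 ?subr_gt0// => A0.
  exists A; split=> //.
    by apply/eqP; rewrite eq_le measure_ge0 andbT -(fineK fA) lee_fin.
  move=> x /= /not_implyP[_] /not_implyP[h1] /not_implyP[h2 _].
  by split.
have := ae_countable slice.
have f1 := integrable_ae measurableT i1.
have f2 := integrable_ae measurableT i2.
apply: filterS3 f1 f2 => x /(_ I) f1 /(_ I) f2 sl.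
rewrite leNgt; apply/negP => lt12.
move: lt12 (sl); rewrite -(fineK f1) -(fineK f2) lte_fin => lt12 {}sl.
have [q] := rat_in_itvoo lt12; rewrite in_itv/= => /andP[q1 q2].
have [q'] := rat_in_itvoo q2; rewrite in_itv/= => /andP[qq' q'2].
by apply: (sl (q, q')) => //=; rewrite lee_fin ltW.
Qed.

Lemma condexp_ae f g : nu.-integrable setT f -> is_condexp nu G f g ->
  {ae nu, forall x, condexp nu G f x = g x}.
Proof.
move=> intf cg.
have cc : is_condexp nu G f (condexp nu G f) by apply: xgetPex; exists g.
have := is_condexp_le intf cc cg; have := is_condexp_le intf cg cc.
by apply: filterS2 => x le1 le2; apply/eqP; rewrite eq_le le1.
Qed.

End conditional_expectation.

Lemma limn_esup_itv (R : realType) (u : (\bar R)^nat) (a b : \bar R) :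
  (forall n, a <= u n <= b)%E -> (a <= limn_esup u <= b)%E.
Proof.
move=> uab; rewrite limn_esup_lim; apply/andP; split.
  apply: lime_ge; first exact: is_cvg_esups.
  apply: nearW => n; have /andP[an _] := uab n.
  by apply: (le_trans an); apply: ereal_sup_ubound; exists n => /=.
apply: lime_le; first exact: is_cvg_esups.
apply: nearW => n; apply: ge_ereal_sup => _ [k _ <-].
by have /andP[] := uab k.
Qed.

Lemma integral_EFin_indic d (T : measurableType d) (R : realType)
    (mu : {measure set T -> \bar R}) (B : set T) (h : T -> R) :
  (\int[mu]_(x in B) (h x)%:E = \int[mu]_x (h x * \1_B x)%:E)%E.
Proof.
rewrite integral_mkcond; apply: eq_integral => x _.
by rewrite patchE indicE; case: ifP; rewrite ?mulr1 ?mulr0.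
Qed.

Section upward_limit.
Context d (T : measurableType d) (R : realType) (nu : probability T R).
Variables (L : countType) (r : nat -> T -> L).
Hypothesis mr : forall n, mlabel (r n).
Hypothesis refine : forall n x y, r n.+1 x = r n.+1 y -> r n x = r n y.
Variables (A : set T) (mA : measurable A).

(** An upper limit is measurable and has its values in [0, 1] also where the
    conditional probabilities diverge. *)
Definition cprob_lim x : R := fine (limn_esup (fun n => (cprob nu A (r n) x)%:E)).

Let c n := cprob nu A (r n).

Lemma cprob_lim_esup x :
  limn_esup (fun n => (cprob nu A (r n) x)%:E) = (cprob_lim x)%:E /\ 0 <= cprob_lim x <= 1.
Proof.
have c01 n := cprob_itv nu x (mr n) mA.
have /andP[l0 l1] : (0 <= limn_esup (fun n => (cprob nu A (r n) x)%:E) <= 1)%E.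
  by apply: limn_esup_itv => n; rewrite !lee_fin.
have lf : limn_esup (fun n => (cprob nu A (r n) x)%:E) \is a fin_num.
  by rewrite ge0_fin_numE// (le_lt_trans l1)// ltry.
rewrite /cprob_lim fineK//; split=> //.
by rewrite -!lee_fin fineK// l0.
Qed.

Lemma cprob_limE x : cvgn (c ^~ x) -> c ^~ x @ \oo --> cprob_lim x.
Proof.
move=> cx.
rewrite /cprob_lim.
have cE : (fun n => (c n x)%:E) @ \oo --> (limn (c ^~ x))%:E.
  by apply: cvg_EFin => //; exact: nearW.
by rewrite (cvg_limn_einf_sup cE).
Qed.

Variables (GG : set (set T)).
Hypothesis GGr : forall B, GG B -> exists n S, B = r n @^-1` S.
Hypothesis rGG : forall n S, <<s GG >> (r n @^-1` S).

Let GGm : <<s GG >> `<=` measurable.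
Proof.
apply: smallest_sub; first exact: sigma_algebra_measurable.
by move=> B /GGr[n [S ->]]; exact: mr.
Qed.

Let cprob_lim_preimage (B : set \bar R) : measurable B ->
  <<s GG >> ((fun x => (cprob_lim x)%:E) @^-1` B).
Proof.
move=> mB.
have mc n : measurable_fun setT ((fun x => (c n x)%:E) : g_sigma_algebraType GG -> \bar R).
  move=> _ C mC; rewrite setTI.
  have -> : (fun x => (c n x)%:E) @^-1` C = r n @^-1` (r n @` ((fun x => (c n x)%:E) @^-1` C)).
    apply/seteqP; split=> x /=; first by exists x.
    by move=> [y /= Cy rxy]; rewrite /c -(cprob_adapted nu A rxy).
  exact: rGG.
have := measurable_fun_limn_esup mc.
move=> /(_ measurableT _ mB); rewrite setTI.
rewrite (_ : (fun x => limn_esup _) = (fun x => (cprob_lim x)%:E))//.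
by apply/funext => x; case: (cprob_lim_esup x).
Qed.

Lemma measurable_cprob_lim : measurable_fun setT cprob_lim.
Proof.
apply/measurable_EFinP => _ B mB; rewrite setTI.
by apply: GGm; exact: cprob_lim_preimage.
Qed.

(** Over a block of r m the integrals of cprob nu A (r n) do not depend on n
    >= m, and dominated convergence passes to the limit. These blocks form a
    pi-system, and the sets over which two bounded functions have the same
    integral form a lambda-system. *)
Lemma cprob_lim_condexp :
  is_condexp nu <<s GG >> (fun x => (\1_A x)%:E) (fun x => (cprob_lim x)%:E).
Proof.
split=> [|B GB]; first exact: cprob_lim_preimage.
have mg := measurable_cprob_lim.
have bg : bounded_measurable cprob_lim.
  split=> //; exists 1 => x; have [_ /andP[g0 g1]] := cprob_lim_esup x.
  by rewrite ger0_norm.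
have ig := bm_integrable nu bg.
have iA := bm_integrable nu (bm_indic R mA).
pose H := [set B | measurable B /\
  \int[nu]_(x in B) (cprob_lim x)%:E = \int[nu]_(x in B) (\1_A x)%:E]%E.
suff : <<s GG >> `<=` H by move=> /(_ _ GB)[].
pose K := [set B | exists n S, B = r n @^-1` S].
suff KH : <<s K >> `<=` H.
  apply: subset_trans KH; apply: sub_sigma_algebra2 => C /GGr; exact.
have KI : setI_closed K.
  move=> _ _ [m [S ->]] [n [S' ->]].
  exists (maxn m n), (r (maxn m n) @` (r m @^-1` S `&` r n @^-1` S')).
  apply/seteqP; split=> x /=; first by exists x.
  move=> [y /= [Sy S'y] rxy].
  rewrite -(refine_le refine (leq_maxl m n) rxy).
  by rewrite -(refine_le refine (leq_maxr m n) rxy).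
have KH : K `<=` H.
  move=> _ [m [S ->]]; split; first exact: mr.
  have mS := mr m S; set B' := r m @^-1` S in mS *.
  have stable n : (m <= n)%N ->
      (\int[nu]_(x in B') (c n x)%:E = \int[nu]_(x in B') (\1_A x)%:E)%E.
    move=> mn; rewrite (integral_EFin_indic nu B' (c n)).
    rewrite (integral_EFin_indic nu B' (\1_A)) -ge0_cprobE//.
    move=> x y /(refine_le refine mn) rxy; rewrite !indicE.
    congr (nat_of_bool _)%:R.
    by apply/idP/idP => /set_mem Bx; apply/mem_set; move: Bx; rewrite /B'/= rxy.
  have mc n : measurable_fun B' (fun x => (c n x)%:E).
    apply/measurable_EFinP/measurable_funTS.
    exact: adapted_measurable (mr n) (@cprob_adapted _ _ _ _ _ A (r n)).
  have mgB : measurable_fun B' (fun x => (cprob_lim x)%:E).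
    exact/measurable_EFinP/measurable_funTS.
  have i1 : nu.-integrable B' (EFin \o cst 1%R) by exact: finite_measure_integrable_cst.
  have [] := dominated_convergence mS mc mgB _ i1 _.
  - apply: filterS (cprob_cvg_ae nu mr refine mA) => x cx _.
    by apply: cvg_EFin; [exact: nearW|exact: cprob_limE].
  - apply: aeW => x n _; have /andP[c0 c1] := cprob_itv nu x (mr n) mA.
    by rewrite /= lee_fin ger0_norm.
  move=> _ _ cvg_int.
  apply: (cvg_unique _ cvg_int) => //.
  apply: cvg_near_cst; exists m => // n /= mn; exact: stable.
have g0 x : (0 <= (cprob_lim x)%:E)%E.
  by have [_ /andP[]] := cprob_lim_esup x; rewrite lee_fin.
have A0 x : (0 <= (\1_A x : R)%:E)%E by rewrite lee_fin.
have mgE : measurable_fun setT (fun x => (cprob_lim x)%:E) by exact/measurable_EFinP.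
have mAE : measurable_fun setT (fun x => (\1_A x : R)%:E).
  by apply/measurable_EFinP; exact: measurable_indic.
apply: lambda_system_subset => //; split=> //.
- by apply: KH; exists 0%N, setT.
- move=> C D DC [mC hC] [mD hD]; split; first exact: measurableD.
  have mCD := measurableD mC mD.
  have CE : C = (C `\` D) `|` D by rewrite setUC setDUK.
  have dj : [disjoint C `\` D & D].
    by apply/disj_setPS => x [[_ nD] Dx]; exact: nD.
  have : (\int[nu]_(x in (C `\` D) `|` D) (cprob_lim x)%:E =
          \int[nu]_(x in (C `\` D) `|` D) (\1_A x)%:E)%E by rewrite -CE.
  rewrite !ge0_integral_setU//; [|exact: measurable_funTS..].
  rewrite hD => hCD.
  have fD : (\int[nu]_(x in D) (\1_A x)%:E)%E \is a fin_num.
    by apply: integrable_fin_num => //; exact: integrableS iA.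
  by rewrite -[LHS](@addeK _ _ _ fD) hCD addeK.
- move=> F ndF HF; have mF n : measurable (F n) by case: (HF n).
  split; first exact: bigcup_measurable.
  have cg := @ge0_nondecreasing_set_cvg_integral _ _ _ F
    (fun x => (cprob_lim x)%:E) nu ndF mF (fun n => measurable_funTS mgE) (fun _ x _ => g0 x).
  have cA := @ge0_nondecreasing_set_cvg_integral _ _ _ F
    (fun x => (\1_A x)%:E) nu ndF mF (fun n => measurable_funTS mAE) (fun _ x _ => A0 x).
  have E : (fun i => \int[nu]_(x in F i) (cprob_lim x)%:E)%E =
      (fun i => \int[nu]_(x in F i) (\1_A x)%:E)%E.
    by apply/funext => i; exact: (HF i).2.
  by rewrite E in cg; apply: cvg_unique cg cA.
Qed.

Lemma condprob_ae : {ae nu, forall x, condprob nu A <<s GG >> x = (cprob_lim x)%:E}.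
Proof.
apply: condexp_ae => //.
- by rewrite -(preimage_setT (r 0%N)); exact: rGG.
- by move=> B C; exact: (@measurableI _ (g_sigma_algebraType GG)).
- exact/(bm_integrable nu)/bm_indic.
- exact: cprob_lim_condexp.
Qed.

End upward_limit.

(** * Garsia's maximal ergodic inequality *)

Section measurability_helpers.
Context d (T : measurableType d) (R : realType).
Implicit Types f g : T -> R.

Lemma measurable_set_le f g : measurable_fun setT f -> measurable_fun setT g ->
  measurable [set x | f x <= g x].
Proof.
by move=> mf mg; rewrite -[X in measurable X]setTI; exact: measurable_fun_le.
Qed.

Lemma measurable_set_lt f g : measurable_fun setT f -> measurable_fun setT g ->
  measurable [set x | f x < g x].
Proof.
move=> mf mg; rewrite (_ : [set x | _] = ~` [set x | g x <= f x]).
  by apply: measurableC; exact: measurable_set_le.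
by apply/seteqP; split=> x /=; rewrite ltNge => /negP.
Qed.

Lemma integrable_EFin_measurable (mu : {measure set T -> \bar R}) D f :
  mu.-integrable D (EFin \o f) -> measurable_fun D f.
Proof. by move/measurable_int/measurable_EFinP. Qed.

End measurability_helpers.

Section measure_preserving_integrals.
Context d (T : measurableType d) (R : realType) (mu : probability T R).
Variables (S : T -> T) (mS : measurable_fun setT S) (muS : invariant_measure mu S).

Lemma measurable_iter k : measurable_fun setT (iter k S).
Proof.
elim: k => [|k IH]; first exact: measurable_id.
exact: (measurableT_comp mS IH).
Qed.

Lemma ge0_integral_invariant (f : T -> \bar R) :
  measurable_fun setT f -> (forall x, 0 <= f x)%E ->
  (\int[mu]_x f (S x) = \int[mu]_x f x)%E.
Proof.
move=> mf f0.
have := @ge0_integral_pushforward _ _ T T R S mS mu setT f measurableT mf.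
rewrite preimage_setT => <-; last by move=> x _; exact: f0.
apply: eq_measure_integral => A mA _; exact: muS.
Qed.

Lemma integrable_invariant (f : T -> \bar R) :
  mu.-integrable setT f -> mu.-integrable setT (f \o S).
Proof.
move=> /integrableP[mf fi]; apply/integrableP; split.
  exact: measurableT_comp.
have mabs : measurable_fun setT (abse \o f) by exact: measurableT_comp.
by have /= -> := ge0_integral_invariant mabs (fun x => abse_ge0 _).
Qed.

Lemma ae_invariant (Q : T -> Prop) :
  {ae mu, forall x, Q x} -> {ae mu, forall x, Q (S x)}.
Proof.
move=> [N [mN N0 QN]]; exists (S @^-1` N); split.
- by rewrite -[X in measurable X]setTI; exact: mS.
- by rewrite -N0; exact: muS.
- by move=> x /= nQ; apply: QN.
Qed.

End measure_preserving_integrals.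

Section maximal_ergodic_inequality.
Context d (T : measurableType d) (R : realType) (mu : probability T R).
Variables (S : T -> T) (mS : measurable_fun setT S) (muS : invariant_measure mu S).
Implicit Types (phi g : T -> R).

Definition birkhoff_sum phi n z := \sum_(k < n) phi (iter k S z).

Lemma birkhoff_sumS phi n z :
  birkhoff_sum phi n.+1 z = phi z + birkhoff_sum phi n (S z).
Proof.
rewrite /birkhoff_sum big_ord_recl; congr (_ + _).
by apply: eq_bigr => i _; rewrite lift0 iterSr.
Qed.

Lemma measurable_birkhoff_sum phi n :
  measurable_fun setT phi -> measurable_fun setT (birkhoff_sum phi n).
Proof.
move=> mphi; apply: measurable_sum => k.
exact: measurableT_comp mphi (measurable_iter mS k).
Qed.

(** The recursion produces max(0, S_1 g, ..., S_n g), and exhibits at once the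
    inequality g >= M_n - M_n o S on the set where M_n is positive. *)
Fixpoint max_birkhoff g n z :=
  if n is m.+1 then Num.max 0 (g z + max_birkhoff g m (S z)) else 0.

Lemma max_birkhoff_ge0 g n z : 0 <= max_birkhoff g n z.
Proof. by case: n => //= n; rewrite le_max lexx. Qed.

Lemma max_birkhoff_nd g n z : max_birkhoff g n z <= max_birkhoff g n.+1 z.
Proof.
elim: n z => [|n IH] z; first exact: max_birkhoff_ge0.
rewrite [leLHS]/= [leRHS]/= ge_max !le_max lexx/=.
by rewrite lerD2l IH orbT.
Qed.

Lemma birkhoff_sum_le_max g n z : birkhoff_sum g n z <= max_birkhoff g n z.
Proof.
elim: n z => [|n IH] z; first by rewrite /birkhoff_sum big_ord0.
by rewrite birkhoff_sumS /= le_max lerD2l IH orbT.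
Qed.

Lemma max_birkhoff_integrable g n : mu.-integrable setT (EFin \o g) ->
  mu.-integrable setT (EFin \o max_birkhoff g n).
Proof.
move=> ig; elim: n => [|n IH]; first exact: integrable0.
have iMS : mu.-integrable setT (EFin \o (fun z => max_birkhoff g n (S z))).
  exact: (integrable_invariant mS muS IH).
have isum := integrableD measurableT ig iMS.
apply: le_integrable isum => //.
  apply/measurable_EFinP => /=; apply: measurable_maxr => //.
  apply: measurable_funD; apply/measurable_EFinP; [exact: measurable_int ig|].
  exact: measurable_int iMS.
move=> z _; rewrite /= lee_fin ger0_norm ?le_max ?lexx//.
by rewrite ge_max normr_ge0 ler_norm.
Qed.

Let pos g n : set T := [set z | 0 < max_birkhoff g n z].

Let mpos g n : mu.-integrable setT (EFin \o g) -> measurable (pos g n).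
Proof.
move=> ig; apply: measurable_set_lt => //.
exact: integrable_EFin_measurable (max_birkhoff_integrable n ig).
Qed.

Let integral_pos_ge0 g n : mu.-integrable setT (EFin \o g) ->
  (0 <= \int[mu]_(z in pos g n) (g z)%:E)%E.
Proof.
move=> ig; case: n => [|n].
  rewrite (_ : pos g 0 = set0) ?integral_set0//.
  by apply/seteqP; split=> // z; rewrite /pos/= ltxx.
have iM := max_birkhoff_integrable n.+1 ig.
have iMS := integrable_invariant mS muS iM.
have mp := mpos n.+1 ig.
have ig1 : mu.-integrable setT (fun z => (g z * \1_(pos g n.+1) z)%:E).
  apply: (le_integrable measurableT _ _ ig) => //.
    apply/measurable_EFinP/measurable_funM; last exact: measurable_indic.
    exact: integrable_EFin_measurable ig.
  move=> z _; rewrite /= lee_fin normrM ler_piMr// indicE.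
  by rewrite ger0_norm// lern1 leq_b1.
rewrite integral_EFin_indic.
apply: (@le_trans _ _ (\int[mu]_z ((max_birkhoff g n.+1 z)%:E - (max_birkhoff g n.+1 (S z))%:E))%E).
  rewrite integralB_EFin//.
  have -> : (\int[mu]_z (max_birkhoff g n.+1 (S z))%:E = \int[mu]_z (max_birkhoff g n.+1 z)%:E)%E.
    apply: (ge0_integral_invariant mS muS (f := EFin \o max_birkhoff g n.+1)).
      exact: measurable_int iM.
    by move=> z; rewrite lee_fin max_birkhoff_ge0.
  by rewrite subee//; exact: integrable_fin_num iM.
apply: le_integral => //; first exact: integrableB.
move=> z _; rewrite -EFinB lee_fin indicE.
have [Mz|Mz] := ltP 0 (max_birkhoff g n.+1 z).
  rewrite mem_set// mulr1 lerBlDr.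
  apply: (@le_trans _ _ (g z + max_birkhoff g n (S z))); last first.
    by rewrite lerD2l max_birkhoff_nd.
  by move: Mz; rewrite /= lt_max ltxx/= => Mz; rewrite ge_max lexx ltW.
rewrite memNset ?mulr0; last by rewrite /pos/= ltNge Mz.
by rewrite subr_le0 (le_trans Mz) ?max_birkhoff_ge0.
Qed.

(** Garsia's argument: integrating g >= M_n - M_n o S over the set where
    M_n = max_birkhoff g n is positive leaves at least the integral of
    M_n - M_n o S over the whole space, which is 0; then n tends to infinity. *)
Lemma maximal_ergodic g : mu.-integrable setT (EFin \o g) ->
  (0 <= \int[mu]_(z in [set z | exists n, (0 < max_birkhoff g n z)%R]) (g z)%:E)%E.
Proof.
move=> ig; have mp n := mpos n ig.
have mg : measurable_fun setT g by exact: integrable_EFin_measurable ig.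
have -> : [set z | exists n, (0 < max_birkhoff g n z)%R] = \bigcup_n pos g n.
  by apply/seteqP; split=> z [n]; [move=> ?; exists n|move=> _ ?; exists n].
have mU : measurable (\bigcup_n pos g n) by exact: bigcup_measurable.
have cvg_int : (\int[mu]_z (g z * \1_(pos g n) z)%:E)%E @[n --> \oo] -->
    (\int[mu]_z (g z * \1_(\bigcup_n pos g n) z)%:E)%E.
  apply: (@dominated_cvg _ _ _ mu setT measurableT _ _ (fun z => `|(g z)%:E|%E)).
  - move=> n; apply/measurable_EFinP/measurable_funM => //; exact: measurable_indic.
  - move=> z _; apply: cvg_EFin; first exact: nearW.
    rewrite /=.
    have [Uz|Uz] := pselect ((\bigcup_n pos g n) z); last first.
      apply: cvg_near_cst; apply: nearW => n; rewrite /= !indicE !memNset//.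
      by move=> pz; apply: Uz; exists n.
    have [m _ pm] := Uz.
    apply: cvg_near_cst; exists m => // n /= mn; rewrite !indicE !mem_set//.
    elim: n mn => [|n IH]; first by rewrite leqn0 => /eqP <-.
    rewrite leq_eqVlt => /predU1P[<-//|/IH]; rewrite /pos/= => /lt_le_trans; apply.
    exact: max_birkhoff_nd.
  - by [].
  - exact: integrable_abse.
  - move=> n z _; rewrite /= lee_fin normrM ler_piMr// indicE.
    by rewrite ger0_norm// lern1 leq_b1.
rewrite integral_EFin_indic -(cvg_lim _ cvg_int)//.
apply: lime_ge; first exact: cvgP cvg_int.
by apply: nearW => n; rewrite -integral_EFin_indic; exact: integral_pos_ge0.
Qed.

(** Garsia's inequality for phi - b, set to 0 outside of the invariant set B. *)
Lemma birkhoff_superlevel phi (B : set T) b : mu.-integrable setT (EFin \o phi) ->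
  measurable B -> S @^-1` B = B ->
  (forall z, B z -> exists n, n%:R * b < birkhoff_sum phi n z) ->
  (b%:E * mu B <= \int[mu]_(z in B) (phi z)%:E)%E.
Proof.
move=> iphi mB SB sup_b.
have BS z : B (S z) <-> B z by rewrite -[in X in _ <-> X]SB.
have mphi : measurable_fun setT phi by exact: integrable_EFin_measurable iphi.
pose g z := (phi z - b) * \1_B z.
have ib : mu.-integrable setT (EFin \o cst b) by exact: finite_measure_integrable_cst.
have ipb := integrableB measurableT iphi ib.
have ig : mu.-integrable setT (EFin \o g).
  apply: (le_integrable measurableT _ _ ipb) => //.
    apply/measurable_EFinP/measurable_funM; last exact: measurable_indic.
    exact: measurable_funB.
  move=> z _; rewrite /= lee_fin normrM ler_piMr// indicE.
  by rewrite ger0_norm// lern1 leq_b1.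
have := maximal_ergodic ig.
rewrite (_ : [set z | exists n, (0 < max_birkhoff g n z)%R] = B).
  have -> : (\int[mu]_(z in B) (g z)%:E = \int[mu]_(z in B) ((phi z)%:E - (cst b z)%:E))%E.
    by apply: eq_integral => z zB; rewrite /g indicE zB mulr1.
  rewrite integralB_EFin//; [|exact: integrableS iphi|exact: integrableS ib].
  have -> : (\int[mu]_(x in B) (cst b x)%:E = b%:E * mu B)%E.
    by rewrite -integral_cst.
  move=> h.
  have fb : (b%:E * mu B)%E \is a fin_num by rewrite fin_numM// fin_num_measure.
  by move: h; rewrite sube_ge0 ?fb ?orbT.
have Bsum n z : B z -> birkhoff_sum g n z = birkhoff_sum phi n z - n%:R * b.
  elim: n z => [|n IH] z Bz; first by rewrite /birkhoff_sum !big_ord0 mul0r subrr.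
  rewrite !birkhoff_sumS IH ?BS// /g indicE mem_set// mulr1 -natr1; ring.
have notB n z : ~ B z -> max_birkhoff g n z = 0.
  elim: n z => //= n IH z nBz.
  by rewrite IH ?BS// /g indicE memNset// mulr0 addr0 maxxx.
apply/seteqP; split=> z /=.
  move=> [n Mn]; apply: contrapT => /(notB n) Mn0.
  by move: Mn; rewrite Mn0 ltxx.
move=> Bz; have [n nb] := sup_b z Bz; exists n.
by rewrite (lt_le_trans _ (birkhoff_sum_le_max _ _ _))// Bsum// subr_gt0.
Qed.

End maximal_ergodic_inequality.

(** * Birkhoff's ergodic theorem and conditional expectation *)

Lemma le_limn_esup (R : realType) (u v : (\bar R)^nat) :
  (forall n, u n <= v n)%E -> (limn_esup u <= limn_esup v)%E.
Proof.
move=> uv; rewrite !limn_esup_lim; apply: lee_lim; [exact: is_cvg_esups..|].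
apply: nearW => n; apply: ge_ereal_sup => _ [k nk <-].
by apply: (le_trans (uv k)); apply: ereal_sup_ubound; exists k.
Qed.

Lemma cvg_limn_esup_einf (R : realType) (u : (\bar R)^nat) :
  (limn_esup u <= limn_einf u)%E -> u @ \oo --> limn_esup u.
Proof.
move=> le_u; have eq_u : limn_einf u = limn_esup u.
  by apply/eqP; rewrite eq_le le_u limn_einf_sup.
apply: (@squeeze_cvge _ _ _ _ (einfs u) _ (esups u)).
- apply: nearW => n; apply/andP; split.
    by apply: ereal_inf_lbound; exists n => /=.
  by apply: ereal_sup_ubound; exists n => /=.
- by rewrite -eq_u limn_einf_lim; exact: is_cvg_einfs.
- by rewrite limn_esup_lim; exact: is_cvg_esups.
Qed.

Lemma sume_const (R : realType) (c : \bar R) n :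
  (0 <= c)%E -> (\sum_(k < n) c = n%:R%:E * c)%E.
Proof.
move=> c0; elim: n => [|n IH]; first by rewrite big_ord0 mul0e.
by rewrite big_ord_recr /= IH -natr1 EFinD ge0_muleDl ?lee_fin// mul1e.
Qed.

Section pointwise_ergodic_theorem.
Context d (T : measurableType d) (R : realType) (mu : probability T R).
Variables (S : T -> T) (mS : measurable_fun setT S) (muS : invariant_measure mu S).
Implicit Types (phi : T -> R).

(** Unboundedness of S_n phi - n b, unlike positivity of it for infinitely many
    n, does not depend on the first term of the orbit: the set is strictly
    invariant. *)
Let super phi b : set T :=
  [set z | forall C : nat, exists n, C%:R < birkhoff_sum S phi n z - n%:R * b].

Let measurable_super phi b : measurable_fun setT phi -> measurable (super phi b).
Proof.
move=> mphi.
rewrite (_ : super phi b = \bigcap_C \bigcup_n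
    [set z | (C : nat)%:R < birkhoff_sum S phi n z - n%:R * b]).
  apply: bigcap_measurable => // C _; apply: bigcup_measurable => n _.
  apply: measurable_set_lt => //; apply: measurable_funB => //.
  exact: measurable_birkhoff_sum.
apply/seteqP; split=> z h C; first by move=> _; have [n ?] := h C; exists n.
by have [n _ ?] := h C I; exists n.
Qed.

Let super_invariant phi b : S @^-1` (super phi b) = super phi b.
Proof.
have shift z n : birkhoff_sum S phi n.+1 z - n.+1%:R * b =
    birkhoff_sum S phi n (S z) - n%:R * b + (phi z - b).
  by rewrite birkhoff_sumS -natr1; ring.
apply/seteqP; split=> z /= h C.
  have [C' ?] : exists C' : nat, C%:R - (phi z - b) < C'%:R.
    by exists (Num.truncn (C%:R - (phi z - b))).+1; exact: truncnS_gt.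
  have [n hn] := h C'; exists n.+1; rewrite shift; lra.
have [C' C'h] : exists C' : nat, Num.max 0 (C%:R + (phi z - b)) < C'%:R.
  by exists (Num.truncn (Num.max 0 (C%:R + (phi z - b)))).+1; exact: truncnS_gt.
move: C'h; rewrite gt_max => /andP[C'0 C'h].
have [[|n] hn] := h C'.
  by exfalso; move: hn; rewrite /birkhoff_sum big_ord0; lra.
by exists n; move: hn; rewrite shift; lra.
Qed.

Let super_le phi b : mu.-integrable setT (EFin \o phi) ->
  (b%:E * mu (super phi b) <= \int[mu]_(z in super phi b) (phi z)%:E)%E.
Proof.
move=> iphi; have mphi := integrable_EFin_measurable iphi.
apply: (birkhoff_superlevel mS muS iphi (measurable_super b mphi)).
  exact: super_invariant.
by move=> z /(_ 0%N)[n hn]; exists n; lra.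
Qed.

Definition birkhoff_avg phi n z := birkhoff_sum S phi n.+1 z / n.+1%:R.

Let avgE phi z := fun n => (birkhoff_avg phi n z)%:E.

Let esup_le phi b z : ~ super phi b z -> (limn_esup (avgE phi z) <= b%:E)%E.
Proof.
move=> /existsNP[C hC].
have bound n : (avgE phi z n <= (b + C%:R * n.+1%:R^-1)%:E)%E.
  rewrite /avgE lee_fin /birkhoff_avg ler_pdivrMr// mulrDl divfK//.
  rewrite addrC -lerBlDr leNgt mulrC; apply/negP => hn.
  by apply: hC; exists n.+1.
apply: (le_trans (le_limn_esup bound)).
suff cv : (fun n => (b + C%:R * n.+1%:R^-1)%:E) @ \oo --> b%:E.
  by rewrite (cvg_limn_einf_sup cv).
apply: cvg_EFin; first exact: nearW.
rewrite /= -[X in _ --> X]addr0 -[X in _ + X](mulr0 C%:R).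
apply: cvgD; first exact: cvg_cst.
by apply: cvgMl_tmp; exact: cvg_harmonic.
Qed.

Let avgN phi z : avgE (fun x => - phi x) z = -%E \o avgE phi z.
Proof.
apply/funext => n; rewrite /avgE/= /birkhoff_avg /birkhoff_sum sumrN mulNr.
by rewrite EFinN.
Qed.

Let einf_ge phi a z : ~ super (fun x => - phi x) (- a) z ->
  (a%:E <= limn_einf (avgE phi z))%E.
Proof.
by move=> /esup_le; rewrite avgN limn_esupN EFinN leeN2.
Qed.

(** On this invariant set, where the averages exceed b and fall below a < b,
    both b mu <= \int phi and \int phi <= a mu hold. *)
Let oscillation0 phi a b : mu.-integrable setT (EFin \o phi) -> a < b ->
  mu (super phi b `&` super (fun x => - phi x) (- a)) = 0%E.
Proof.
move=> iphi ab; have mphi := integrable_EFin_measurable iphi.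
set D := _ `&` _.
have mD : measurable D.
  apply: measurableI; apply: measurable_super => //; exact: measurableT_comp.
have SD : S @^-1` D = D by rewrite preimage_setI !super_invariant.
have iN : mu.-integrable setT (EFin \o (fun x => - phi x)).
  exact: integrableN iphi.
have D1 : (b%:E * mu D <= \int[mu]_(z in D) (phi z)%:E)%E.
  apply: (birkhoff_superlevel mS muS iphi mD SD) => z [/(_ 0%N)[n hn] _].
  by exists n; lra.
have D2 : ((- a)%:E * mu D <= \int[mu]_(z in D) (- phi z)%:E)%E.
  apply: (birkhoff_superlevel mS muS iN mD SD) => z [_ /(_ 0%N)[n hn]].
  by exists n; lra.
have iD := integrableS measurableT mD (@subsetT _ D) iphi.
have fD := integrable_fin_num mD iD.
have fmu : mu D \is a fin_num by exact: fin_num_measure.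
move: D2; under eq_integral do rewrite EFinN.
rewrite integralN; last exact: integrable_add_def iD.
move: D1; rewrite -(fineK fD) -(fineK fmu) -EFinN -!EFinM !lee_fin => D1 D2.
congr (_%:E); apply/eqP; rewrite eq_le fine_ge0// andbT.
by rewrite -(pmulr_rle0 (x := b - a)) ?subr_gt0//; lra.
Qed.

(** Oscillation across a pair of rationals is negligible by oscillation0, and
    so is divergence to infinity by Garsia's inequality for large levels b. *)
Lemma birkhoff_avg_cvg phi : mu.-integrable setT (EFin \o phi) ->
  (forall z, 0 <= phi z) -> {ae mu, forall z, cvgn (birkhoff_avg phi ^~ z)}.
Proof.
move=> iphi phi0; have mphi := integrable_EFin_measurable iphi.
have osc : {ae mu, forall z, forall q : rat * rat, ratr q.1 < ratr q.2 :> R ->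
    ~ (super phi (ratr q.2) `&` super (fun x => - phi x) (- ratr q.1)) z}.
  apply: ae_countable => q; have [lt_q|nlt_q] := boolP (ratr q.1 < ratr q.2 :> R).
    exists (super phi (ratr q.2) `&` super (fun x => - phi x) (- ratr q.1)); split.
    - apply: measurableI; apply: measurable_super => //; exact: measurableT_comp.
    - exact: oscillation0.
    - by move=> z /= /not_implyP[_ /contrapT].
  by apply: aeW.
have bdd : {ae mu, forall z, exists N : nat, ~ super phi N%:R z}.
  exists (\bigcap_N super phi N%:R); split.
  - by apply: bigcap_measurable => // N _; exact: measurable_super.
  - have mI : measurable (\bigcap_N super phi (N : nat)%:R).
      by apply: bigcap_measurable => // N _; exact: measurable_super.
    have fi := integrable_fin_num measurableT iphi.
    have fI : mu (\bigcap_N super phi (N : nat)%:R) \is a fin_num.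
      exact: fin_num_measure.
    have le_N (N : nat) : N%:R * fine (mu (\bigcap_N super phi (N : nat)%:R)) <=
        fine (\int[mu]_z (phi z)%:E)%E.
      rewrite -lee_fin EFinM !fineK//.
      apply: (@le_trans _ _ (N%:R%:E * mu (super phi N%:R))%E).
        apply: lee_wpmul2l; first by rewrite lee_fin.
        apply: le_measure; rewrite ?inE//; first exact: measurable_super.
        by move=> z; apply.
      apply: (le_trans (super_le _ iphi)).
      apply: ge0_subset_integral => //; first exact: measurable_super.
        exact/measurable_EFinP.
      by move=> z _; rewrite lee_fin.
    apply/eqP; rewrite eq_le measure_ge0 andbT -(fineK fI) lee_fin leNgt.
    apply/negP => gt0.
    set c := fine _ in le_N gt0; set M := fine _ in le_N.
    have := le_N (Num.truncn (M / c)).+1.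
    by rewrite leNgt -ltr_pdivrMr// truncnS_gt.
  - move=> z /= /forallNP h N _; exact: contrapT.
apply: filterS2 osc bdd => z osc [N nN].
have avg0 n : (0 <= avgE phi z n)%E.
  by rewrite lee_fin divr_ge0// sumr_ge0.
have esup_N := esup_le nN.
have einf0 : (0 <= limn_einf (avgE phi z))%E.
  rewrite /limn_einf leeNr oppe0.
  have /andP[_ //] : (-oo <= limn_esup (-%E \o avgE phi z) <= 0)%E.
  by apply: limn_esup_itv => n; rewrite leNye /comp leeNl oppe0 avg0.
have einf_esup := limn_einf_sup (avgE phi z).
have fin_sup : limn_esup (avgE phi z) \is a fin_num.
  by rewrite ge0_fin_numE ?(le_trans einf0)// (le_lt_trans esup_N)// ltry.
have fin_inf : limn_einf (avgE phi z) \is a fin_num.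
  by rewrite ge0_fin_numE// (le_lt_trans einf_esup)// (le_lt_trans esup_N)// ltry.
have le_inf : (limn_esup (avgE phi z) <= limn_einf (avgE phi z))%E.
  rewrite leNgt -(fineK fin_sup) -(fineK fin_inf) lte_fin; apply/negP => lt_is.
  have [q] := rat_in_itvoo lt_is; rewrite in_itv/= => /andP[q1 q2].
  have [q'] := rat_in_itvoo q2; rewrite in_itv/= => /andP[qq' q'2].
  have [sup|/esup_le] := pselect (super phi (ratr q') z); last first.
    by rewrite -(fineK fin_sup) lee_fin leNgt q'2.
  have [inf|/einf_ge] := pselect (super (fun x => - phi x) (- ratr q) z).
    exact: (osc (q, q') qq').
  by rewrite -(fineK fin_inf) lee_fin leNgt q1.
have := cvg_limn_esup_einf le_inf; rewrite -(fineK fin_sup) => /fine_cvg.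
exact: cvgP.
Qed.

Definition birkhoff_lim phi z : R := fine (limn_esup (avgE phi z)).

Lemma measurable_birkhoff_avg phi n : measurable_fun setT phi ->
  measurable_fun setT (birkhoff_avg phi n).
Proof.
move=> mphi; apply: measurable_funM => //; exact: measurable_birkhoff_sum.
Qed.

Lemma measurable_birkhoff_lim phi : measurable_fun setT phi ->
  measurable_fun setT (birkhoff_lim phi).
Proof.
move=> mphi; apply: measurableT_comp => //.
apply: measurable_fun_limn_esup => n; apply/measurable_EFinP.
exact: measurable_birkhoff_avg.
Qed.

Lemma birkhoff_lim_ge0 phi z : (forall z, 0 <= phi z) -> 0 <= birkhoff_lim phi z.
Proof.
move=> phi0; apply: fine_ge0.
have /andP[//] : (0 <= limn_esup (avgE phi z) <= +oo)%E.
apply: limn_esup_itv => n; rewrite leey andbT lee_fin divr_ge0//.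
exact: sumr_ge0.
Qed.

Lemma birkhoff_limE phi z : cvgn (birkhoff_avg phi ^~ z) ->
  birkhoff_avg phi ^~ z @ \oo --> birkhoff_lim phi z.
Proof.
move=> cz; rewrite /birkhoff_lim.
have cE : avgE phi z @ \oo --> (limn (birkhoff_avg phi ^~ z))%:E.
  by apply: cvg_EFin => //; exact: nearW.
by rewrite (cvg_limn_einf_sup cE).
Qed.

Lemma birkhoff_lim_cvg phi : mu.-integrable setT (EFin \o phi) ->
  (forall z, 0 <= phi z) ->
  {ae mu, forall z, birkhoff_avg phi ^~ z @ \oo --> birkhoff_lim phi z}.
Proof.
move=> iphi phi0; apply: filterS (birkhoff_avg_cvg iphi phi0) => z.
exact: birkhoff_limE.
Qed.

(** The averages along the orbits of z and of S z differ by O(1 / n). *)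
Lemma birkhoff_lim_invariant phi : mu.-integrable setT (EFin \o phi) ->
  (forall z, 0 <= phi z) ->
  {ae mu, forall z, birkhoff_lim phi (S z) = birkhoff_lim phi z}.
Proof.
move=> iphi phi0; have cv := birkhoff_lim_cvg iphi phi0.
apply: filterS2 cv (ae_invariant mS muS cv) => z cz cSz.
apply: (cvg_unique _ cSz) => //.
have -> : birkhoff_avg phi ^~ (S z) = fun n =>
    birkhoff_avg phi (n + 1)%N z * (1 + n.+1%:R^-1) - phi z * n.+1%:R^-1.
  apply/funext => n; rewrite /birkhoff_avg addn1 (birkhoff_sumS S phi n.+1 z).
  by field; rewrite !nat1r; apply/andP; split.
suff : (fun n => birkhoff_avg phi (n + 1)%N z * (1 + n.+1%:R^-1) - phi z * n.+1%:R^-1)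
    @ \oo --> birkhoff_lim phi z * (1 + 0) - phi z * 0.
  by rewrite addr0 mulr1 mulr0 subr0.
apply: cvgB; last by apply: cvgMl_tmp; exact: cvg_harmonic.
apply: cvgM; first by rewrite (cvg_shiftn 1 (birkhoff_avg phi ^~ z)).
by apply: cvgD; [exact: cvg_cst|exact: cvg_harmonic].
Qed.

Lemma integral_iter_invariant phi (B : set T) k : measurable_fun setT phi ->
  (forall z, 0 <= phi z) -> ae_invariant_sets mu S B ->
  (\int[mu]_(z in B) (phi (iter k S z))%:E = \int[mu]_(z in B) (phi z)%:E)%E.
Proof.
move=> mphi phi0 [mB B0]; elim: k phi mphi phi0 => // k IH phi mphi phi0.
have mk := measurableT_comp mphi (measurable_iter mS k).
have mkS := measurableT_comp mk mS.
rewrite -(IH _ mphi phi0).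
transitivity (\int[mu]_(z in B) (phi (iter k S (S z)))%:E)%E.
  by apply: eq_integral => z _; rewrite iterSr.
rewrite (integral_EFin_indic mu B (fun z => phi (iter k S (S z)))).
rewrite (integral_EFin_indic mu B (fun z => phi (iter k S z))).
have mB1 : measurable_fun setT (\1_B : T -> R) by exact: measurable_indic.
have mkB : measurable_fun setT (fun z => (phi (iter k S z) * \1_B z)%:E).
  by apply/measurable_EFinP; exact: measurable_funM.
rewrite -(ge0_integral_invariant mS muS mkB); last first.
  by move=> z; rewrite lee_fin mulr_ge0.
apply: ge0_ae_eq_integral => //.
- by apply/measurable_EFinP; exact: measurable_funM.
- exact: measurableT_comp mkB mS.
- by move=> z _; rewrite lee_fin mulr_ge0.
- by move=> z _; rewrite lee_fin mulr_ge0.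
exists (B `+` S @^-1` B); split=> //.
  have mSB : measurable (S @^-1` B) by rewrite -[X in measurable X]setTI; exact: mS.
  by apply: measurableU; exact: measurableD.
move=> z /= /not_implyP[_ neq].
apply: contrapT => nY; apply: neq; congr (_ * _)%:E; rewrite !indicE.
congr (nat_of_bool _)%:R.
apply/idP/idP => /set_mem Bz; apply/mem_set; apply: contrapT => nBz.
  by apply: nY; left; split.
by apply: nY; right; split.
Qed.

Lemma integral_birkhoff_avg phi (B : set T) n : measurable_fun setT phi ->
  (forall z, 0 <= phi z) -> ae_invariant_sets mu S B ->
  (\int[mu]_(z in B) (birkhoff_avg phi n z)%:E = \int[mu]_(z in B) (phi z)%:E)%E.
Proof.
move=> mphi phi0 IB; have [mB _] := IB.
have mk k : measurable_fun B (fun z => (phi (iter k S z))%:E).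
  apply/measurable_EFinP/measurable_funTS.
  exact: measurableT_comp mphi (measurable_iter mS k).
transitivity (\int[mu]_(z in B) (n.+1%:R^-1%:E * \sum_(k < n.+1) (phi (iter k S z))%:E))%E.
  apply: eq_integral => z _.
  by rewrite /birkhoff_avg /birkhoff_sum mulrC EFinM sumEFin.
rewrite ge0_integralZl ?lee_fin//; last 2 first.
- by apply: emeasurable_sum => k; exact: mk.
- by move=> z _; apply: sume_ge0 => k _; rewrite lee_fin.
rewrite ge0_integral_sum//; last by move=> k z _; rewrite lee_fin.
under eq_bigr do rewrite integral_iter_invariant//.
rewrite sume_const ?integral_ge0//; last by move=> z _; rewrite lee_fin.
by rewrite muleA -EFinM mulVf// mul1e.
Qed.

Lemma integral_birkhoff_lim_le phi (B : set T) : mu.-integrable setT (EFin \o phi) ->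
  (forall z, 0 <= phi z) -> ae_invariant_sets mu S B ->
  (\int[mu]_(z in B) (birkhoff_lim phi z)%:E <= \int[mu]_(z in B) (phi z)%:E)%E.
Proof.
move=> iphi phi0 IB; have mphi := integrable_EFin_measurable iphi.
have mB := IB.1.
have mavg n : measurable_fun B (fun z => (birkhoff_avg phi n z)%:E).
  by apply/measurable_EFinP/measurable_funTS; exact: measurable_birkhoff_avg.
have avg0 n z : (0 <= (birkhoff_avg phi n z)%:E)%E.
  by rewrite lee_fin divr_ge0// sumr_ge0.
have -> : (\int[mu]_(z in B) (birkhoff_lim phi z)%:E =
    \int[mu]_(z in B) limn_einf (fun n => (birkhoff_avg phi n z)%:E))%E.
  apply: ae_eq_integral => //.
  - by apply/measurable_EFinP/measurable_funTS; exact: measurable_birkhoff_lim.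
  - rewrite /limn_einf; apply: measurableT_comp => //.
    apply: measurable_fun_limn_esup => n; exact: measurableT_comp (mavg n).
  apply: filterS (birkhoff_lim_cvg iphi phi0) => z cz _.
  have cE : (fun n => (birkhoff_avg phi n z)%:E) @ \oo --> (birkhoff_lim phi z)%:E.
    by apply: cvg_EFin => //; exact: nearW.
  by rewrite (cvg_limn_einf_sup cE).
apply: (le_trans (fatou mu mB mavg (fun n z _ => avg0 n z))).
under eq_fun do rewrite integral_birkhoff_avg//.
by rewrite (cvg_limn_einf_sup (cvg_cst _)).
Qed.

Lemma ae_invariant_setsT : ae_invariant_sets mu S setT.
Proof.
split=> //; rewrite preimage_setT (_ : _ `+` _ = set0) ?measure0//.
by apply/seteqP; split=> // z [[]|[]].
Qed.

Let integral_birkhoff_lim_bounded phi (M : R) : measurable_fun setT phi ->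
  (forall z, 0 <= phi z <= M) ->
  (\int[mu]_z (birkhoff_lim phi z)%:E = \int[mu]_z (phi z)%:E)%E.
Proof.
move=> mphi phiM.
have phi0 z : 0 <= phi z by have /andP[] := phiM z.
have iphi : mu.-integrable setT (EFin \o phi).
  apply: bm_integrable; split=> //; exists M => z.
  by rewrite ger0_norm//; have /andP[] := phiM z.
have IT := ae_invariant_setsT.
have mavg n : measurable_fun setT (fun z => (birkhoff_avg phi n z)%:E).
  by apply/measurable_EFinP; exact: measurable_birkhoff_avg.
have mlim : measurable_fun setT (fun z => (birkhoff_lim phi z)%:E).
  by apply/measurable_EFinP; exact: measurable_birkhoff_lim.
have iM : mu.-integrable setT (EFin \o cst M) by exact: finite_measure_integrable_cst.
have [] := dominated_convergence measurableT mavg mlim _ iM _.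
- apply: filterS (birkhoff_lim_cvg iphi phi0) => z cz _.
  by apply: cvg_EFin => //; exact: nearW.
- apply: aeW => z n _; rewrite /= lee_fin ger0_norm ?divr_ge0 ?sumr_ge0//.
  rewrite ler_pdivrMr// /birkhoff_sum mulr_natr -[n.+1 in leRHS]card_ord -sumr_const.
  by apply: ler_sum => k _; have /andP[] := phiM (iter k S z).
move=> _ _ cv; apply/esym; apply: (cvg_unique _ _ cv) => //.
by apply: cvg_near_cst; apply: nearW => n /=; exact: integral_birkhoff_avg.
Qed.

(** Fatou's lemma gives one inequality. For the other one, truncation at M
    makes phi bounded, and dominated convergence applies. *)
Lemma integral_birkhoff_limT phi : mu.-integrable setT (EFin \o phi) ->
  (forall z, 0 <= phi z) ->
  (\int[mu]_z (birkhoff_lim phi z)%:E = \int[mu]_z (phi z)%:E)%E.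
Proof.
move=> iphi phi0; have mphi := integrable_EFin_measurable iphi.
have IT := ae_invariant_setsT.
apply/eqP; rewrite eq_le integral_birkhoff_lim_le//=.
pose trunc (M : nat) z := Num.min (phi z) M%:R.
have mtrunc M : measurable_fun setT (trunc M) by exact: measurable_minr.
have truncM M z : 0 <= trunc M z <= M%:R.
  by rewrite le_min phi0 ler0n ge_min lexx orbT.
have itrunc M : mu.-integrable setT (EFin \o trunc M).
  apply: bm_integrable; split=> //; exists M%:R => z.
  by have /andP[t0 t1] := truncM M z; rewrite ger0_norm.
have cv : (\int[mu]_z (trunc M z)%:E)%E @[M --> \oo] --> (\int[mu]_z (phi z)%:E)%E.
  apply: (@dominated_cvg _ _ _ mu setT measurableT _ _ (EFin \o phi)).
  - by move=> M; exact/measurable_EFinP.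
  - move=> z _; apply: cvg_EFin; first exact: nearW.
    apply: cvg_near_cst; exists (Num.truncn (phi z)).+1 => // M /= zM.
    rewrite /trunc; apply/min_idPl.
    by rewrite ltW// (lt_le_trans (truncnS_gt _))// ler_nat.
  - by [].
  - by [].
  - move=> M z _; have /andP[t0 _] := truncM M z.
    by rewrite /= lee_fin ger0_norm// ge_min lexx.
rewrite -(cvg_lim _ cv)//; apply: lime_le; first exact: cvgP cv.
apply: nearW => M.
rewrite -(integral_birkhoff_lim_bounded (mtrunc M) (truncM M)).
have t0 z : 0 <= trunc M z by have /andP[] := truncM M z.
apply: ae_ge0_le_integral => //.
- by move=> z _; rewrite lee_fin birkhoff_lim_ge0.
- by apply/measurable_EFinP; exact: measurable_birkhoff_lim.
- by move=> z _; rewrite lee_fin birkhoff_lim_ge0.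
- by apply/measurable_EFinP; exact: measurable_birkhoff_lim.
apply: filterS2 (birkhoff_lim_cvg iphi phi0) (birkhoff_lim_cvg (itrunc M) t0) => z c1 c2 _.
rewrite lee_fin -(cvg_lim _ c1)// -(cvg_lim _ c2)//; apply: ler_lim.
- exact: cvgP c2.
- exact: cvgP c1.
apply: nearW => n; rewrite ler_pM2r// ler_sum// => k _.
by rewrite ge_min lexx.
Qed.

Lemma birkhoff_lim_integrable phi : mu.-integrable setT (EFin \o phi) ->
  (forall z, 0 <= phi z) -> mu.-integrable setT (EFin \o birkhoff_lim phi).
Proof.
move=> iphi phi0; have mphi := integrable_EFin_measurable iphi.
apply/integrableP; split.
  by apply/measurable_EFinP; exact: measurable_birkhoff_lim.
under eq_integral do rewrite /= ger0_norm ?birkhoff_lim_ge0//.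
rewrite integral_birkhoff_limT//; exact: integrable_lty iphi.
Qed.

Lemma ae_invariant_setsC B : ae_invariant_sets mu S B -> ae_invariant_sets mu S (~` B).
Proof.
move=> [mB B0]; split; first exact: measurableC.
rewrite -B0; congr (mu _); apply/seteqP; split=> z /=.
  by move=> [[nB /contrapT SB]|[SB /contrapT Bz]]; [right|left].
by move=> [[Bz nSB]|[SB nBz]]; [right|left]; split=> // -[].
Qed.

(** Fatou's lemma gives an inequality on B and another one on its complement;
    their sum is the equality of integral_birkhoff_limT. *)
Lemma integral_birkhoff_lim phi B : mu.-integrable setT (EFin \o phi) ->
  (forall z, 0 <= phi z) -> ae_invariant_sets mu S B ->
  (\int[mu]_(z in B) (birkhoff_lim phi z)%:E = \int[mu]_(z in B) (phi z)%:E)%E.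
Proof.
move=> iphi phi0 IB; have mphi := integrable_EFin_measurable iphi.
have ilim := birkhoff_lim_integrable iphi phi0.
have IC := ae_invariant_setsC IB.
have [mB mC] := (IB.1, IC.1).
have leB := integral_birkhoff_lim_le iphi phi0 IB.
have leC := integral_birkhoff_lim_le iphi phi0 IC.
have eqT := integral_birkhoff_limT iphi phi0.
have split_int h : mu.-integrable setT (EFin \o h) -> (forall z, 0 <= h z) ->
    (\int[mu]_z (h z)%:E = \int[mu]_(z in B) (h z)%:E + \int[mu]_(z in ~` B) (h z)%:E)%E.
  move=> ih h0; rewrite -(setUv B) ge0_integral_setU//.
  - rewrite setUv; exact: measurable_int ih.
  - by move=> z _; rewrite lee_fin.
  - by apply/disj_setPS => z [].
have fin_int h D : measurable D -> mu.-integrable setT (EFin \o h) ->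
    (\int[mu]_(z in D) (h z)%:E)%E \is a fin_num.
  by move=> mD ih; apply: integrable_fin_num => //; exact: integrableS ih.
move: eqT leB leC; rewrite (split_int _ iphi)// (split_int _ ilim); last first.
  by move=> z; exact: birkhoff_lim_ge0.
rewrite -(fineK (fin_int _ _ mB ilim)) -(fineK (fin_int _ _ mC ilim)).
rewrite -(fineK (fin_int _ _ mB iphi)) -(fineK (fin_int _ _ mC iphi)).
rewrite -!EFinD !lee_fin => -[] eqT leB leC; congr (_%:E); lra.
Qed.

Lemma birkhoff_lim_condexp phi : mu.-integrable setT (EFin \o phi) ->
  (forall z, 0 <= phi z) ->
  is_condexp mu (ae_invariant_sets mu S) (EFin \o phi) (EFin \o birkhoff_lim phi).
Proof.
move=> iphi phi0; have mphi := integrable_EFin_measurable iphi.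
split=> [C mC|B IB]; last exact: integral_birkhoff_lim.
have mlim : measurable_fun setT (EFin \o birkhoff_lim phi).
  by apply/measurable_EFinP; exact: measurable_birkhoff_lim.
have mB : measurable ((EFin \o birkhoff_lim phi) @^-1` C).
  by rewrite -[X in measurable X]setTI; exact: mlim.
have mSB : measurable (S @^-1` ((EFin \o birkhoff_lim phi) @^-1` C)).
  by rewrite -[X in measurable X]setTI; exact: mS.
split=> //; apply: measure_negligible.
  by apply: measurableU; exact: measurableD.
apply: negligibleS (birkhoff_lim_invariant iphi phi0) => z /= h eqz.
by move: h; rewrite /setY/= eqz => -[[]|[]].
Qed.

Lemma condexp_invariant phi (F : T -> \bar R) : mu.-integrable setT (EFin \o phi) ->
  (forall z, 0 <= phi z) -> measurable_fun setT F ->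
  {ae mu, forall z, F z = (phi z)%:E} ->
  {ae mu, forall z, condexp mu (ae_invariant_sets mu S) F z = (birkhoff_lim phi z)%:E}.
Proof.
move=> iphi phi0 mF Fphi.
have mphi : measurable_fun setT (EFin \o phi) by exact: measurable_int iphi.
have [c1 c2] := birkhoff_lim_condexp iphi phi0.
apply: (@condexp_ae _ _ _ mu (ae_invariant_sets mu S) _ _ _ F (EFin \o birkhoff_lim phi)).
- by move=> B [].
- exact: ae_invariant_setsT.
- move=> B C [mB B0] [mC C0]; split; first exact: measurableI.
  have mp D : measurable D -> measurable (S @^-1` D).
    by move=> mD; rewrite -[X in measurable X]setTI; exact: mS.
  have mY D : measurable D -> measurable (D `+` S @^-1` D).
    by move=> mD; apply: measurableU; apply: measurableD => //; exact: mp.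
  apply: measure_negligible; first exact: mY (measurableI _ _ mB mC).
  have nU := negligibleU ((negligibleP mu (mY _ mB)).2 B0) ((negligibleP mu (mY _ mC)).2 C0).
  apply: negligibleS nU => z /=.
  move=> [[[Bz Cz] nS]|[[Bz Cz] nBC]].
    have [SB|nSB] := pselect (B (S z)); last by left; left.
    by right; left; split=> // SC; apply: nS.
  have [Bz'|nBz'] := pselect (B z); last by left; right.
  by right; right; split=> // SC; apply: nBC.
- apply/integrableP; split=> //.
  have -> : (\int[mu]_z `|F z| = \int[mu]_z `|(phi z)%:E|)%E; last first.
    by have /integrableP[] := iphi.
  apply: ae_eq_integral => //.
  + exact: measurableT_comp.
  + exact: measurableT_comp mphi.
  + by apply: filterS Fphi => z -> .
- split=> // B IB; rewrite (c2 _ IB); apply: ae_eq_integral => //.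
  + exact: IB.1.
  + exact: measurable_funTS.
  + exact: measurable_funTS.
  + by apply: filterS Fphi => z -> .
Qed.

(** The set where S_n phi - n b is unbounded is strictly invariant, hence null
    or of full measure; by Garsia's inequality it can be of full measure only
    for b up to the integral of phi. *)
Lemma birkhoff_lim_ergodic phi : mu.-integrable setT (EFin \o phi) ->
  (forall z, 0 <= phi z) -> ergodic mu S ->
  {ae mu, forall z, (birkhoff_lim phi z)%:E = (\int[mu]_z (phi z)%:E)%E}.
Proof.
move=> iphi phi0 erg; have mphi := integrable_EFin_measurable iphi.
have fi := integrable_fin_num measurableT iphi.
set c := fine (\int[mu]_z (phi z)%:E)%E.
have iN : mu.-integrable setT (EFin \o (fun x => - phi x)) by exact: integrableN iphi.
have full h b : mu.-integrable setT (EFin \o h) -> mu (super h b) = 1%E ->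
    (b%:E <= \int[mu]_z (h z)%:E)%E.
  move=> ih h1; have mh := integrable_EFin_measurable ih.
  have msup := measurable_super b mh.
  have := super_le b ih; rewrite h1 mule1 => /le_trans; apply.
  rewrite [leRHS](@negligible_integral _ _ _ _ _ (~` super h b))//.
  - by rewrite setTD setCK.
  - exact: measurableC.
  - transitivity (1 - mu (super h b))%E; first exact: probability_setC.
    by rewrite h1 subee.
have dich h b : mu.-integrable setT (EFin \o h) ->
    (\int[mu]_z (h z)%:E < b%:E)%E -> {ae mu, forall z, ~ super h b z}.
  move=> ih hb; have mh := integrable_EFin_measurable ih.
  have msup := measurable_super b mh.
  exists (super h b); split=> //; last by move=> z /= /contrapT.
  have [//|h1] := erg _ msup (super_invariant h b).
  by have := full _ _ ih h1; rewrite leNgt hb.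
have up : {ae mu, forall z, forall q : rat, c < ratr q -> ~ super phi (ratr q) z}.
  apply: ae_countable => q; have [lt_q|_] := boolP (c < ratr q); last exact: aeW.
  have /dich : (\int[mu]_z (phi z)%:E < (ratr q)%:E)%E by rewrite -(fineK fi) lte_fin.
  by move=> /(_ iphi); apply: filterS => z.
have dn : {ae mu, forall z, forall q : rat, ratr q < c ->
    ~ super (fun x => - phi x) (- ratr q) z}.
  apply: ae_countable => q; have [lt_q|_] := boolP (ratr q < c); last exact: aeW.
  have /dich : (\int[mu]_z (- phi z)%:E < (- ratr q)%:E)%E.
    under eq_integral do rewrite EFinN.
    rewrite integralN; last exact: integrable_add_def iphi.
    by rewrite -(fineK fi) -EFinN lte_fin ltrN2.
  by move=> /(_ iN); apply: filterS => z.
apply: filterS3 up dn (birkhoff_lim_cvg iphi phi0) => z up dn cz.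
have cE : avgE phi z @ \oo --> (birkhoff_lim phi z)%:E.
  by apply: cvg_EFin => //; exact: nearW.
rewrite -(fineK fi) -/c; congr (_%:E); apply/eqP; rewrite eq_le; apply/andP; split.
  rewrite leNgt; apply/negP => /rat_in_itvoo[q]; rewrite in_itv/= => /andP[cq ql].
  have := esup_le (up q cq); rewrite (cvg_limn_einf_sup cE) lee_fin.
  by rewrite leNgt ql.
rewrite leNgt; apply/negP => /rat_in_itvoo[q]; rewrite in_itv/= => /andP[lq qc].
have := einf_ge (dn q qc); rewrite (cvg_limn_einf_sup cE) lee_fin.
by rewrite leNgt lq.
Qed.

End pointwise_ergodic_theorem.

(** * Disintegrated measures *)

Lemma ge0_measurable_funV d (T : measurableType d) (R : realType) (h : T -> R) :
  measurable_fun setT h -> (forall x, 0 <= h x) ->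
  measurable_fun setT (fun x => (h x)^-1).
Proof.
move=> mh h0; rewrite (_ : (fun x => _) = (fun x => h x `^ (-1))).
  apply: (measurableT_comp (@measurable_powR R (-1))).
  exact: mh.
by apply/funext => x; rewrite powR_inv1.
Qed.

Section disintegrated_measure.
Context d d' (Om : measurableType d) (X : measurableType d') (R : realType).
Variables (P : probability Om R) (mu_ : R.-pker Om ~> X).
Variable mu : probability (Om * X)%type R.
Hypothesis mu_dis : disintegration P mu_ mu.
Local Notation Z := (Om * X)%type.

(** An alias of the kernel at w, on which a structure of probability measure
    can be declared. *)
Definition fiber_law w : set X -> \bar R := mu_ w.
HB.instance Definition _ w := Measure.on (fiber_law w).
HB.instance Definition _ w :=
  Measure_isProbability.Build _ _ _ (fiber_law w) (prob_kernel w).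
Definition fiber_prob w : probability X R := fiber_law w.

Lemma measurable_kernel_xsection (A : set Z) : measurable A ->
  measurable_fun setT (fun w => mu_ w (xsection A w)).
Proof. by move=> mA; apply: measurable_fun_xsection_finite_kernel; rewrite inE. Qed.

Lemma kernel_fin_num (A : set X) w : measurable A -> mu_ w A \is a fin_num.
Proof. exact: (@fin_num_measure _ _ _ (fiber_prob w)). Qed.

Lemma null_fibers (N : set Z) : measurable N -> mu N = 0%E ->
  {ae P, forall w, mu_ w (xsection N w) = 0%E}.
Proof.
move=> mN; rewrite mu_dis// => N0.
have m := measurable_kernel_xsection mN.
have := (ae_eq_integral_abs P measurableT m).1.
move=> /(_ _)h; apply: filterS (h _) => [w /(_ I)//|].
by under eq_integral do rewrite gee0_abs//.
Qed.

Lemma null_of_fibers (N : set Z) : measurable N ->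
  {ae P, forall w, mu_ w (xsection N w) = 0%E} -> mu N = 0%E.
Proof.
move=> mN N0; rewrite mu_dis//.
have m := measurable_kernel_xsection mN.
rewrite (ae_eq_integral (cst 0%E))//; first exact: integral0.
by apply: filterS N0 => w + _.
Qed.

Lemma ae_base (Q : Om -> Prop) :
  {ae P, forall w, Q w} -> {ae mu, forall z, Q z.1}.
Proof.
move=> [N [mN N0 QN]]; exists (N `*` setT); split.
- exact: measurableX.
- apply: null_of_fibers; first exact: measurableX.
  exists N; split=> // w /= h; apply: contrapT => nNw; apply: h.
  by rewrite notin_xsectionX ?measure0//; apply/negP => /set_mem.
- by move=> [w x] /= /QN.
Qed.

Lemma ae_of_fibers (Q : Z -> Prop) : measurable [set z | Q z] ->
  {ae P, forall w, {ae mu_ w, forall x, Q (w, x)}} -> {ae mu, forall z, Q z}.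
Proof.
move=> mQ aeQ; exists (~` [set z | Q z]); split=> //; first exact: measurableC.
apply: null_of_fibers; first exact: measurableC.
apply: filterS aeQ => w aew.
apply: measure_negligible; first by apply: measurable_xsection; exact: measurableC.
by apply: negligibleS aew => x; rewrite /xsection/= inE.
Qed.

Import HBNNSimple.

Let ge0_integral_disintegration_nnsfun (h : {nnsfun Z >-> R}) :
  (\int[mu]_z (h z)%:E = \int[P]_w \int[mu_ w]_x (h (w, x))%:E)%E.
Proof.
have mh r : measurable (h @^-1` [set r]) by [].
under eq_integral do rewrite fimfunE -fsumEFin//.
rewrite ge0_integral_fsum//; last 2 first.
- by move=> r; apply/measurable_EFinP/measurable_funM.
- by move=> r z _; rewrite EFinM nnfun_muleindic_ge0.
transitivity (\int[P]_w \sum_(r \in range h) (r%:E * mu_ w (xsection (h @^-1` [set r]) w)))%E.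
  rewrite ge0_integral_fsum//; last 2 first.
  - move=> r; apply: emeasurable_funM => //; exact: measurable_kernel_xsection.
  - move=> r w _; have [r0|r0] := leP 0%R r; first by rewrite mule_ge0.
    by rewrite preimage_nnfun0// xsection0 measure0 mule0.
  apply: eq_fsbigr => r _.
  have [r0|r0] := leP 0%R r; last first.
    rewrite !integral0_eq// => z _; rewrite preimage_nnfun0//.
      by rewrite xsection0 measure0 mule0.
    by rewrite indic0 mulr0.
  under eq_integral do rewrite EFinM.
  rewrite ge0_integralZl//; last by exact/measurable_EFinP.
  rewrite integral_indic// setIT ge0_integralZl//; last first.
    exact: measurable_kernel_xsection.
  by congr (_ * _)%E; exact: mu_dis.
apply: eq_integral => w _.
under [RHS]eq_integral do rewrite fimfunE -fsumEFin//.
rewrite ge0_integral_fsum//; last 2 first.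
- move=> r; apply/measurable_EFinP/measurable_funM => //.
  by apply: measurableT_comp.
- by move=> r z _; rewrite EFinM nnfun_muleindic_ge0.
apply: eq_fsbigr => r _.
have [r0|r0] := leP 0%R r; last first.
  rewrite preimage_nnfun0// xsection0 measure0 mule0.
  by rewrite integral0_eq// => x _; rewrite indic0 mulr0.
under eq_integral do rewrite EFinM.
rewrite ge0_integralZl//; last by apply/measurable_EFinP; exact: measurableT_comp.
congr (_ * _)%E.
rewrite -[xsection _ w]setTI setIC -integral_indic//; last exact: measurable_xsection.
by apply: eq_integral => x _; rewrite !indicE mem_xsection.
Qed.

(** Tonelli's theorem, from the case of indicators by simple functions and
    monotone convergence. *)
Lemma ge0_integral_disintegration (F : Z -> \bar R) :
  measurable_fun setT F -> (forall z, 0 <= F z)%E ->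
  (\int[mu]_z F z = \int[P]_w \int[mu_ w]_x F (w, x))%E.
Proof.
move=> mF F0.
pose F_ := nnsfun_approx measurableT mF.
have mFw w : measurable_fun setT (fun x => F (w, x)) by exact: measurableT_comp.
transitivity (\int[mu]_z (lim ((F_ n z)%:E @[n --> \oo])))%E.
  by apply/eq_integral => z _; apply/esym/cvg_lim => //=; exact: cvg_nnsfun_approx.
rewrite monotone_convergence//; last 3 first.
- by move=> n; exact/measurable_EFinP.
- by move=> n z _; rewrite lee_fin.
- by move=> z _ a b ab; rewrite lee_fin; exact/lefP/nd_nnsfun_approx.
under eq_fun do rewrite ge0_integral_disintegration_nnsfun.
have mI n : measurable_fun setT (fun w => \int[mu_ w]_x (F_ n (w, x))%:E)%E.
  apply: (@measurable_fun_integral_finite_kernel _ _ Om X R (fun z => (F_ n z)%:E) mu_).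
    by move=> z; rewrite lee_fin.
  exact/measurable_EFinP.
have mFn w n : measurable_fun setT (fun x => (F_ n (w, x))%:E).
  by apply/measurable_EFinP; exact: measurableT_comp.
transitivity (\int[P]_w lim ((\int[mu_ w]_x (F_ n (w, x))%:E)%E @[n --> \oo]))%E.
  rewrite -monotone_convergence//.
  - by move=> n w _; apply: integral_ge0 => // x _; rewrite lee_fin.
  - move=> w _ a b ab; apply: ge0_le_integral => //.
    + by move=> x _; rewrite lee_fin.
    + by move=> x _; rewrite lee_fin; exact/lefP/nd_nnsfun_approx.
apply: eq_integral => w _; rewrite -monotone_convergence//.
- by apply: eq_integral => x _; apply/cvg_lim => //; exact: cvg_nnsfun_approx.
- by move=> n x _; rewrite lee_fin.
- by move=> x _ a b ab; rewrite lee_fin; exact/lefP/nd_nnsfun_approx.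
Qed.

End disintegrated_measure.

(** * Conditional probabilities relative to the base *)

Section relative_conditional_probability.
Context d d' (Om : measurableType d) (X : measurableType d') (R : realType).
Variables (P : probability Om R) (mu_ : R.-pker Om ~> X).
Variable mu : probability (Om * X)%type R.
Hypothesis mu_dis : disintegration P mu_ mu.
Local Notation Z := (Om * X)%type.

Definition mass (A : set Z) (z : Z) : R := fine (mu_ z.1 (xsection A z.1)).

Definition label_mass (L : Type) (r : Z -> L) (z : Z) : R := mass (same_label r z) z.

(** The conditional probability of A given r and the base point. *)
Definition rel_cprob (L : Type) (A : set Z) (r : Z -> L) (z : Z) : R :=
  mass (A `&` same_label r z) z / label_mass r z.

Definition label_cprob (K L : Type) (p : Z -> K) (r : Z -> L) (z : Z) : R :=
  rel_cprob (same_label p z) r z.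

Definition fiber_adapted (L : Type) (r : Z -> L) (V : Type) (h : Z -> V) :=
  forall w x y, r (w, x) = r (w, y) -> h (w, x) = h (w, y).

Lemma measurable_mass A : measurable A -> measurable_fun setT (mass A).
Proof.
move=> mA; apply: measurableT_comp => //.
exact: (measurableT_comp (measurable_kernel_xsection mu_ mA) (@measurable_fst _ _ _ _)).
Qed.

Lemma mass_ge0 A z : 0 <= mass A z.
Proof. exact: fine_ge0. Qed.

Lemma le_mass A B z : measurable A -> measurable B -> A `<=` B -> mass A z <= mass B z.
Proof.
move=> mA mB AB; apply: fine_le; try exact/kernel_fin_num/measurable_xsection.
by apply: le_measure; rewrite ?inE; [exact: measurable_xsection..|exact: le_xsection].
Qed.

Section one_label.
Variables (L : countType) (r : Z -> L).
Hypothesis mr : mlabel r.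

Lemma measurable_label_mass : measurable_fun setT (label_mass r).
Proof.
apply: (@mlabel_glue _ _ _ r _ _ (fun l z => mass (r @^-1` [set l]) z)) => // l.
by apply: measurable_mass; exact: mr.
Qed.

Lemma measurable_rel_cprob A : measurable A -> measurable_fun setT (rel_cprob A r).
Proof.
move=> mA; apply: measurable_funM; last first.
  apply: ge0_measurable_funV; first exact: measurable_label_mass.
  by move=> z; exact: mass_ge0.
apply: (@mlabel_glue _ _ _ r _ _ (fun l z => mass (A `&` r @^-1` [set l]) z)) => // l.
by apply: measurable_mass; apply: measurableI => //; exact: mr.
Qed.

Lemma mlabel_fiber w : mlabel (fun x => r (w, x)).
Proof.
move=> S; rewrite (_ : _ @^-1` _ = xsection (r @^-1` S) w).
  by apply: measurable_xsection; exact: mr.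
by apply/seteqP; split=> x; rewrite /xsection/= inE.
Qed.

Lemma rel_cprobE A w x :
  rel_cprob A r (w, x) = cprob (fiber_prob mu_ w) (xsection A w) (fun x => r (w, x)) x.
Proof.
rewrite /rel_cprob /cprob /label_mass /mass/=; congr (fine (mu_ w _) / fine (mu_ w _)).
  by apply/seteqP; split=> y; rewrite /xsection /same_label/= !inE.
by apply/seteqP; split=> y; rewrite /xsection /same_label/= inE.
Qed.

Lemma rel_cprob_itv A z : measurable A -> 0 <= rel_cprob A r z <= 1.
Proof.
move=> mA; case: z => w x; rewrite rel_cprobE; apply: cprob_itv.
  exact: mlabel_fiber.
exact: measurable_xsection.
Qed.

Lemma rel_cprob_adapted A : fiber_adapted r (rel_cprob A r).
Proof. by move=> w x y rxy; rewrite /rel_cprob /label_mass /mass/= /same_label rxy. Qed.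

Lemma ge0_rel_cprobE A (h : Z -> R) : measurable A -> measurable_fun setT h ->
  fiber_adapted r h -> (forall z, 0 <= h z) ->
  (\int[mu]_z (\1_A z * h z)%:E = \int[mu]_z (rel_cprob A r z * h z)%:E)%E.
Proof.
move=> mA mh rh h0.
rewrite !(ge0_integral_disintegration mu_dis); last 4 first.
- by apply/measurable_EFinP/measurable_funM => //; exact: measurable_rel_cprob.
- move=> z; rewrite lee_fin mulr_ge0//.
  by have /andP[] := rel_cprob_itv z mA.
- by apply/measurable_EFinP/measurable_funM => //; exact: measurable_indic.
- by move=> z; rewrite lee_fin mulr_ge0.
apply: eq_integral => w _.
have mAw := measurable_xsection w mA.
have := ge0_cprobE (fiber_prob mu_ w) (mlabel_fiber w) mAw (@rh w) (fun x => h0 (w, x)).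
move=> e; transitivity (\int[mu_ w]_x (\1_(xsection A w) x * h (w, x))%:E)%E.
  by apply: eq_integral => x _; rewrite !indicE mem_xsection.
apply: (etrans e); apply: eq_integral => x _.
by rewrite rel_cprobE.
Qed.

End one_label.

(** Given r and the base point, C (p z) z / label_cprob p r z has as conditional
    mean the sum of C k z over the labels k of positive conditional probability. *)
Lemma integral_ratio_le (K : nat) (L : countType) (p : Z -> nat) (r : Z -> L)
    (C : nat -> Z -> R) (u : Z -> R) :
  mlabel p -> mlabel r -> (forall z, (p z < K)%N) ->
  (forall k, measurable_fun setT (C k)) -> (forall k z, 0 <= C k z) ->
  (forall k, fiber_adapted r (C k)) -> (forall z, \sum_(k < K) C k z <= 1) ->
  measurable_fun setT u -> (forall z, 0 <= u z) -> fiber_adapted r u ->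
  (\int[mu]_z (u z * (C (p z) z / label_cprob p r z))%:E <= \int[mu]_z (u z)%:E)%E.
Proof.
move=> mp mr pK mC C0 rC C1 mfu u0 ru.
pose A k := p @^-1` [set k].
have mA k : measurable (A k) by exact: mp.
pose h k z := u z * C k z / rel_cprob (A k) r z.
have c0 k z : 0 <= rel_cprob (A k) r z by have /andP[] := rel_cprob_itv mr z (mA k).
have h0 k z : 0 <= h k z by rewrite divr_ge0// mulr_ge0.
have mh k : measurable_fun setT (h k).
  apply: measurable_funM; first exact: measurable_funM.
  by apply: ge0_measurable_funV => //; exact: measurable_rel_cprob.
have rh k : fiber_adapted r (h k).
  by move=> w x y rxy; rewrite /h (ru _ _ _ rxy) (rC _ _ _ _ rxy) (rel_cprob_adapted (A k) rxy).
have mc k : measurable_fun setT (rel_cprob (A k) r) by exact: measurable_rel_cprob.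
have -> : (\int[mu]_z (u z * (C (p z) z / label_cprob p r z))%:E =
    \int[mu]_z \sum_(k < K) (\1_(A k) z * h k z)%:E)%E.
  apply: eq_integral => z _; rewrite sumEFin; congr (_%:E).
  rewrite (bigD1 (Ordinal (pK z)))//= big1 => [|k kpz].
    by rewrite addr0 indicE mem_set// mul1r /h mulrA.
  rewrite indicE memNset ?mul0r// /A/= => pzk.
  by move/eqP: kpz; apply; apply/val_inj; rewrite /= -pzk.
rewrite ge0_integral_sum//; last 2 first.
- by move=> k; apply/measurable_EFinP/measurable_funM => //; exact: measurable_indic.
- by move=> k z _; rewrite lee_fin mulr_ge0.
under eq_bigr do rewrite (ge0_rel_cprobE mr)//.
rewrite -ge0_integral_sum//; last 2 first.
- by move=> k; apply/measurable_EFinP/measurable_funM.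
- by move=> k z _; rewrite lee_fin mulr_ge0.
apply: ge0_le_integral => //.
- by move=> z _; apply: sume_ge0 => k _; rewrite lee_fin mulr_ge0.
- by apply: emeasurable_sum => k; apply/measurable_EFinP/measurable_funM.
- exact/measurable_EFinP.
move=> z _; rewrite sumEFin lee_fin -[leRHS]mulr1.
apply: le_trans (ler_wpM2l (u0 z) (C1 z)); rewrite mulr_sumr.
apply: ler_sum => k _; rewrite /h.
have [->|ck] := eqVneq (rel_cprob (A k) r z) 0; first by rewrite mul0r mulr_ge0.
by rewrite mulrC divfK.
Qed.

End relative_conditional_probability.

(** * Linear time changes *)

(** The cost per unit of time of a bound (N + 1)(N + 2) on likelihood ratios. *)
Lemma cvg_ln_sq_over_n (R : realType) :
  (fun N : nat => ln (N.+1%:R * N.+2%:R) / N%:R) @ \oo --> (0 : R).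
Proof.
have sq0 : (fun N : nat => 8 * Num.sqrt (N%:R^-1)) @ \oo --> (0 : R).
  rewrite -[X in _ --> X](mulr0 8); apply: cvgMl_tmp.
  rewrite -[X in _ --> X]sqrtr0; apply: continuous_cvg; first exact: sqrt_continuous.
  rewrite -(cvg_shiftS (fun N : nat => (N%:R^-1 : R))); exact: cvg_harmonic.
apply: (squeeze_cvgr _ (cvg_cst 0) sq0); exists 1%N => // N /= N1.
have N0 : (0 : R) < N%:R by rewrite ltr0n.
have N1' : (1 : R) <= N%:R by rewrite ler1n.
have t1 : (1 : R) <= N.+1%:R * N.+2%:R by rewrite -natrM ler1n.
apply/andP; split; first by rewrite divr_ge0 ?ln_ge0// ltW.
pose s := Num.sqrt (N%:R : R).
have s0 : 0 < s by rewrite sqrtr_gt0.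
have ss : s * s = N%:R by rewrite -expr2 sqr_sqrtr// ltW.
have le_t : N.+1%:R * N.+2%:R <= (2 * s) ^+ 4 :> R.
  have -> : (2 * s) ^+ 4 = 16 * (s * s) * (s * s) by ring.
  rewrite ss -!natr1; nra.
have le_ln : ln (N.+1%:R * N.+2%:R : R) <= 8 * s.
  apply: (@le_trans _ _ (ln ((2 * s) ^+ 4))).
    by rewrite ler_ln ?posrE ?exprn_gt0 ?mulr_gt0// (lt_le_trans _ t1).
  rewrite lnXn ?mulr_gt0//; have := ln_sublinear (_ : 0 < 2 * s).
  by move=> /(_ _)/ltW; rewrite mulr_gt0// => /(_ isT); rewrite -mulr_natl; lra.
rewrite ler_pdivrMr// sqrtrV ?(ltW N0)// -/s -ss.
by rewrite (_ : 8 * s^-1 * (s * s) = 8 * s)//; field; rewrite gt_eqF.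
Qed.

Lemma cvg_ceil_over_n (R : realType) (a : R) : 0 <= a ->
  (fun N : nat => (`|Num.ceil (a * N%:R)|%N)%:R / N%:R) @ \oo --> a.
Proof.
move=> a0.
have up : (fun N : nat => a + N%:R^-1) @ \oo --> a.
  rewrite -[X in _ --> X]addr0; apply: cvgD; first exact: cvg_cst.
  rewrite -(cvg_shiftS (fun N : nat => (N%:R^-1 : R))); exact: cvg_harmonic.
apply: (squeeze_cvgr _ (cvg_cst a) up); exists 1%N => // N /= N1.
have N0 : (0 : R) < N%:R by rewrite ltr0n.
have aN : 0 <= a * N%:R by rewrite mulr_ge0// ltW.
have c0 : 0 <= Num.ceil (a * N%:R) by rewrite ceil_ge0// (lt_le_trans _ aN)// ltrN10.
have -> : (`|Num.ceil (a * N%:R)|%N)%:R = (Num.ceil (a * N%:R))%:~R :> R.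
  by rewrite natr_absz ger0_norm.
rewrite ler_pdivlMr// ler_pdivrMr// ceil_ge/= mulrDl mulVf ?gt_eqF//.
by rewrite ltW// -ltrBlDr; have /andP[] := ceil_itv (a * N%:R); rewrite intrB.
Qed.

Lemma leq_ceil (R : realType) (a b : R) (N : nat) : 0 <= a -> a <= b ->
  (`|Num.ceil (a * N%:R)| <= `|Num.ceil (b * N%:R)|)%N.
Proof.
move=> a0 ab.
have le_ab : a * N%:R <= b * N%:R by rewrite ler_wpM2r.
have aN : 0 <= a * N%:R by rewrite mulr_ge0.
have ca : 0 <= Num.ceil (a * N%:R) by rewrite ceil_ge0// (lt_le_trans _ aN)// ltrN10.
rewrite -lez_nat !gez0_abs//; first by rewrite le_ceil.
by rewrite (le_trans ca)// le_ceil.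
Qed.

Lemma cvg_between_bounds (R : realType) (s U : nat -> R) (L : R) :
  (exists2 l : nat -> R, l @ \oo --> L & \forall N \near \oo, l N <= s N) ->
  (forall m, exists2 u : nat -> R, u @ \oo --> U m & \forall N \near \oo, s N <= u N) ->
  (forall k : nat, exists m, U m <= L + k.+1%:R^-1) -> s @ \oo --> L.
Proof.
move=> [l cl ll] up cls; apply/cvgrPdist_le => e e0.
have e20 : 0 < e / 2 by lra.
have [k ke] : exists k : nat, k.+1%:R^-1 < e / 2.
  exists (Num.truncn (e / 2)^-1).
  by rewrite -[ltRHS]invrK ltf_pV2 ?posrE ?truncnS_gt ?ltr0n ?invr_gt0.
have [m Um'] := cls k; have [u cu uu] := up m.
have Um : U m <= L + e / 2 by rewrite (le_trans Um')// lerD2l ltW.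
have nl : \forall N \near \oo, L - e < l N by apply: (cvgr_gt L cl); lra.
have nu : \forall N \near \oo, u N < U m + e / 2 by apply: (cvgr_lt (U m) cu); lra.
near=> N.
have h1 : L - e < l N by near: N.
have h2 : u N < U m + e / 2 by near: N.
have h3 : l N <= s N by near: N.
have h4 : s N <= u N by near: N.
rewrite ler_norml; apply/andP; split; lra.
Unshelve. all: by end_near. Qed.

Section linear_time_changes.
Context d (T : measurableType d) (R : realType).
Variable S : T -> T.
Implicit Type phi : T -> R.

Lemma birkhoff_sum_split phi a b z :
  birkhoff_sum S phi b (iter a S z) = birkhoff_sum S phi (a + b) z - birkhoff_sum S phi a z.
Proof.
elim: a z => [|a IH] z; first by rewrite /birkhoff_sum big_ord0 subr0.
by rewrite iterSr IH addSn !birkhoff_sumS; ring.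
Qed.

Lemma birkhoff_sum_linear phi (k : nat -> nat) (a l : R) z : 0 < a ->
  birkhoff_avg S phi ^~ z @ \oo --> l -> (fun N => (k N)%:R / N%:R) @ \oo --> a ->
  (fun N => birkhoff_sum S phi (k N) z / N%:R) @ \oo --> a * l.
Proof.
move=> a0 avg ka.
have avg' : (fun n => birkhoff_sum S phi n z / n%:R) @ \oo --> l.
  by rewrite -(cvg_shiftS (fun n => birkhoff_sum S phi n z / n%:R)).
have k_oo : k @ \oo --> \oo.
  apply/cvgnyPge => m.
  have half : \forall N \near \oo, a / 2 <= (k N)%:R / N%:R.
    by apply: (cvgr_ge _ ka); lra.
  have big : \forall N \near \oo, (m%:R * 2 / a <= N%:R :> R)%R.
    exists (Num.truncn (m%:R * 2 / a)).+1 => // N /= hN.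
    by rewrite ltW// (lt_le_trans (truncnS_gt _))// ler_nat.
  near=> N.
  have h1 : a / 2 <= (k N)%:R / N%:R by near: N.
  have h2 : (m%:R * 2 / a <= N%:R :> R)%R by near: N.
  have N0 : (0 : R) < N%:R by rewrite ltr0n; near: N; exists 1%N.
  rewrite -(ler_nat R); move: h1 h2.
  rewrite ler_pdivlMr// ler_pdivrMr//; lra.
have := cvg_comp _ _ k_oo avg' => comp.
have -> : (fun N => birkhoff_sum S phi (k N) z / N%:R) =
    (fun N => (k N)%:R / N%:R * (birkhoff_sum S phi (k N) z / (k N)%:R)).
  apply/funext => N; have [->|k0] := eqVneq (k N) 0%N.
    by rewrite /birkhoff_sum big_ord0 !mul0r.
  by rewrite mulrCA mulrAC mulfV ?mul1r// pnatr_eq0.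
exact: cvgM.
Unshelve. all: by end_near. Qed.

End linear_time_changes.

(** * Positivity and convergence of integrals *)

Section positivity_of_the_limit.
Context d (T : measurableType d) (R : realType) (nu : probability T R).
Variables (L : countType) (r : nat -> T -> L).
Hypothesis mr : forall n, mlabel (r n).
Hypothesis refine : forall n x y, r n.+1 x = r n.+1 y -> r n x = r n y.
Variables (A : set T) (mA : measurable A).

(** The limit has integral mu (A n {lim = 0}) over {lim = 0}. *)
Lemma cprob_lim_gt0 : {ae nu, forall x, A x -> 0 < cprob_lim nu r A x}.
Proof.
pose GG := [set B | exists n S, B = r n @^-1` S].
have rGG n S : <<s GG >> (r n @^-1` S) by apply: sub_gen_smallest; exists n, S.
have GGr B : GG B -> exists n S, B = r n @^-1` S by [].
have [pre ints] := cprob_lim_condexp nu mr refine mA GGr rGG.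
have g01 x : 0 <= cprob_lim nu r A x <= 1.
  by have [_] := cprob_lim_esup nu mr mA x.
pose B := (fun x => (cprob_lim nu r A x)%:E) @^-1` [set 0%E].
have GB : <<s GG >> B by apply: pre; exact: emeasurable_set1.
have mg := measurable_cprob_lim nu mr mA GGr rGG.
have mB : measurable B.
  have mgE : measurable_fun setT (fun x => (cprob_lim nu r A x)%:E) by exact/measurable_EFinP.
  by rewrite -[X in measurable X]setTI; apply: mgE => //; exact: emeasurable_set1.
have := ints _ GB; rewrite [X in X = _]integral0_eq; last by move=> x; rewrite /B/= => ->.
rewrite integral_indic// => /esym AB0.
exists (A `&` B); split=> //; first exact: measurableI.
move=> x /= /not_implyP[Ax /negP]; rewrite -leNgt => g0; split=> //.
by rewrite /B/=; congr (_%:E); apply/eqP; rewrite eq_le g0; have /andP[] := g01 x.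
Qed.

End positivity_of_the_limit.

Section convergence_of_integrals.
Context d (T : measurableType d) (R : realType) (mu : probability T R).

(** x <= min(x, t) + x^2 / t: a bound in L2 makes truncation uniformly small. *)
Lemma cvg_integral_L2_bounded (h : nat -> T -> R) (g : T -> R) (c : R) :
  (forall n, measurable_fun setT (h n)) -> measurable_fun setT g ->
  (forall n x, 0 <= h n x) -> (forall x, 0 <= g x) ->
  {ae mu, forall x, h ^~ x @ \oo --> g x} ->
  (forall n, \int[mu]_x (h n x ^+ 2)%:E <= c%:E)%E ->
  [/\ mu.-integrable setT (EFin \o g),
      forall n, mu.-integrable setT (EFin \o h n) &
      (fun n => \int[mu]_x h n x) @ \oo --> \int[mu]_x g x].
Proof.
move=> mh mg h0 g0 hg hc.
have sq_meas (u : T -> R) : measurable_fun setT u ->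
    measurable_fun setT (fun x : T => (u x ^+ 2)%:E).
  by move=> mu0; apply/measurable_EFinP; exact: measurable_funX.
have gc : (\int[mu]_x (g x ^+ 2)%:E <= c%:E)%E.
  have -> : (\int[mu]_x (g x ^+ 2)%:E =
      \int[mu]_x limn_einf (fun n => (h n x ^+ 2)%:E))%E.
    apply: ae_eq_integral => //.
    - exact: sq_meas.
    - rewrite /limn_einf; apply: measurableT_comp => //.
      by apply: measurable_fun_limn_esup => n; apply: measurableT_comp => //; exact: sq_meas.
    apply: filterS hg => x hx _.
    have cE : (fun n => (h n x ^+ 2)%:E) @ \oo --> (g x ^+ 2)%:E.
      apply: cvg_EFin; first exact: nearW.
      by rewrite /= expr2; apply: cvgM.
    by rewrite (cvg_limn_einf_sup cE).
  apply: (le_trans (fatou mu measurableT (fun n => sq_meas _ (mh n)) _)).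
    by move=> n x _; rewrite lee_fin sqr_ge0.
  have := limn_einf_sup (fun n => \int[mu]_x (h n x ^+ 2)%:E)%E.
  move=> /le_trans; apply.
  have /andP[//] : (0 <= limn_esup (fun n => \int[mu]_x (h n x ^+ 2)%:E) <= c%:E)%E.
  apply: limn_esup_itv => n; rewrite hc andbT; apply: integral_ge0 => x _.
  by rewrite lee_fin sqr_ge0.
have int_sq (u : T -> R) : measurable_fun setT u -> (forall x, 0 <= u x) ->
    (\int[mu]_x (u x ^+ 2)%:E <= c%:E)%E -> mu.-integrable setT (EFin \o u).
  move=> mfu u0 uc; apply/integrableP; split; first exact/measurable_EFinP.
  apply: (@le_lt_trans _ _ (\int[mu]_x ((u x ^+ 2)%:E + cst 1 x))%E).
    apply: ge0_le_integral => //.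
    - by apply: measurableT_comp => //; exact/measurable_EFinP.
    - by apply: emeasurable_funD => //; exact: sq_meas.
    - move=> x _; rewrite /= -EFinD lee_fin ger0_norm//.
      by rewrite -subr_ge0; have := sqr_ge0 (u x - 2^-1); rewrite !expr2; lra.
  rewrite ge0_integralD//; last 2 first.
  - by move=> x _; rewrite lee_fin sqr_ge0.
  - exact: sq_meas.
  rewrite integral_cst// mul1e probability_mass.
  by rewrite (le_lt_trans (leeD2r _ uc))// -EFinD ltry.
have ih n : mu.-integrable setT (EFin \o h n) by exact: int_sq.
have ig : mu.-integrable setT (EFin \o g) by exact: int_sq.
split=> //.
pose cut t (u : T -> R) x := Num.min (u x) t.
have bcut t (u : T -> R) : 0 <= t -> measurable_fun setT u -> (forall x, 0 <= u x) ->
    bounded_measurable (cut t u).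
  move=> t0 mfu u0; split; first exact: measurable_minr.
  by exists t => x; rewrite ger0_norm /cut ?le_min ?u0// ge_min lexx orbT.
have c0 : 0 <= c.
  by rewrite -lee_fin (le_trans _ gc)//; apply: integral_ge0 => x _; rewrite lee_fin sqr_ge0.
have cut_int t (u : T -> R) : 0 < t -> measurable_fun setT u -> (forall x, 0 <= u x) ->
    (\int[mu]_x (u x ^+ 2)%:E <= c%:E)%E ->
    \int[mu]_x cut t u x <= \int[mu]_x u x <= \int[mu]_x cut t u x + c / t.
  move=> t0 mfu u0 uc; have iu := int_sq u mfu u0 uc.
  have bc := bcut t u (ltW t0) mfu u0; have ic := bm_integrable mu bc.
  have mst : measurable_fun setT (fun x => t^-1 * u x ^+ 2).
    by apply: measurable_funM => //; exact: measurable_funX.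
  apply/andP; split.
    by apply: le_Rintegral => // x _; rewrite /cut ge_min lexx.
  have le_sq : (\int[mu]_x (t^-1 * u x ^+ 2)%:E <= (c / t)%:E)%E.
    under eq_integral do rewrite EFinM.
    rewrite ge0_integralZl//; last 3 first.
    - exact: sq_meas.
    - by move=> x _; rewrite lee_fin sqr_ge0.
    - by rewrite lee_fin invr_ge0 ltW.
    by rewrite mulrC EFinM lee_wpmul2l// lee_fin invr_ge0 ltW.
  have isq : mu.-integrable setT (EFin \o (fun x => t^-1 * u x ^+ 2)).
    apply/integrableP; split; first exact/measurable_EFinP.
    rewrite (le_lt_trans _ (ltry (c / t)))//; apply: le_trans le_sq.
    apply: ge0_le_integral => //.
    - by apply: measurableT_comp => //; exact/measurable_EFinP.
    - exact/measurable_EFinP.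
    - move=> x _; rewrite /= lee_fin ger0_norm// mulr_ge0 ?sqr_ge0//.
      by rewrite invr_ge0 ltW.
  apply: (@le_trans _ _ (\int[mu]_x (cut t u x + t^-1 * u x ^+ 2))).
    apply: le_Rintegral => //; first exact: (integrableD _ ic isq).
    move=> x _; rewrite /cut; have [ut|tu] := leP (u x) t.
      by rewrite lerDl mulr_ge0 ?sqr_ge0// invr_ge0 ltW.
    apply: (@le_trans _ _ (t^-1 * u x ^+ 2)); last by rewrite lerDr ltW.
    by rewrite mulrC ler_pdivlMr// expr2 ler_wpM2l// ltW.
  rewrite RintegralD// lerD2l -lee_fin; apply: le_trans le_sq.
  by rewrite /Rintegral fineK//; exact: integrable_fin_num isq.
have cut_cvg t : 0 < t -> (fun n => \int[mu]_x cut t (h n) x) @ \oo --> \int[mu]_x cut t g x.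
  move=> t0.
  have bg := bcut t g (ltW t0) mg g0.
  have bh n := bcut t (h n) (ltW t0) (mh n) (h0 n).
  have it : mu.-integrable setT (EFin \o cst t) by exact: finite_measure_integrable_cst.
  have mEg : measurable_fun setT (EFin \o cut t g) by apply/measurable_EFinP; case: bg.
  have mEh n : measurable_fun setT (EFin \o cut t (h n)) by apply/measurable_EFinP; case: (bh n).
  have [] := dominated_convergence measurableT mEh mEg _ it _.
  - apply: filterS hg => x hx _; apply: cvg_EFin; first exact: nearW.
    apply/cvgrPdist_le => e e0; move/cvgrPdist_le/(_ e e0): hx.
    apply: filterS => n; apply: le_trans; rewrite /= /cut.
    have := ler_norm (g x - h n x); have := ler_norm (- (g x - h n x)); rewrite normrN.
    by move=> ? ?; have [?|?] := leP (g x) t; have [?|?] := leP (h n x) t;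
      rewrite ler_norml; apply/andP; split; lra.
  - apply: aeW => x n _; rewrite /= lee_fin ger0_norm /cut ?ge_min ?lexx ?orbT//.
    by rewrite le_min h0 ltW.
  move=> _ _ cv; rewrite /Rintegral; apply: fine_cvg.
  by rewrite fineK//; exact: integrable_fin_num (bm_integrable mu bg).
apply/cvgrPdist_le => e e0.
pose t := (c + 1) * 4 / e.
have t0 : 0 < t by rewrite divr_gt0// mulr_gt0//; lra.
have ct : c / t <= e / 4.
  rewrite ler_pdivrMr// (_ : e / 4 * t = c + 1) ?lerDl//.
  by rewrite /t; field; rewrite gt_eqF.
have /cvgrPdist_le/(_ (e / 2)) := cut_cvg t t0.
move=> /(_ _)[|N _ hN]; first lra.
exists N => // n /= Nn; have := hN n Nn.
have /andP[] := cut_int t g t0 mg g0 gc.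
have /andP[] := cut_int t (h n) t0 (mh n) (h0 n) (hc n).
by rewrite !ler_norml => a1 a2 a3 a4 /andP[a5 a6]; apply/andP; split; lra.
Qed.

(** Markov's inequality for the thresholds (N + 1)(N + 2), followed by the
    Borel-Cantelli lemma. *)
Lemma eventually_le_square (W : nat -> T -> R) :
  (forall N, measurable_fun setT (W N)) -> (forall N x, 0 <= W N x) ->
  (forall N, \int[mu]_x (W N x)%:E <= 1)%E ->
  {ae mu, forall x, \forall N \near \oo, W N x <= N.+1%:R * N.+2%:R}.
Proof.
move=> mW W0 W1.
pose B N := [set x | (N.+1%:R * N.+2%:R : R) < W N x].
have mB N : measurable (B N) by exact: measurable_set_lt.
have muB N : (mu (B N) <= ((N.+1%:R * N.+2%:R)^-1)%:E)%E.
  have t0 : (0 : R) < N.+1%:R * N.+2%:R by rewrite mulr_gt0.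
  have mWE : measurable_fun setT (EFin \o W N) by exact/measurable_EFinP.
  have := le_integral_abse mu measurableT mWE t0.
  have -> : (\int[mu]_x `|(EFin \o W N) x| = \int[mu]_x (W N x)%:E)%E.
    by apply: eq_integral => x _; rewrite /= ger0_norm.
  move=> /le_trans/(_ (W1 N)) h.
  rewrite -[_^-1%:E]mule1 lee_pdivlMl//; apply: le_trans h.
  apply: lee_wpmul2l; first by rewrite lee_fin ltW.
  apply: le_measure; rewrite ?inE//.
    apply: measurableI => //.
    rewrite (_ : [set x | _] = [set x | (N.+1%:R * N.+2%:R : R) <= `|W N x|]).
      by apply: measurable_set_le => //; exact: measurableT_comp.
    by apply/seteqP; split=> x /=; rewrite lee_fin.
  by move=> x /= Bx; split=> //=; rewrite lee_fin ger0_norm// ltW.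
have sumB : (\sum_(0 <= N <oo) mu (B N) < +oo)%E.
  apply: (@le_lt_trans _ _ 1%E); last exact: ltry.
  apply: lime_le; first exact: is_cvg_nneseries.
  apply: nearW => n.
  apply: (@le_trans _ _ (\sum_(0 <= N < n) ((N.+1%:R * N.+2%:R)^-1)%:E)%E).
    by apply: lee_sum => N _; exact: muB.
  rewrite sumEFin lee_fin.
  have -> : \sum_(0 <= N < n) (N.+1%:R * N.+2%:R)^-1 = 1 - n.+1%:R^-1 :> R.
    elim: n => [|n IH]; first by rewrite big_nil invr1 subrr.
    rewrite big_nat_recr//= IH; field.
    by rewrite !nat1r -!natrD; apply/andP; split; rewrite ?pnatr_eq0.
  by rewrite lerBlDr lerDl invr_ge0.
have B0 := lim_sup_set_cvg0 mB sumB.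
exists (lim_sup_set B); split=> //.
  by apply: bigcap_measurable => // n _; exact: bigcup_measurable.
move=> x /= nW n _; apply: contrapT => nB; apply: nW.
exists n => // N /= nN; rewrite leNgt; apply/negP => BN.
by apply: nB; exists N.
Qed.

Lemma fatou_ae_le1 (W : nat -> T -> R) (V : T -> R) :
  (forall n, measurable_fun setT (W n)) -> (forall n x, 0 <= W n x) ->
  measurable_fun setT V -> {ae mu, forall x, W ^~ x @ \oo --> V x} ->
  (forall n, \int[mu]_x (W n x)%:E <= 1)%E -> (\int[mu]_x (V x)%:E <= 1)%E.
Proof.
move=> mW W0 mV cv W1.
have mWE n : measurable_fun setT (fun x => (W n x)%:E) by exact/measurable_EFinP.
have -> : (\int[mu]_x (V x)%:E = \int[mu]_x limn_einf (fun n => (W n x)%:E))%E.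
  apply: ae_eq_integral => //.
  - exact/measurable_EFinP.
  - rewrite /limn_einf; apply: measurableT_comp => //.
    by apply: measurable_fun_limn_esup => n; apply: measurableT_comp.
  apply: filterS cv => x cx _.
  have cE : (fun n => (W n x)%:E) @ \oo --> (V x)%:E.
    by apply: cvg_EFin; first exact: nearW.
  by rewrite (cvg_limn_einf_sup cE).
apply: (le_trans (fatou mu measurableT mWE _)); first by move=> n x _; rewrite lee_fin.
apply: (le_trans (limn_einf_sup _)).
have /andP[//] : (0 <= limn_esup (fun n => \int[mu]_x (W n x)%:E) <= 1)%E.
by apply: limn_esup_itv => n; rewrite W1 andbT; apply: integral_ge0 => x _; rewrite lee_fin.
Qed.

End convergence_of_integrals.

(** * Fibre measures along the skew product *)

Section skew_product_of_a_disintegrated_measure.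
Context d d' (Om : measurableType d) (X : measurableType d') (R : realType).
Variables (P : probability Om R) (mu_ : R.-pker Om ~> X).
Variable mu : probability (Om * X)%type R.
Hypothesis mu_dis : disintegration P mu_ mu.
Variables (theta : Om -> Om) (f : Om -> X -> X).
Hypothesis theta_meas : measurable_fun setT theta.
Hypothesis theta_pres : invariant_measure P theta.
Hypothesis theta_inv : invertible theta.
Hypothesis f_meas : measurable_fun setT (fun z : Om * X => f z.1 z.2).
Local Notation Th := (skew_product theta f).
Hypothesis mu_inv : invariant_measure mu Th.
Local Notation Z := (Om * X)%type.

Lemma measurable_skew_product : measurable_fun setT (Th : Z -> Z).
Proof.
apply/measurable_fun_pairP; split => //=.
exact: (measurableT_comp theta_meas (@measurable_fst _ _ _ _)).
Qed.

Let mTh := measurable_skew_product.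

Let measurable_preimage_skew (A : set Z) : measurable A -> measurable (Th @^-1` A).
Proof. by move=> mA; rewrite -[X in measurable X]setTI; exact: mTh. Qed.

(** The two sides have the same integral over theta^-1 D for all measurable D;
    as theta is invertible, these are all the measurable sets of the base.
    Without invertibility only an average of the right-hand side over the fibre
    of theta would be determined. *)
Lemma kernel_equivariant (A : set Z) : measurable A ->
  {ae P, forall w, mu_ (theta w) (xsection A (theta w)) =
                   mu_ w (xsection (Th @^-1` A) w)}.
Proof.
move=> mA; have mTA := measurable_preimage_skew mA.
have m1 : measurable_fun setT (fun w => mu_ (theta w) (xsection A (theta w))).
  exact: (measurableT_comp (measurable_kernel_xsection mu_ mA) theta_meas).
have m2 := measurable_kernel_xsection mu_ mTA.
have kle1 w B : measurable B -> (mu_ w B <= 1)%E.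
  by move=> mB; rewrite -(prob_kernel w (s := mu_)) le_measure ?inE.
have i2 : P.-integrable setT (fun w => mu_ w (xsection (Th @^-1` A) w)).
  apply/integrableP; split=> //.
  apply: (@le_lt_trans _ _ (\int[P]_w cst 1 w)%E); last first.
    by rewrite integral_cst// mul1e probability_mass ltry.
  apply: ge0_le_integral => //; first exact: measurableT_comp.
  by move=> w _; rewrite gee0_abs// kle1//; exact: measurable_xsection.
have [theta' mtheta' [thetaK theta'K]] := theta_inv.
suff : ae_eq P setT (fun w => mu_ w (xsection (Th @^-1` A) w))
    (fun w => mu_ (theta w) (xsection A (theta w))).
  by apply: filterS => w /(_ I) ->.
apply: integral_ae_eq => // D _ mD.
pose D' := theta' @^-1` D.
have mD' : measurable D' by rewrite -[X in measurable X]setTI; exact: mtheta'.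
have DE : theta @^-1` D' = D.
  by apply/seteqP; split=> w; rewrite /D'/= thetaK.
have base_int (B : set Z) (E : set Om) : measurable B -> measurable E ->
    (\int[P]_(w in E) mu_ w (xsection B w) = mu (B `&` E `*` setT))%E.
  move=> mB mE; rewrite mu_dis; last by apply: measurableI => //; exact: measurableX.
  rewrite integral_mkcond; apply: eq_integral => w _.
  rewrite patchE xsectionI; case: ifPn => wE.
    by rewrite in_xsectionX// setIT.
  by rewrite notin_xsectionX// setI0 measure0.
rewrite base_int//.
have -> : Th @^-1` A `&` D `*` setT = Th @^-1` (A `&` D' `*` setT).
  by rewrite preimage_setI -DE; apply/seteqP; split=> -[w x].
rewrite mu_inv; last by apply: measurableI => //; exact: measurableX.
rewrite -base_int// [LHS]integral_mkcond [RHS]integral_mkcond.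
rewrite -[LHS](ge0_integral_invariant theta_meas theta_pres); last 2 first.
- apply/(measurable_restrictT _ mD').1/measurable_funTS.
  exact: measurable_kernel_xsection.
- by move=> w; rewrite patchE; case: ifP.
apply: eq_integral => w _; rewrite !patchE -DE.
by congr (if _ then _ else _); apply/idP/idP; rewrite !inE.
Qed.

Lemma label_mass_skew (L : countType) (r : Z -> L) : mlabel r ->
  {ae mu, forall z, label_mass mu_ r (Th z) = label_mass mu_ (r \o Th) z}.
Proof.
move=> mr.
have aeP : {ae P, forall w, forall l : L,
    mu_ (theta w) (xsection (r @^-1` [set l]) (theta w)) =
    mu_ w (xsection (Th @^-1` (r @^-1` [set l])) w)}.
  by apply: ae_countable => l; apply: kernel_equivariant; exact: mr.
apply: filterS (ae_base mu_dis aeP) => -[w x] /= h.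
by rewrite /label_mass /mass/=; congr fine; exact: (h (r (Th (w, x)))).
Qed.

Lemma label_massP (K L : Type) (p : Z -> K) (r : Z -> L) z :
  label_mass mu_ (fun z => (p z, r z)) z = mass mu_ (same_label p z `&` same_label r z) z.
Proof.
rewrite /label_mass; congr mass; apply/seteqP; split=> y; rewrite /same_label/=.
  by move=> [-> ->].
by move=> [/= -> ->].
Qed.

Lemma label_cprobE (K L : Type) (p : Z -> K) (r : Z -> L) z :
  label_cprob mu_ p r z = label_mass mu_ (fun z => (p z, r z)) z / label_mass mu_ r z.
Proof. by rewrite label_massP. Qed.

(** The points in massless blocks form a union N of blocks, so that the
    measure of N is the integral over N of the conditional probability of the
    whole space given r. The latter is 0 on massless blocks. *)
Lemma label_mass_gt0 (L : countType) (r : Z -> L) : mlabel r ->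
  {ae mu, forall z, 0 < label_mass mu_ r z}.
Proof.
move=> mr; have mJ := measurable_label_mass mu_ mr.
pose N := [set z | label_mass mu_ r z <= 0].
have mN : measurable N by exact: measurable_set_le.
exists N; split=> //; last by move=> z /= /negP; rewrite -leNgt.
have rN : fiber_adapted r (\1_N : Z -> R).
  move=> w x y rxy; rewrite !indicE; congr (nat_of_bool _)%:R.
  have JJ : label_mass mu_ r (w, x) = label_mass mu_ r (w, y).
    by rewrite /label_mass /mass/= /same_label rxy.
  by apply/idP/idP; rewrite !inE /N/= JJ.
have m1N : measurable_fun setT (\1_N : Z -> R) by exact: measurable_indic.
have := ge0_rel_cprobE mu_dis mr measurableT m1N rN _.
have -> : (\int[mu]_z (\1_setT z * \1_N z)%:E = mu N :> \bar R)%E.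
  rewrite -[N in RHS]setIT -integral_indic//; apply: eq_integral => z _.
  by rewrite indicT mul1r.
move=> -> //; rewrite integral0_eq// => z _; congr (_%:E).
rewrite indicE; have [Nz|] := boolP (z \in N); last by rewrite mulr0.
have -> : rel_cprob mu_ setT r z = 0.
  rewrite /rel_cprob (_ : label_mass mu_ r z = 0) ?invr0 ?mulr0//.
  by apply/eqP; rewrite eq_le mass_ge0 andbT; move: Nz; rewrite inE.
by rewrite mul0r.
Qed.

Lemma mlabel_skew (L : countType) (r : Z -> L) : mlabel r -> mlabel (r \o Th).
Proof. by move=> mr; exact: mlabel_fun mr mTh. Qed.

Lemma label_cprob_gt0 (K L : countType) (p : Z -> K) (r : Z -> L) :
  mlabel p -> mlabel r -> {ae mu, forall z, 0 < label_cprob mu_ p r z}.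
Proof.
move=> mp mr.
apply: filterS2 (label_mass_gt0 (mlabel_pair mp mr)) (label_mass_gt0 mr) => z J1 J2.
by rewrite label_cprobE divr_gt0.
Qed.

Lemma label_cprob_itv (K L : countType) (p : Z -> K) (r : Z -> L) z :
  mlabel p -> mlabel r -> 0 <= label_cprob mu_ p r z <= 1.
Proof. by move=> mp mr; apply: rel_cprob_itv => //; exact: (mp [set p z]). Qed.

Lemma measurable_label_cprob (K L : countType) (p : Z -> K) (r : Z -> L) :
  mlabel p -> mlabel r -> measurable_fun setT (label_cprob mu_ p r).
Proof.
move=> mp mr; rewrite (_ : label_cprob mu_ p r = fun z =>
    label_mass mu_ (fun z => (p z, r z)) z * (label_mass mu_ r z)^-1); last first.
  by apply/funext => z; rewrite label_cprobE.
apply: measurable_funM; first by apply: measurable_label_mass; exact: mlabel_pair.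
apply: ge0_measurable_funV; first exact: measurable_label_mass.
by move=> z; exact: mass_ge0.
Qed.

(** One step of a likelihood ratio, built backwards in time: the weight C of the
    label at time 0 against its conditional probability given the later labels,
    times the ratio W of the later labels. *)
Definition ratio_cons (C : nat -> Z -> R) (p : Z -> nat) (L : Type) (r : Z -> L)
    (W : Z -> R) z : R :=
  C (p z) z / label_cprob mu_ p (r \o Th) z * W (Th z).

Section ratio_cons.
Variables (K : nat) (L : countType) (p : Z -> nat) (r : Z -> L).
Variables (C : nat -> Z -> R) (W : Z -> R).
Hypotheses (mp : mlabel p) (mr : mlabel r) (pK : forall z, (p z < K)%N).
Hypothesis mC : forall k, measurable_fun setT (C k).
Hypothesis C0 : forall k z, 0 <= C k z.
Hypothesis rC : forall k, fiber_adapted (r \o Th) (C k).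
Hypothesis C1 : forall z, \sum_(k < K) C k z <= 1.
Hypotheses (mW : measurable_fun setT W) (W0 : forall z, 0 <= W z).
Hypothesis rW : fiber_adapted r W.

Lemma ratio_cons_ge0 z : 0 <= ratio_cons C p r W z.
Proof.
have /andP[g0 _] := label_cprob_itv z mp (mlabel_skew mr).
by rewrite mulr_ge0// divr_ge0.
Qed.

Lemma measurable_ratio_cons : measurable_fun setT (ratio_cons C p r W).
Proof.
apply: measurable_funM; last exact: measurableT_comp.
apply: measurable_funM; first exact: mlabel_glue mp mC.
apply: ge0_measurable_funV.
  by apply: measurable_label_cprob => //; exact: mlabel_skew.
by move=> z; have /andP[] := label_cprob_itv z mp (mlabel_skew mr).
Qed.

Lemma fiber_adapted_skew (L' V : Type) (s : Z -> L') (h : Z -> V) :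
  fiber_adapted s h -> fiber_adapted (s \o Th) (h \o Th).
Proof. by move=> sh w x y; exact: sh. Qed.

Lemma ratio_cons_adapted :
  fiber_adapted (fun z => (p z, r (Th z))) (ratio_cons C p r W).
Proof.
move=> w x y [pxy rxy]; rewrite /ratio_cons pxy (rC _ rxy).
have -> : W (Th (w, x)) = W (Th (w, y)) by exact: fiber_adapted_skew rW _ _ _ rxy.
congr (_ / _ * _).
rewrite /label_cprob /rel_cprob /label_mass /mass/= /same_label/=.
by rewrite pxy rxy.
Qed.

Lemma integral_ratio_cons :
  (\int[mu]_z (ratio_cons C p r W z)%:E <= \int[mu]_z (W z)%:E)%E.
Proof.
rewrite -(ge0_integral_invariant mTh mu_inv (f := EFin \o W)); last 2 first.
- exact/measurable_EFinP.
- by move=> z; rewrite lee_fin.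
have := integral_ratio_le mu_dis mp (mlabel_skew mr) pK mC C0 rC C1
  (measurableT_comp mW mTh) (fun z => W0 (Th z)) (fiber_adapted_skew rW).
apply: le_trans; rewrite le_eqVlt; apply/orP; left; apply/eqP.
by apply: eq_integral => z _; rewrite /ratio_cons mulrC.
Qed.

End ratio_cons.

Section inverse_conditional_probability.
Variables (K : nat) (L : countType) (p : Z -> nat) (r : Z -> L).
Hypotheses (mp : mlabel p) (mr : mlabel r) (pK : forall z, (p z < K)%N).

Lemma label_bound_gt0 : (0 < K)%N.
Proof. exact: leq_ltn_trans (pK point). Qed.

(** The likelihood ratio of the uniform law on K labels is at most 1 in the
    mean. *)
Lemma integral_label_cprobV :
  (\int[mu]_z ((label_cprob mu_ p r z)^-1)%:E <= K%:R%:E)%E.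
Proof.
have K0 := label_bound_gt0.
have g0 z : 0 <= label_cprob mu_ p r z by have /andP[] := label_cprob_itv z mp mr.
have h : (\int[mu]_z (1 * (K%:R^-1 / label_cprob mu_ p r z))%:E <= \int[mu]_z 1%:E)%E.
  apply: (integral_ratio_le mu_dis mp mr pK (C := fun _ _ => K%:R^-1) (u := fun=> 1)) => //.
  by move=> z; rewrite sumr_const card_ord -[leLHS]mulr_natl mulfV// pnatr_eq0 -lt0n.
have {h} : (\int[mu]_z (K%:R^-1%:E * ((label_cprob mu_ p r z)^-1)%:E) <= 1)%E.
  have -> : (1 = \int[mu]_z (cst 1 z))%E by rewrite integral_cst// mul1e probability_mass.
  by under eq_integral do rewrite -EFinM -[(_ / _)%R]mul1r.
rewrite ge0_integralZl// ?lee_fin ?invr_ge0//; last 2 first.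
- apply/measurable_EFinP; apply: ge0_measurable_funV => //; exact: measurable_label_cprob.
- by move=> z _; rewrite lee_fin invr_ge0.
by rewrite muleC lee_pdivrMr ?ltr0n// mul1e.
Qed.

End inverse_conditional_probability.

Lemma mlabel_cons (p : Z -> nat) (r : Z -> seq nat) :
  mlabel p -> mlabel r -> mlabel (fun z => p z :: r (Th z)).
Proof.
move=> mp mr.
exact: (mlabel_comp (fun kl => kl.1 :: kl.2) (mlabel_pair mp (mlabel_skew mr))).
Qed.

(** Chain rule: by equivariance of the fibre measures, the block of r o Th at
    z has the mass of the block of r at Th z. *)
Lemma label_mass_cons (p : Z -> nat) (r : Z -> seq nat) : mlabel p -> mlabel r ->
  {ae mu, forall z, label_mass mu_ (fun z => p z :: r (Th z)) z =
    label_cprob mu_ p (r \o Th) z * label_mass mu_ r (Th z)}.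
Proof.
move=> mp mr.
apply: filterS2 (label_mass_skew mr) (label_mass_gt0 (mlabel_skew mr)) => z -> J0.
rewrite label_cprobE divfK ?gt_eqF// /label_mass; congr mass.
by apply/seteqP; split=> y; rewrite /same_label/= => -[-> ->].
Qed.

Fixpoint itin (p : Z -> nat) n z : seq nat :=
  if n is m.+1 then p z :: itin p m (Th z) else [::].

Lemma mlabel_itin (p : Z -> nat) n : mlabel p -> mlabel (itin p n).
Proof.
move=> mp; elim: n => [|n IH]; last exact: mlabel_cons.
by move=> S; rewrite preimage_cst; case: ifP.
Qed.

Lemma itin_refine p n x y : itin p n.+1 x = itin p n.+1 y -> itin p n x = itin p n y.
Proof.
elim: n x y => [//|n IH] x y h.
have hT : itin p n.+1 (Th x) = itin p n.+1 (Th y) := congr1 behead h.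
exact: (congr2 cons (congr1 (head 0%N) h) (IH _ _ hT)).
Qed.

(** * Information of one label given its future *)

Section one_process.
Variables (K : nat) (p : Z -> nat) (mp : mlabel p) (pK : forall z, (p z < K)%N).

Let future n := itin p n \o Th.

Let mfuture n : mlabel (future n).
Proof. by apply: mlabel_skew; exact: mlabel_itin. Qed.

Let mpk k : measurable (p @^-1` [set k]). Proof. exact: mp. Qed.

Let mfuture_cprob n : measurable_fun setT (label_cprob mu_ p (itin p n \o Th)) :=
  measurable_label_cprob mp (mfuture n).

Definition cinfo n z : R := - ln (label_cprob mu_ p (itin p n \o Th) z).

Lemma cinfo_ge0 n z : 0 <= cinfo n z.
Proof.
by rewrite oppr_ge0 ln_le0//; have /andP[] := label_cprob_itv z mp (mfuture n).
Qed.

Lemma measurable_cinfo n : measurable_fun setT (cinfo n).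
Proof.
apply: measurableT_comp => //; apply: (measurableT_comp (@measurable_ln R)).
exact: mfuture_cprob.
Qed.

Definition future_cprob z : R :=
  fine (limn_esup (fun n => (label_cprob mu_ p (itin p n \o Th) z)%:E)).

Definition cinfo_lim z : R := - ln (future_cprob z).

Lemma measurable_future_cprob : measurable_fun setT future_cprob.
Proof.
apply: measurableT_comp => //.
apply: measurable_fun_limn_esup => n; apply/measurable_EFinP.
exact: mfuture_cprob.
Qed.

Lemma measurable_cinfo_lim : measurable_fun setT cinfo_lim.
Proof.
apply: measurableT_comp => //; apply: (measurableT_comp (@measurable_ln R)).
exact: measurable_future_cprob.
Qed.

Lemma future_fiberE n w x : label_cprob mu_ p (itin p n \o Th) (w, x) =
  cprob (fiber_prob mu_ w) (xsection (p @^-1` [set p (w, x)]) w)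
    (fun y => itin p n (Th (w, y))) x.
Proof. exact: (rel_cprobE mu_ (itin p n \o Th) (p @^-1` [set p (w, x)]) w x). Qed.

Lemma future_cprob_fiberE w x : future_cprob (w, x) =
  cprob_lim (fiber_prob mu_ w) (fun n y => itin p n (Th (w, y)))
    (xsection (p @^-1` [set p (w, x)]) w) x.
Proof.
rewrite /future_cprob /cprob_lim; congr (fine (limn_esup _)).
by apply/funext => n; rewrite future_fiberE.
Qed.

Lemma mlabel_future_fiber n w : mlabel (fun y => itin p n (Th (w, y))).
Proof. exact: (mlabel_fiber (mfuture n) w). Qed.

Lemma future_refine n w x y : itin p n.+1 (Th (w, x)) = itin p n.+1 (Th (w, y)) ->
  itin p n (Th (w, x)) = itin p n (Th (w, y)).
Proof. exact: itin_refine. Qed.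

Lemma future_cprob_itv z : 0 <= future_cprob z <= 1.
Proof.
case: z => w x; rewrite future_cprob_fiberE.
by have [_] := cprob_lim_esup (fiber_prob mu_ w) (mlabel_future_fiber^~ w)
  (measurable_xsection w (mpk (p (w, x)))) x.
Qed.

Lemma cinfo_lim_ge0 z : 0 <= cinfo_lim z.
Proof. by rewrite oppr_ge0 ln_le0//; have /andP[] := future_cprob_itv z. Qed.

Lemma fiber_probE w : mu_ w = fiber_prob mu_ w :> {measure set X -> \bar R}.
Proof. exact: eq_measure. Qed.

(** The convergence of conditional probabilities along an increasing sequence
    of partitions, applied to mu_ w for each w. *)
Lemma label_cprob_cvg : {ae mu, forall z,
  label_cprob mu_ p (itin p n \o Th) z @[n --> \oo] --> future_cprob z}.
Proof.
pose u z n := (label_cprob mu_ p (itin p n \o Th) z)%:E.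
have settled : {ae mu, forall z, (limn_esup (u z) <= limn_einf (u z))%E}.
  apply: (ae_of_fibers mu_dis).
    rewrite -[X in measurable X]setTI; apply: measurable_lee => //.
      apply: measurable_fun_limn_esup => n; apply/measurable_EFinP.
      exact: mfuture_cprob.
    rewrite /limn_einf; apply: measurableT_comp => //.
    apply: measurable_fun_limn_esup => n; apply: measurableT_comp => //.
    by apply/measurable_EFinP; exact: mfuture_cprob.
  apply: aeW => w; rewrite fiber_probE.
  have : {ae fiber_prob mu_ w, forall x, forall k,
      cvgn (fun n => cprob (fiber_prob mu_ w) (xsection (p @^-1` [set k]) w)
        (fun y => itin p n (Th (w, y))) x)}.
    apply/ae_foralln => k; apply: cprob_cvg_ae.
    - by move=> n; exact: mlabel_future_fiber.
    - by move=> n x y; exact: future_refine.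
    - exact: measurable_xsection.
  apply: filterS => x /(_ (p (w, x))) cx.
  rewrite (_ : u (w, x) = EFin \o (fun n => cprob (fiber_prob mu_ w)
    (xsection (p @^-1` [set p (w, x)]) w) (fun y => itin p n (Th (w, y))) x)).
    have cE : EFin \o (fun n => cprob (fiber_prob mu_ w) (xsection (p @^-1` [set p (w, x)]) w)
        (fun y => itin p n (Th (w, y))) x) @ \oo --> (limn (fun n => cprob (fiber_prob mu_ w)
        (xsection (p @^-1` [set p (w, x)]) w) (fun y => itin p n (Th (w, y))) x))%:E.
      by apply: cvg_EFin; [exact: nearW|exact: cx].
    by rewrite !(cvg_limn_einf_sup cE).
  by apply/funext => n; rewrite /u/= future_fiberE.
apply: filterS settled => z /cvg_limn_esup_einf.
have /andP[l0 l1] : (0 <= limn_esup (u z) <= 1)%E.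
  by apply: limn_esup_itv => n; rewrite !lee_fin; exact: (label_cprob_itv z mp (mfuture n)).
have lf : limn_esup (u z) \is a fin_num by rewrite ge0_fin_numE// (le_lt_trans l1)// ltry.
by rewrite -{1}(fineK lf) => /fine_cvg.
Qed.

Lemma future_cprob_gt0 : {ae mu, forall z, 0 < future_cprob z}.
Proof.
apply: (ae_of_fibers mu_dis).
  by apply: measurable_set_lt => //; exact: measurable_future_cprob.
apply: aeW => w; rewrite fiber_probE.
have : {ae fiber_prob mu_ w, forall x, forall k, xsection (p @^-1` [set k]) w x ->
    0 < cprob_lim (fiber_prob mu_ w) (fun n y => itin p n (Th (w, y)))
      (xsection (p @^-1` [set k]) w) x}.
  apply/ae_foralln => k; apply: cprob_lim_gt0.
  - by move=> n; exact: mlabel_future_fiber.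
  - by move=> n x y; exact: future_refine.
  - exact: measurable_xsection.
apply: filterS => x /(_ (p (w, x))) h; rewrite future_cprob_fiberE; apply: h.
by apply/xsectionP.
Qed.

Lemma cinfo_cvg : {ae mu, forall z, cinfo ^~ z @ \oo --> cinfo_lim z}.
Proof.
apply: filterS2 label_cprob_cvg future_cprob_gt0 => z cz z0.
apply: cvgN; apply: continuous_cvg cz.
exact: continuous_ln.
Qed.

(** From ln s < s for s = t^(- 1 / 2). *)
Let ln_sqr_le (t : R) : 0 <= t <= 1 -> (- ln t) ^+ 2 <= 4 * t^-1.
Proof.
move=> /andP[]; rewrite le_eqVlt => /predU1P[<- _|t0 t1].
  by rewrite ln0// oppr0 expr0n/= invr0 mulr0.
have s0 : 0 < Num.sqrt t^-1 by rewrite sqrtr_gt0 invr_gt0.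
have lnE : - ln t = ln (Num.sqrt t^-1) *+ 2.
  by rewrite -lnXn// sqr_sqrtr ?invr_ge0 ?ltW// lnV ?posrE.
have ln_le := ltW (ln_sublinear s0).
have ln_ge : 0 <= - ln t by rewrite oppr_ge0 ln_le0.
have le_s : - ln t <= 2 * Num.sqrt t^-1 by rewrite lnE mulr2n; lra.
have := ler_pM ln_ge ln_ge le_s le_s; rewrite -expr2 mulrACA -expr2.
have -> // : 2 ^+ 2 * (Num.sqrt t^-1 * Num.sqrt t^-1) = 4 * t^-1 :> R.
by rewrite -[X in _ * X]expr2 sqr_sqrtr ?invr_ge0 ?ltW//; ring.
Qed.

(** (ln t)^2 <= 4 / t, and the inverse of a conditional probability of one of
    K labels has mean at most K. *)
Lemma integral_cinfo_sqr n : (\int[mu]_z (cinfo n z ^+ 2)%:E <= (4 * K%:R)%:E)%E.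
Proof.
have g01 z := label_cprob_itv z mp (mfuture n).
have mg : measurable_fun setT (fun z => (label_cprob mu_ p (itin p n \o Th) z)^-1).
  apply: ge0_measurable_funV; first exact: mfuture_cprob.
  by move=> z; have /andP[] := g01 z.
apply: (@le_trans _ _ (\int[mu]_z (4%:E * ((label_cprob mu_ p (itin p n \o Th) z)^-1)%:E))%E).
  apply: ge0_le_integral => //.
  - by move=> z _; rewrite lee_fin sqr_ge0.
  - by apply/measurable_EFinP/measurable_funX; exact: measurable_cinfo.
  - by apply: emeasurable_funM => //; exact/measurable_EFinP.
  - by move=> z _; rewrite -EFinM lee_fin ln_sqr_le.
rewrite ge0_integralZl//; last 2 first.
- exact/measurable_EFinP.
- by move=> z _; rewrite lee_fin invr_ge0; have /andP[] := g01 z.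
rewrite EFinM; apply: lee_wpmul2l; first by rewrite lee_fin.
exact: (integral_label_cprobV mp (mfuture n) pK).
Qed.

Lemma cinfo_integral_cvg :
  [/\ mu.-integrable setT (EFin \o cinfo_lim),
      forall n, mu.-integrable setT (EFin \o cinfo n) &
      (fun n => \int[mu]_z cinfo n z) @ \oo --> \int[mu]_z cinfo_lim z].
Proof.
apply: (cvg_integral_L2_bounded measurable_cinfo measurable_cinfo_lim cinfo_ge0
  cinfo_lim_ge0 cinfo_cvg integral_cinfo_sqr).
Qed.

Definition itin_info n z : R := - ln (label_mass mu_ (itin p n) z).

Lemma label_mass_le1 (L : countType) (r : Z -> L) z : mlabel r -> label_mass mu_ r z <= 1.
Proof.
move=> mr; have mz := measurable_same_label z mr.
apply: (le_trans (le_mass mu_ z mz measurableT (@subsetT _ _))).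
rewrite /mass (_ : xsection _ _ = setT) ?prob_kernel//.
by apply/seteqP; split=> // x _; apply/xsectionP.
Qed.

Lemma itin_info_cons n : {ae mu, forall z, itin_info n.+1 z = cinfo n z + itin_info n (Th z)}.
Proof.
have mi := mlabel_itin n mp.
apply: filterS3 (label_mass_cons mp mi) (label_cprob_gt0 mp (mfuture n))
  (ae_invariant mTh mu_inv (label_mass_gt0 mi)) => z J G0 J0.
by rewrite /itin_info /cinfo [label_mass _ _ _]J lnM ?posrE// opprD.
Qed.

(** Each step of the chain rule adds the information of a label given its
    future, by invariance of mu. *)
Lemma integral_itin_info n :
  (\int[mu]_z (itin_info n z)%:E = (\sum_(k < n) \int[mu]_z cinfo k z)%:E)%E.
Proof.
have mI k : measurable_fun setT (itin_info k).
  apply: measurableT_comp => //; apply: (measurableT_comp (@measurable_ln R)).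
  by apply: measurable_label_mass; exact: mlabel_itin.
have I0 k z : 0 <= itin_info k z.
  by rewrite oppr_ge0 ln_le0// label_mass_le1//; exact: mlabel_itin.
elim: n => [|n IH].
  rewrite big_ord0 integral0_eq// => z _; rewrite /itin_info /label_mass /mass.
  rewrite (_ : xsection _ _ = setT) ?prob_kernel/= ?ln1 ?oppr0//.
  by apply/seteqP; split=> // x _; apply/xsectionP.
rewrite big_ord_recr/= EFinD -IH.
have [_ ic _] := cinfo_integral_cvg.
have -> : (\int[mu]_z (itin_info n.+1 z)%:E =
    \int[mu]_z ((cinfo n z)%:E + (itin_info n (Th z))%:E))%E.
  apply: ae_eq_integral => //.
  - exact/measurable_EFinP.
  - apply: emeasurable_funD; first by apply/measurable_EFinP; exact: measurable_cinfo.
    by apply/measurable_EFinP; exact: measurableT_comp (mI n) mTh.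
  - by apply: filterS (itin_info_cons n) => z -> _; rewrite EFinD.
rewrite ge0_integralD//; last 4 first.
- by move=> z _; rewrite lee_fin cinfo_ge0.
- by apply/measurable_EFinP; exact: measurable_cinfo.
- by move=> z _; rewrite lee_fin.
- by apply/measurable_EFinP; exact: measurableT_comp (mI n) mTh.
rewrite addeC (ge0_integral_invariant mTh mu_inv (f := EFin \o itin_info n)); last 2 first.
- exact/measurable_EFinP.
- by move=> z; rewrite lee_fin.
by congr (_ + _)%E; rewrite /Rintegral fineK//; exact: integrable_fin_num (ic n).
Qed.

Lemma entropy_rate_cvg :
  (fun n => n%:R^-1 * \sum_(k < n) \int[mu]_z cinfo k z) @ \oo --> \int[mu]_z cinfo_lim z.
Proof.
have [_ _ /cesaro h] := cinfo_integral_cvg.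
rewrite -(cvg_shiftS (fun n => n%:R^-1 * \sum_(k < n) \int[mu]_z cinfo k z)).
move: h; rewrite /arithmetic_mean.
by under eq_fun do rewrite seriesEord/=.
Qed.

End one_process.

(** * Likelihood ratios and the two bounds *)

Definition subprobability (K : nat) (L : Type) (r : Z -> L) (C : nat -> Z -> R) :=
  [/\ forall k, measurable_fun setT (C k), forall k z, 0 <= C k z,
      forall k, fiber_adapted r (C k) & forall z, \sum_(k < K) C k z <= 1].

(** A ratio between a subprobability on the labels and the law of the labels
    under mu_w has these properties, the last of which is what Markov's
    inequality needs. *)
Definition likelihood_ratio (L : Type) (r : Z -> L) (W : Z -> R) :=
  [/\ measurable_fun setT W, forall z, 0 <= W z, fiber_adapted r W &
      (\int[mu]_z (W z)%:E <= 1)%E].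

Lemma likelihood_ratio1 (L : Type) (r : Z -> L) : likelihood_ratio r (fun=> 1).
Proof. by split=> //; rewrite integral_cst// mul1e probability_mass. Qed.

Lemma likelihood_ratio_cons K (p : Z -> nat) (r : Z -> seq nat) C W :
  mlabel p -> (forall z, (p z < K)%N) -> mlabel r ->
  subprobability K (r \o Th) C -> likelihood_ratio r W ->
  likelihood_ratio (fun z => p z :: r (Th z)) (ratio_cons C p r W).
Proof.
move=> mp pK mr [mC C0 rC C1] [mW W0 rW W1]; split.
- exact: measurable_ratio_cons.
- by move=> z; apply: ratio_cons_ge0.
- by move=> w x y [pxy rxy]; apply: (ratio_cons_adapted rC rW); rewrite pxy rxy.
- apply: le_trans W1; exact: (integral_ratio_cons mp mr pK).
Qed.

Lemma likelihood_ratio_finer (L L' : Type) (r : Z -> L) (s : Z -> L') W :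
  (forall x y, s x = s y -> r x = r y) -> likelihood_ratio r W -> likelihood_ratio s W.
Proof. by move=> sr [mW W0 rW W1]; split=> // w x y /sr; exact: rW. Qed.

Lemma massU A B z : measurable A -> measurable B -> [disjoint A & B] ->
  mass mu_ (A `|` B) z = mass mu_ A z + mass mu_ B z.
Proof.
move=> mA mB AB; have [mAx mBx] := (measurable_xsection z.1 mA, measurable_xsection z.1 mB).
rewrite /mass (_ : xsection (A `|` B) _ = xsection A z.1 `|` xsection B z.1); last first.
  by rewrite !xsectionE preimage_setU.
rewrite -fineD ?kernel_fin_num// measureU//.
by rewrite -xsectionI; move/disj_set2P: AB => ->; rewrite xsection0.
Qed.

Lemma subprobability_cprob K (p : Z -> nat) (L : countType) (L' : Type)
    (s : Z -> L) (r : Z -> L') : mlabel p -> mlabel s ->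
  (forall x y, r x = r y -> s x = s y) ->
  subprobability K r (fun k => rel_cprob mu_ (p @^-1` [set k]) s).
Proof.
move=> mp ms rs.
have mpk k : measurable (p @^-1` [set k]) by exact: (mp [set k]).
split.
- by move=> k; exact: measurable_rel_cprob.
- by move=> k z; have /andP[] := rel_cprob_itv mu_ ms z (mpk k).
- by move=> k w x y /rs; exact: rel_cprob_adapted.
move=> z; have mS := measurable_same_label z ms.
rewrite /rel_cprob -mulr_suml.
suff -> : \sum_(k < K) mass mu_ (p @^-1` [set nat_of_ord k] `&` same_label s z) z =
    mass mu_ (p @^-1` [set k | (k < K)%N] `&` same_label s z) z.
  have [->|S0] := eqVneq (label_mass mu_ s z) 0; first by rewrite invr0 mulr0.
  rewrite ler_pdivrMr ?mul1r; last by rewrite lt0r S0 mass_ge0.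
  by apply: le_mass => //; apply: measurableI => //; exact: mp.
elim: K => [|n IH].
  rewrite big_ord0 (_ : _ `&` _ = set0); last by apply/seteqP; split=> x // -[].
  by rewrite /mass xsection0 measure0.
rewrite big_ord_recr/= IH -massU; last 3 first.
- by apply: measurableI => //; exact: mp.
- exact: measurableI.
- by apply/disj_setPS => x [[/= pn _] [/= pE _]]; rewrite pE ltnn in pn.
congr mass; rewrite -setIUl; congr (_ `&` _); apply/seteqP; split=> x /=.
  by case=> [/ltnW|->].
by rewrite ltnS leq_eqVlt => /predU1P[->|]; [right|left].
Qed.

Lemma subprobability_unif K (L : Type) (r : Z -> L) : (0 < K)%N ->
  subprobability K r (fun _ _ => K%:R^-1).
Proof.
by move=> K0; split=> // z; rewrite sumr_const card_ord -[leLHS]mulr_natl mulfV// pnatr_eq0 -lt0n.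
Qed.

Lemma ratio_cons_mass (C : nat -> Z -> R) (p : Z -> nat) (r : Z -> seq nat)
    (W c w : Z -> R) : mlabel p -> mlabel r ->
  {ae mu, forall z, C (p z) z = expR (- c z)} ->
  {ae mu, forall z, W z * label_mass mu_ r z = expR (- w z)} ->
  {ae mu, forall z, ratio_cons C p r W z * label_mass mu_ (fun z => p z :: r (Th z)) z =
                    expR (- (c z + w (Th z)))}.
Proof.
move=> mp mr aeC aeW.
have aeWT := ae_invariant mTh mu_inv aeW.
have aeG := label_cprob_gt0 mp (mlabel_skew mr).
have aeJ := label_mass_cons mp mr.
apply: filterS3 aeC aeWT (filterI aeG aeJ) => z Cz Wz [G0 ->].
rewrite /ratio_cons Cz opprD expRD -Wz; field.
by rewrite gt_eqF.
Qed.

Lemma ratio_cons_cvg (p : Z -> nat) (s : Z -> seq nat) (r : nat -> Z -> seq nat)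
    (W : nat -> Z -> R) (g w : Z -> R) : mlabel p -> mlabel s ->
  {ae mu, forall z, 0 < g z} ->
  {ae mu, forall z, label_cprob mu_ p (r M \o Th) z @[M --> \oo] --> g z} ->
  {ae mu, forall z, W M z @[M --> \oo] --> label_mass mu_ s z * expR (w z)} ->
  {ae mu, forall z,
    ratio_cons (fun k => rel_cprob mu_ (p @^-1` [set k]) (s \o Th)) p (r M) (W M) z
      @[M --> \oo] -->
    label_mass mu_ (fun z => p z :: s (Th z)) z * expR (- ln (g z) + w (Th z))}.
Proof.
move=> mp ms aeg aer aeW.
have aeWT := ae_invariant mTh mu_inv aeW.
have aeJ := label_mass_cons mp ms.
apply: filterS3 aeg aer (filterI aeWT aeJ) => z g0 cr [cW ->].
rewrite expRD -lnV ?posrE// lnK ?posrE ?invr_gt0//.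
rewrite (_ : _ * _ * _ = label_cprob mu_ p (s \o Th) z / g z *
  (label_mass mu_ s (Th z) * expR (w (Th z)))); last by rewrite !mulrA [_ * _ / _]mulrAC.
apply: cvgM => //; apply: cvgMl_tmp.
by apply: cvgV => //; rewrite gt_eqF.
Qed.

Section two_processes.
Variables (K1 : nat) (xi : Z -> nat) (mxi : mlabel xi) (xiK : forall z, (xi z < K1)%N).
Variables (K2 : nat) (eta : Z -> nat) (meta : mlabel eta) (etaK : forall z, (eta z < K2)%N).
Hypothesis xi_eta : forall x y, xi x = xi y -> eta x = eta y.

Fixpoint itin2 a b z : seq nat :=
  if a is a'.+1 then xi z :: itin2 a' b (Th z) else itin eta b z.

Lemma mlabel_itin2 a b : mlabel (itin2 a b).
Proof. by elim: a => [|a IH]; [exact: mlabel_itin|exact: mlabel_cons]. Qed.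

Lemma itin_finer n x y : itin xi n x = itin xi n y -> itin eta n x = itin eta n y.
Proof. by elim: n x y => //= n IH x y [/xi_eta -> /IH ->]. Qed.

Lemma itin_addr p n m x y : itin p (n + m) x = itin p (n + m) y -> itin p n x = itin p n y.
Proof. by elim: n x y => //= n IH x y [-> /IH ->]. Qed.

Lemma itin2_finer a b m x y :
  itin xi (a + b + m) x = itin xi (a + b + m) y -> itin2 a b x = itin2 a b y.
Proof.
elim: a x y => [|a IH] x y /=; last by move=> [-> /IH ->].
by move=> /itin_addr/itin_finer.
Qed.

Lemma itin_take p n m x y : (m <= n)%N -> itin p n x = itin p n y -> itin p m x = itin p m y.
Proof. by move=> /subnKC <-; exact: itin_addr. Qed.

Lemma itin2_take a b m x y : (m <= a)%N ->
  itin2 a b x = itin2 a b y -> itin xi m x = itin xi m y.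
Proof.
elim: a m x y => [|a IH] [|m] x y //= ma [-> h].
by rewrite (IH m _ _ ma h).
Qed.

(** Transition probabilities of the Markov approximation of order m. A factor
    with fewer than m later labels to condition on is replaced by the uniform
    law. *)
Definition markov_cprob (p : Z -> nat) K m n k z : R :=
  if (m <= n)%N then rel_cprob mu_ (p @^-1` [set k]) (itin p m \o Th) z else K%:R^-1.

Definition markov_info (p : Z -> nat) K m n z : R :=
  if (m <= n)%N then cinfo p m z else ln K%:R.

(** The law of the Markov approximation over the true law of the labels; cost1
    and cost2 are minus the logarithm of the former. *)
Fixpoint upper1 (p : Z -> nat) K m b z : R :=
  if b is b'.+1 then ratio_cons (markov_cprob p K m b') p (itin p b') (upper1 p K m b') z
  else 1.

Fixpoint upper2 m a b z : R :=
  if a is a'.+1 then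
    ratio_cons (markov_cprob xi K1 m a') xi (itin2 a' b) (upper2 m a' b) z
  else upper1 eta K2 m b z.

Fixpoint cost1 (p : Z -> nat) K m b z : R :=
  if b is b'.+1 then markov_info p K m b' z + cost1 p K m b' (Th z) else 0.

Fixpoint cost2 m a b z : R :=
  if a is a'.+1 then markov_info xi K1 m a' z + cost2 m a' b (Th z)
  else cost1 eta K2 m b z.

Lemma subprobability_markov p K m n (r : Z -> seq nat) : mlabel p -> (0 < K)%N ->
  ((m <= n)%N -> forall x y, r x = r y -> itin p m x = itin p m y) ->
  subprobability K (r \o Th) (markov_cprob p K m n).
Proof.
move=> mp K0 mr; rewrite /markov_cprob; case mn: (m <= n)%N.
  apply: subprobability_cprob => //.
    by apply: mlabel_skew; exact: mlabel_itin.
  by move=> x y; exact: mr mn _ _.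
exact: subprobability_unif.
Qed.

Lemma markov_cprobE p K m n : mlabel p -> (0 < K)%N ->
  {ae mu, forall z, markov_cprob p K m n (p z) z = expR (- markov_info p K m n z)}.
Proof.
move=> mp K0; rewrite /markov_cprob /markov_info; case: (m <= n)%N.
  apply: filterS (label_cprob_gt0 mp (mlabel_skew (mlabel_itin m mp))) => z G0.
  by rewrite /cinfo opprK lnK ?posrE.
by apply: aeW => z; rewrite -lnV ?posrE ?ltr0n// lnK ?posrE ?invr_gt0 ?ltr0n.
Qed.

Lemma likelihood_upper1 p K m b : mlabel p -> (forall z, (p z < K)%N) ->
  likelihood_ratio (itin p b) (upper1 p K m b).
Proof.
move=> mp pK; have K0 := label_bound_gt0 pK.
elim: b => [|b IH]; first exact: likelihood_ratio1.
apply: likelihood_ratio_cons IH => //; first exact: mlabel_itin.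
by apply: subprobability_markov => // mb x y; exact: itin_take.
Qed.

Lemma likelihood_upper2 m a b : likelihood_ratio (itin2 a b) (upper2 m a b).
Proof.
have K0 := label_bound_gt0 xiK.
elim: a => [|a IH]; first exact: likelihood_upper1.
apply: likelihood_ratio_cons IH => //; first exact: mlabel_itin2.
by apply: subprobability_markov => // mb x y; exact: itin2_take.
Qed.

Lemma upper1_mass p K m b : mlabel p -> (forall z, (p z < K)%N) ->
  {ae mu, forall z, upper1 p K m b z * label_mass mu_ (itin p b) z = expR (- cost1 p K m b z)}.
Proof.
move=> mp pK; have K0 := label_bound_gt0 pK.
elim: b => [|b IH].
  apply: aeW => z; rewrite /= oppr0 expR0 mul1r /label_mass /mass.
  rewrite (_ : xsection _ _ = setT) ?prob_kernel//.
  by apply/seteqP; split=> // x _; apply/xsectionP.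
exact: (ratio_cons_mass mp (mlabel_itin b mp) (markov_cprobE m b mp K0) IH).
Qed.

Lemma upper2_mass m a b :
  {ae mu, forall z, upper2 m a b z * label_mass mu_ (itin2 a b) z = expR (- cost2 m a b z)}.
Proof.
have K0 := label_bound_gt0 xiK.
elim: a => [|a IH]; first exact: upper1_mass.
exact: (ratio_cons_mass mxi (mlabel_itin2 a b) (markov_cprobE m a mxi K0) IH).
Qed.

Lemma markov_info_le p K m n z : mlabel p -> (0 < K)%N ->
  markov_info p K m n z <= cinfo p m z + (n < m)%N%:R * ln K%:R.
Proof.
move=> mp K0; rewrite /markov_info ltnNge; case: leqP => _ /=.
  by rewrite mul0r addr0.
by rewrite mul1r lerDr cinfo_ge0.
Qed.

Let minnS_ltn b m : (minn b.+1 m = (b < m)%N + minn b m)%N.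
Proof. by case: (ltnP b m) => ?; lia. Qed.

Lemma cost1_le p K m b z : mlabel p -> (0 < K)%N ->
  cost1 p K m b z <= birkhoff_sum Th (cinfo p m) b z + (minn b m)%:R * ln K%:R.
Proof.
move=> mp K0; elim: b z => [|b IH] z.
  by rewrite /= /birkhoff_sum big_ord0 min0n mul0r addr0.
rewrite birkhoff_sumS minnS_ltn natrD mulrDl.
have := IH (Th z); have := markov_info_le m b z mp K0 => /=; lra.
Qed.

Lemma birkhoff_sum0 (phi : Z -> R) z : birkhoff_sum Th phi 0 z = 0.
Proof. by rewrite /birkhoff_sum big_ord0. Qed.

Lemma cost2_le m a b z :
  cost2 m a b z <= birkhoff_sum Th (cinfo xi m) a z
    + birkhoff_sum Th (cinfo eta m) b (iter a Th z) + m%:R * (ln K1%:R + ln K2%:R).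
Proof.
have K10 := label_bound_gt0 xiK; have K20 := label_bound_gt0 etaK.
have ln_ge0 K : (0 < K)%N -> 0 <= ln (K%:R : R) by move=> K0; rewrite ln_ge0// ler1n.
suff h : cost2 m a b z <= birkhoff_sum Th (cinfo xi m) a z
    + birkhoff_sum Th (cinfo eta m) b (iter a Th z)
    + (minn a m)%:R * ln K1%:R + (minn b m)%:R * ln K2%:R.
  apply: (le_trans h); rewrite -addrA lerD2l mulrDr.
  by apply: lerD; apply: ler_wpM2r; rewrite ?ln_ge0// ler_nat geq_minr.
elim: a z => [|a IH] z.
  rewrite birkhoff_sum0 min0n mul0r add0r addr0; exact: cost1_le.
rewrite birkhoff_sumS minnS_ltn natrD mulrDl iterSr.
have := IH (Th z); have := markov_info_le m a z mxi K10 => /=; lra.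
Qed.

(** The likelihood ratio of the Markov approximation has mean at most 1, so it
    is eventually below (N + 1)(N + 2). *)
Lemma info_upper_bound m (a b : nat -> nat) : {ae mu, forall z, \forall N \near \oo,
  - ln (label_mass mu_ (itin2 (a N) (b N)) z) <=
    birkhoff_sum Th (cinfo xi m) (a N) z
    + birkhoff_sum Th (cinfo eta m) (b N) (iter (a N) Th z)
    + m%:R * (ln K1%:R + ln K2%:R) + ln (N.+1%:R * N.+2%:R)}.
Proof.
have good N := likelihood_upper2 m (a N) (b N).
have ev : {ae mu, forall z, \forall N \near \oo,
    upper2 m (a N) (b N) z <= N.+1%:R * N.+2%:R}.
  by apply: eventually_le_square => N; have [] := good N.
have aeM : {ae mu, forall z, forall N,
    upper2 m (a N) (b N) z * label_mass mu_ (itin2 (a N) (b N)) z =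
    expR (- cost2 m (a N) (b N) z)}.
  by apply/ae_foralln => N; exact: upper2_mass.
have aeJ : {ae mu, forall z, forall N, 0 < label_mass mu_ (itin2 (a N) (b N)) z}.
  by apply/ae_foralln => N; apply: label_mass_gt0; exact: mlabel_itin2.
apply: filterS3 ev aeM aeJ => z evz Mz Jz; apply: filterS evz => N le_T.
have T0 : (0 : R) < N.+1%:R * N.+2%:R by rewrite mulr_gt0.
apply: (@le_trans _ _ (cost2 m (a N) (b N) z + ln (N.+1%:R * N.+2%:R))); last first.
  by rewrite lerD2r cost2_le.
have : expR (- cost2 m (a N) (b N) z) <=
    N.+1%:R * N.+2%:R * label_mass mu_ (itin2 (a N) (b N)) z.
  by rewrite -Mz ler_wpM2r// ltW.
rewrite -ler_ln ?posrE ?expR_gt0 ?mulr_gt0// expRK lnM ?posrE//; lra.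
Qed.

(** The true law of the labels over the product of the conditional
    probabilities given a future that extends M steps beyond the observed
    labels. *)
Fixpoint lower1 (p : Z -> nat) M b z : R :=
  if b is b'.+1 then
    ratio_cons (fun k => rel_cprob mu_ (p @^-1` [set k]) (itin p b' \o Th)) p
      (itin p (b' + M)) (lower1 p M b') z
  else 1.

Fixpoint lower2 M a b z : R :=
  if a is a'.+1 then
    ratio_cons (fun k => rel_cprob mu_ (xi @^-1` [set k]) (itin2 a' b \o Th)) xi
      (itin xi (a' + b + M)) (lower2 M a' b) z
  else lower1 eta M b z.

Lemma likelihood_lower1 p K M b : mlabel p -> (forall z, (p z < K)%N) ->
  likelihood_ratio (itin p (b + M)) (lower1 p M b).
Proof.
move=> mp pK; elim: b => [|b IH]; first exact: likelihood_ratio1.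
apply: likelihood_ratio_cons pK _ _ IH => //; first exact: mlabel_itin.
apply: subprobability_cprob => //; first by apply: mlabel_skew; exact: mlabel_itin.
by move=> x y; exact: itin_addr.
Qed.

Lemma likelihood_lower2 M a b : likelihood_ratio (itin xi (a + b + M)) (lower2 M a b).
Proof.
elim: a => [|a IH].
  apply: likelihood_ratio_finer (likelihood_lower1 M b meta etaK) => x y.
  exact: itin_finer.
apply: likelihood_ratio_cons xiK _ _ IH => //; first exact: mlabel_itin.
apply: subprobability_cprob => //; first by apply: mlabel_skew; exact: mlabel_itin2.
by move=> x y; exact: itin2_finer.
Qed.

Let label_cprob_cvg_shift p K n : mlabel p -> (forall z, (p z < K)%N) ->
  {ae mu, forall z,
    label_cprob mu_ p (itin p (n + M) \o Th) z @[M --> \oo] --> future_cprob p z}.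
Proof.
move=> mp pK; apply: filterS (label_cprob_cvg mp) => z cz.
have : (fun M => label_cprob mu_ p (itin p (M + n) \o Th) z) @ \oo --> future_cprob p z.
  by rewrite (cvg_shiftn n (fun M => label_cprob mu_ p (itin p M \o Th) z)).
by under eq_fun do rewrite addnC.
Qed.

Lemma lower1_cvg p K b : mlabel p -> (forall z, (p z < K)%N) ->
  {ae mu, forall z, lower1 p M b z @[M --> \oo] -->
    label_mass mu_ (itin p b) z * expR (birkhoff_sum Th (cinfo_lim p) b z)}.
Proof.
move=> mp pK; elim: b => [|b IH].
  apply: aeW => z; rewrite birkhoff_sum0 expR0 mulr1 /label_mass /mass.
  rewrite (_ : xsection _ _ = setT) ?prob_kernel; first exact: cvg_cst.
  by apply/seteqP; split=> // x _; apply/xsectionP.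
have := ratio_cons_cvg mp (mlabel_itin b mp) (future_cprob_gt0 mp)
  (label_cprob_cvg_shift b mp pK) IH.
by apply: filterS => z; rewrite birkhoff_sumS.
Qed.

Lemma lower2_cvg a b : {ae mu, forall z, lower2 M a b z @[M --> \oo] -->
    label_mass mu_ (itin2 a b) z * expR (birkhoff_sum Th (cinfo_lim xi) a z +
      birkhoff_sum Th (cinfo_lim eta) b (iter a Th z))}.
Proof.
elim: a => [|a IH].
  by apply: filterS (lower1_cvg b meta etaK) => z; rewrite birkhoff_sum0 add0r.
have := ratio_cons_cvg mxi (mlabel_itin2 a b) (future_cprob_gt0 mxi)
  (label_cprob_cvg_shift (a + b) mxi xiK) IH.
by apply: filterS => z; rewrite birkhoff_sumS iterSr addrA.
Qed.

(** As M tends to infinity, the conditional probabilities in the denominator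
    of lower2 converge to those given the whole future; Fatou's lemma keeps
    the mean at most 1. *)
Lemma info_lower_bound (a b : nat -> nat) : {ae mu, forall z, \forall N \near \oo,
  birkhoff_sum Th (cinfo_lim xi) (a N) z
    + birkhoff_sum Th (cinfo_lim eta) (b N) (iter (a N) Th z)
    - ln (N.+1%:R * N.+2%:R) <= - ln (label_mass mu_ (itin2 (a N) (b N)) z)}.
Proof.
pose V N z := label_mass mu_ (itin2 (a N) (b N)) z *
  expR (birkhoff_sum Th (cinfo_lim xi) (a N) z +
        birkhoff_sum Th (cinfo_lim eta) (b N) (iter (a N) Th z)).
have mV N : measurable_fun setT (V N).
  apply: measurable_funM; first by apply: measurable_label_mass; exact: mlabel_itin2.
  apply: (measurableT_comp (@measurable_expR R)); apply: measurable_funD.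
    by apply: measurable_birkhoff_sum => //; exact: measurable_cinfo_lim.
  apply: measurableT_comp (measurable_iter mTh (a N)).
  by apply: measurable_birkhoff_sum => //; exact: measurable_cinfo_lim.
have V0 N z : 0 <= V N z by rewrite mulr_ge0 ?mass_ge0 ?expR_ge0.
have V1 N : (\int[mu]_z (V N z)%:E <= 1)%E.
  have good M := likelihood_lower2 M (a N) (b N).
  apply: (fatou_ae_le1 (W := fun M => lower2 M (a N) (b N))) => //.
  - by move=> M; have [] := good M.
  - by move=> M; have [] := good M.
  - exact: lower2_cvg.
  - by move=> M; have [] := good M.
have aeJ : {ae mu, forall z, forall N, 0 < label_mass mu_ (itin2 (a N) (b N)) z}.
  by apply/ae_foralln => N; apply: label_mass_gt0; exact: mlabel_itin2.
apply: filterS2 (eventually_le_square mV V0 V1) aeJ => z evz Jz.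
apply: filterS evz => N le_T.
have T0 : (0 : R) < N.+1%:R * N.+2%:R by rewrite mulr_gt0.
move: le_T; rewrite -ler_ln ?posrE ?mulr_gt0 ?expR_gt0// /V lnM ?posrE ?expR_gt0//.
by rewrite expRK; lra.
Qed.

Local Notation blim := (birkhoff_lim Th).

(** Lower and upper bounds for the limit are Birkhoff limits with linear time
    changes. The integrals of the upper ones converge to that of the lower one
    as the order m grows, and a nonnegative function whose integral is arbitrarily
    small vanishes. *)
Lemma info_cvg (A1 A2 : nat -> nat) (a1 a2 : R) : 0 < a1 -> 0 <= a2 ->
  (forall N, (A1 N <= A2 N)%N) ->
  (fun N => (A1 N)%:R / N%:R) @ \oo --> a1 ->
  (fun N => (A2 N)%:R / N%:R) @ \oo --> a1 + a2 ->
  {ae mu, forall z,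
    (fun N => - ln (label_mass mu_ (itin2 (A1 N) (A2 N - A1 N)) z) / N%:R) @ \oo -->
    a1 * blim (cinfo_lim xi) z + a2 * blim (cinfo_lim eta) z}.
Proof.
move=> a10 a20 A12 cA1 cA2.
have a120 : 0 < a1 + a2 by lra.
have [ixi ixin cxi] := cinfo_integral_cvg mxi xiK.
have [ieta ietan ceta] := cinfo_integral_cvg meta etaK.
have avg phi : mu.-integrable setT (EFin \o phi) -> (forall z, 0 <= phi z) ->
    {ae mu, forall z, birkhoff_avg Th phi ^~ z @ \oo --> blim phi z}.
  by move=> iphi phi0; exact: (birkhoff_lim_cvg mTh mu_inv).
pose L z := a1 * blim (cinfo_lim xi) z + a2 * blim (cinfo_lim eta) z.
pose U m z := a1 * blim (cinfo xi m) z + a2 * blim (cinfo eta m) z.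
have sums phi psi z : birkhoff_avg Th phi ^~ z @ \oo --> blim phi z ->
    birkhoff_avg Th psi ^~ z @ \oo --> blim psi z ->
    (fun N => (birkhoff_sum Th phi (A1 N) z +
       birkhoff_sum Th psi (A2 N - A1 N)%N (iter (A1 N) Th z)) / N%:R) @ \oo -->
    a1 * blim phi z + a2 * blim psi z.
  move=> cphi cpsi.
  have -> : (fun N => (birkhoff_sum Th phi (A1 N) z +
       birkhoff_sum Th psi (A2 N - A1 N)%N (iter (A1 N) Th z)) / N%:R) =
    (fun N => birkhoff_sum Th phi (A1 N) z / N%:R +
      (birkhoff_sum Th psi (A2 N) z / N%:R - birkhoff_sum Th psi (A1 N) z / N%:R)).
    apply/funext => N; rewrite birkhoff_sum_split subnKC//.
    by rewrite -mulrBl -mulrDl.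
  rewrite (_ : a2 * blim psi z = (a1 + a2) * blim psi z - a1 * blim psi z); last by ring.
  by apply: cvgD; [|apply: cvgB]; exact: birkhoff_sum_linear.
have invN0 : (fun N : nat => (N%:R^-1 : R)) @ \oo --> (0 : R).
  by rewrite -(cvg_shiftS (fun N : nat => (N%:R^-1 : R))); exact: cvg_harmonic.
have lowerN : {ae mu, forall z, exists2 l : nat -> R, l @ \oo --> L z &
    \forall N \near \oo, l N <=
      - ln (label_mass mu_ (itin2 (A1 N) (A2 N - A1 N)) z) / N%:R}.
  have := info_lower_bound A1 (fun N => A2 N - A1 N)%N.
  apply: filterS3 (avg _ ixi (cinfo_lim_ge0 mxi)) (avg _ ieta (cinfo_lim_ge0 meta)) =>
    z cz1 cz2 lb.
  exists (fun N => (birkhoff_sum Th (cinfo_lim xi) (A1 N) z +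
    birkhoff_sum Th (cinfo_lim eta) (A2 N - A1 N)%N (iter (A1 N) Th z)) / N%:R -
    ln (N.+1%:R * N.+2%:R) / N%:R).
    rewrite -[X in _ --> X]subr0; apply: cvgB; first exact: sums.
    exact: cvg_ln_sq_over_n.
  by apply: filterS lb => N lb; rewrite -mulrBl ler_wpM2r// invr_ge0.
have upperN m : {ae mu, forall z, exists2 u : nat -> R, u @ \oo --> U m z &
    \forall N \near \oo,
      - ln (label_mass mu_ (itin2 (A1 N) (A2 N - A1 N)) z) / N%:R <= u N}.
  have := info_upper_bound m A1 (fun N => A2 N - A1 N)%N.
  apply: filterS3 (avg _ (ixin m) (cinfo_ge0 mxi m)) (avg _ (ietan m) (cinfo_ge0 meta m)) =>
    z cz1 cz2 ub.
  exists (fun N => (birkhoff_sum Th (cinfo xi m) (A1 N) z +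
    birkhoff_sum Th (cinfo eta m) (A2 N - A1 N)%N (iter (A1 N) Th z)) / N%:R +
    (m%:R * (ln K1%:R + ln K2%:R) * N%:R^-1 + ln (N.+1%:R * N.+2%:R) / N%:R)).
    rewrite -[X in _ --> X]addr0; apply: cvgD; first exact: sums.
    rewrite -[X in _ --> X]addr0; apply: cvgD; last exact: cvg_ln_sq_over_n.
    by rewrite -[X in _ --> X](mulr0 (m%:R * (ln K1%:R + ln K2%:R))); apply: cvgMl_tmp.
  apply: filterS ub => N ub; rewrite -!mulrDl addrA.
  by rewrite ler_wpM2r// invr_ge0.
have LU : {ae mu, forall z, forall m, L z <= U m z}.
  apply/ae_foralln => m; apply: filterS2 lowerN (upperN m) => z [l cl ll] [u cu uu].
  rewrite -(cvg_lim _ cl)// -(cvg_lim _ cu)//; apply: ler_lim.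
  - exact: cvgP cl.
  - exact: cvgP cu.
  - by apply: filterS2 ll uu => N; exact: le_trans.
have iblim phi : mu.-integrable setT (EFin \o phi) -> (forall z, 0 <= phi z) ->
    mu.-integrable setT (EFin \o blim phi).
  by move=> iphi phi0; exact: (birkhoff_lim_integrable mTh mu_inv).
have blimE phi : mu.-integrable setT (EFin \o phi) -> (forall z, 0 <= phi z) ->
    \int[mu]_z blim phi z = \int[mu]_z phi z.
  by move=> iphi phi0; rewrite /Rintegral (integral_birkhoff_limT mTh mu_inv).
have lin phi psi : mu.-integrable setT (EFin \o phi) -> mu.-integrable setT (EFin \o psi) ->
    mu.-integrable setT (EFin \o (fun z => a1 * phi z + a2 * psi z)) /\
    \int[mu]_z (a1 * phi z + a2 * psi z) = a1 * \int[mu]_z phi z + a2 * \int[mu]_z psi z.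
  move=> i1 i2.
  have j1 : mu.-integrable setT (EFin \o (fun z => a1 * phi z)) by exact: (integrableZl _ _ i1).
  have j2 : mu.-integrable setT (EFin \o (fun z => a2 * psi z)) by exact: (integrableZl _ _ i2).
  split; first exact: (integrableD _ j1 j2).
  by rewrite RintegralD// !RintegralZl.
have [iL EL] := lin _ _ (iblim _ ixi (cinfo_lim_ge0 mxi)) (iblim _ ieta (cinfo_lim_ge0 meta)).
have iUE m := lin _ _ (iblim _ (ixin m) (cinfo_ge0 mxi m)) (iblim _ (ietan m) (cinfo_ge0 meta m)).
have cvgUL : (fun m => \int[mu]_z U m z - \int[mu]_z L z) @ \oo --> (0 : R).
  rewrite -[X in _ --> X](subrr (\int[mu]_z L z)); apply: cvgB; last exact: cvg_cst.
  have -> : (fun m => \int[mu]_z U m z) =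
      (fun m => a1 * \int[mu]_z cinfo xi m z + a2 * \int[mu]_z cinfo eta m z).
    apply/funext => m; rewrite (iUE m).2.
    by rewrite !blimE// => z; exact: cinfo_ge0.
  have -> : \int[mu]_z L z =
      a1 * \int[mu]_z cinfo_lim xi z + a2 * \int[mu]_z cinfo_lim eta z.
    by rewrite -(blimE _ ixi (cinfo_lim_ge0 mxi)) -(blimE _ ieta (cinfo_lim_ge0 meta)); exact: EL.
  by apply: cvgD; apply: cvgMl_tmp; [exact: cxi|exact: ceta].
have close : {ae mu, forall z, forall k, exists m, U m z <= L z + k.+1%:R^-1}.
  apply/ae_foralln => k.
  pose B := [set z | forall m, L z + k.+1%:R^-1 < U m z].
  have mL : measurable_fun setT L by exact: integrable_EFin_measurable iL.
  have mU m : measurable_fun setT (U m) by exact: integrable_EFin_measurable (iUE m).1.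
  have mB : measurable B.
    rewrite (_ : B = \bigcap_m [set z | L z + k.+1%:R^-1 < U m z]).
      apply: bigcap_measurable => // m _; apply: measurable_set_lt => //.
      exact: measurable_funD.
    by apply/seteqP; split=> z h m; [move=> _; exact: h|exact: (h m I)].
  exists B; split=> //; last first.
    move=> z /= /forallNP h m; rewrite ltNge; apply/negP; exact: h.
  have i1B : mu.-integrable setT (EFin \o (fun z => k.+1%:R^-1 * \1_B z)).
    apply: bm_integrable; apply: bmM; first exact: bm_cst.
    exact: bm_indic.
  have EB : \int[mu]_z (k.+1%:R^-1 * \1_B z) = k.+1%:R^-1 * fine (mu B).
    rewrite RintegralZl//; last exact/bm_integrable/bm_indic.
    by rewrite /Rintegral integral_indic// setIT.
  have le_m m : k.+1%:R^-1 * fine (mu B) <= \int[mu]_z U m z - \int[mu]_z L z.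
    rewrite -EB -RintegralB//; last exact: (iUE m).1.
    have iUL : mu.-integrable setT (EFin \o (fun z => U m z - L z)).
      exact: (integrableB measurableT (iUE m).1 iL).
    rewrite -lee_fin /Rintegral !fineK; [|exact: integrable_fin_num iUL|
      exact: integrable_fin_num i1B].
    pose D z := Num.max (U m z - L z) 0.
    have -> : (\int[mu]_z (U m z - L z)%:E = \int[mu]_z (D z)%:E)%E.
      apply: ae_eq_integral => //.
      - exact: measurable_int iUL.
      - apply/measurable_EFinP/measurable_maxr => //; exact: measurable_funB.
      - apply: filterS LU => z /(_ m) LUz _; rewrite /D; congr (_%:E).
        by apply/esym/max_idPl; rewrite subr_ge0.
    apply: ge0_le_integral => //.
    - exact: measurable_int i1B.
    - apply/measurable_EFinP/measurable_maxr => //; exact: measurable_funB.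
    - move=> z _; rewrite lee_fin /D indicE.
      have [zB|zB] := boolP (z \in B); last by rewrite mulr0 le_max lexx orbT.
      by rewrite mulr1 le_max lerBrDl; move: zB; rewrite inE => /(_ m)/ltW ->.
  have fB : mu B \is a fin_num by exact: fin_num_measure.
  suff b0 : fine (mu B) = 0 by transitivity ((fine (mu B))%:E); [exact/esym/fineK|rewrite b0].
  apply/eqP; rewrite eq_le fine_ge0// andbT.
  rewrite -(pmulr_rle0 _ (_ : 0 < k.+1%:R^-1 :> R)) ?invr_gt0//.
  rewrite -(cvg_lim _ cvgUL)//; apply: limr_ge; first exact: cvgP cvgUL.
  exact: nearW.
have upperNm : {ae mu, forall z, forall m, exists2 u : nat -> R, u @ \oo --> U m z &
    \forall N \near \oo,
      - ln (label_mass mu_ (itin2 (A1 N) (A2 N - A1 N)) z) / N%:R <= u N}.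
  by apply/ae_foralln.
by apply: filterS3 lowerN upperNm close => z; exact: cvg_between_bounds.
Qed.

End two_processes.

End skew_product_of_a_disintegrated_measure.

(** * Atoms of partitions and their labels *)

Section atoms.
Context {T U : Type}.
Implicit Types (xi eta : set (set T)) (x : T).

Lemma atom_pjoin xi eta x : atom (pjoin xi eta) x = atom xi x `&` atom eta x.
Proof.
apply/seteqP; split=> y.
  move=> [_ [[A xiA [B etaB <-]] [Ax Bx]] [Ay By]].
  by split; [exists A|exists B].
move=> [[A [xiA Ax] Ay] [B [etaB Bx] By]].
by exists (A `&` B) => //; split=> //; exists A => //; exists B.
Qed.

Lemma atom_setT x : atom [set setT] x = setT.
Proof. by apply/seteqP; split=> // y _; exists setT. Qed.

Lemma atom_big_pjoin n (F : nat -> set (set T)) x :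
  atom (\pjoin_(i < n) F i) x = [set y | forall i, (i < n)%N -> atom (F i) x y].
Proof.
elim: n F => [|n IH] F; first by rewrite big_ord0 atom_setT; apply/seteqP; split.
rewrite big_ord_recl atom_pjoin (IH (F \o S)); apply/seteqP; split=> y.
  by move=> [y0 yS] [|i] // /yS.
by move=> h; split=> [|i ni]; exact: h.
Qed.

Lemma atom_pullback (S : U -> T) xi u : atom (pullback S xi) u = S @^-1` atom xi (S u).
Proof.
apply/seteqP; split=> v.
  by move=> [_ [[A xiA <-] Au] Av]; exists A.
by move=> [A [xiA Au] Av]; exists (S @^-1` A) => //; split=> //; exists A.
Qed.

Lemma atom_fiber (alpha : set (set (U * T))) u x :
  atom (fiber alpha u) x = xsection (atom alpha (u, x)) u.
Proof.
apply/seteqP; split=> y; rewrite /xsection/= inE.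
  by move=> [_ [[A aA <-]]]; rewrite /xsection/= !inE => Ax Ay; exists A.
move=> [A [aA Ax] Ay]; exists (xsection A u); last by rewrite /xsection/= inE.
by split; [exists A|rewrite /xsection/= inE].
Qed.

Lemma fiber_pjoin (alpha beta : set (set (U * T))) u :
  fiber (pjoin alpha beta) u = pjoin (fiber alpha u) (fiber beta u).
Proof.
apply/seteqP; split=> C.
  move=> [_ [A aA [B bB <-]] <-]; exists (xsection A u); first by exists A.
  by exists (xsection B u); [exists B|rewrite xsectionI].
move=> [_ [A aA <-] [_ [B bB <-] <-]]; exists (A `&` B); last by rewrite xsectionI.
by exists A => //; exists B.
Qed.

Lemma atomE xi A x : trivIset xi id -> xi A -> A x -> atom xi x = A.
Proof.
move=> tr xiA Ax; apply/seteqP; split=> [y [B [xiB Bx] By]|y Ay]; last by exists A.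
by rewrite -(tr B A xiB xiA)//; exists x.
Qed.

Lemma atom_mem xi x : is_partition xi -> xi (atom xi x) /\ atom xi x x.
Proof.
move=> [cov tr]; have : setT x by [].
by rewrite -cov => -[A xiA Ax]; rewrite (atomE tr xiA Ax).
Qed.

Lemma is_partition_pjoin xi eta : is_partition xi -> is_partition eta ->
  is_partition (pjoin xi eta).
Proof.
move=> pxi peta; split.
  apply/seteqP; split=> // x _.
  have [xi1 xi2] := atom_mem x pxi; have [eta1 eta2] := atom_mem x peta.
  by exists (atom xi x `&` atom eta x) => //; exists (atom xi x) => //; exists (atom eta x).
move=> _ _ [A xiA [B etaB <-]] [A' xiA' [B' etaB' <-]] [x [[/= Ax Bx] [A'x B'x]]].
by rewrite -(atomE pxi.2 xiA Ax) -(atomE pxi.2 xiA' A'x) -(atomE peta.2 etaB Bx)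
  -(atomE peta.2 etaB' B'x).
Qed.

Lemma is_partition_pullback (S : U -> T) xi : is_partition xi -> is_partition (pullback S xi).
Proof.
move=> pxi; split.
  apply/seteqP; split=> // u _; have [xi1 xi2] := atom_mem (S u) pxi.
  by exists (S @^-1` atom xi (S u)) => //; exists (atom xi (S u)).
move=> _ _ [A xiA <-] [B xiB <-] [u [/= Au Bu]].
by rewrite -(atomE pxi.2 xiA Au) -(atomE pxi.2 xiB Bu).
Qed.

(** Only the atom of x contributes. *)
Lemma sum_atom (R : realType) xi x (g : set T -> \bar R) : finite_set xi -> is_partition xi ->
  (\sum_(A \in xi) (\1_A x)%:E * g A = g (atom xi x))%E.
Proof.
move=> fxi pxi; have [xi1 xi2] := atom_mem x pxi.
rewrite (fsbigD1 (atom xi x))//= indicE mem_set// mul1e fsbig1 ?adde0//.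
move=> A [xiA neA]; rewrite indicE memNset ?mul0e// => Ax; apply: neA.
by rewrite /= (atomE pxi.2 xiA Ax).
Qed.

End atoms.

Lemma is_partition_fiber (U T : Type) (alpha : set (set (U * T))) u :
  is_partition alpha -> is_partition (fiber alpha u).
Proof.
move=> pa; split.
  apply/seteqP; split=> // x _; have [a1 a2] := atom_mem (u, x) pa.
  exists (xsection (atom alpha (u, x)) u); first by exists (atom alpha (u, x)).
  by rewrite /xsection/= inE.
move=> _ _ [A aA <-] [B aB <-] [x []]; rewrite /= /xsection/= !inE => Ax Bx.
by rewrite -(atomE pa.2 aA Ax) -(atomE pa.2 aB Bx).
Qed.

Section finite_measurable_partitions.
Context d (T : measurableType d).
Implicit Types xi eta : set (set T).

Lemma finite_measurable_partition_setT :
  finite_measurable_partition [set (setT : set T)].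
Proof.
split; [exact: finite_set1|by move=> _ ->|split].
  by rewrite /cover bigcup_set1.
by move=> A B /= -> ->.
Qed.

Lemma finite_measurable_partition_pjoin xi eta : finite_measurable_partition xi ->
  finite_measurable_partition eta -> finite_measurable_partition (pjoin xi eta).
Proof.
move=> [fxi mxi pxi] [feta meta peta]; split; [exact: finite_image2| |].
  by move=> _ [A /mxi mA [B /meta mB <-]]; exact: measurableI.
exact: is_partition_pjoin.
Qed.

Lemma finite_measurable_partition_big_pjoin n (F : nat -> set (set T)) :
  (forall i, finite_measurable_partition (F i)) ->
  finite_measurable_partition (\pjoin_(i < n) F i).
Proof.
elim: n F => [|n IH] F hF; first by rewrite big_ord0; exact: finite_measurable_partition_setT.
rewrite big_ord_recl; apply: finite_measurable_partition_pjoin => //.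
by apply: (IH (F \o S)) => i; exact: hF.
Qed.

Lemma finite_measurable_partition_pullback d' (U : measurableType d') (S : U -> T) xi :
  measurable_fun setT S -> finite_measurable_partition xi ->
  finite_measurable_partition (pullback S xi).
Proof.
move=> mS [fxi mxi pxi]; split; [exact: finite_image| |exact: is_partition_pullback].
by move=> _ [A /mxi mA <-]; rewrite -[X in measurable X]setTI; exact: mS.
Qed.

Lemma finite_measurable_partition_fiber d' (U : measurableType d')
    (alpha : set (set (U * T))) u :
  finite_measurable_partition alpha -> finite_measurable_partition (fiber alpha u).
Proof.
move=> [fa ma pa]; split; [exact: finite_image| |exact: is_partition_fiber].
by move=> _ [A /ma mA <-]; exact: measurable_xsection.
Qed.

Definition labels (p : T -> nat) xi := forall x, atom xi x = same_label p x.

(** The label of a point is the rank of its atom in an enumeration of the partition. *)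
Lemma finite_measurable_partition_label xi : finite_measurable_partition xi ->
  exists p : T -> nat, [/\ mlabel p, exists K, forall x, (p x < K)%N & labels p xi].
Proof.
move=> [/finite_seqP[s xis] mxi pxi].
pose has_pt (x : T) := fun A : set T => x \in A.
pose p x := find (has_pt x) s.
have hass x : has (has_pt x) s.
  have [xi1 xi2] := atom_mem x pxi; apply/hasP; exists (atom xi x); rewrite /has_pt ?inE//.
  by rewrite xis /= -xis in xi1.
have xi_nth x : xi (nth set0 s (p x)) by rewrite xis/=; apply: mem_nth; rewrite -has_find.
have nth_x x : nth set0 s (p x) x by have := nth_find set0 (hass x); rewrite /has_pt inE.
have atom_nth x : atom xi x = nth set0 s (p x) by exact: atomE pxi.2 (xi_nth x) (nth_x x).
have p_le x y : nth set0 s (p x) y -> (p y <= p x)%N.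
  move=> h; rewrite leqNgt; apply/negP => /(before_find set0); rewrite /has_pt.
  by rewrite mem_set.
have lab : labels p xi.
  move=> x; apply/seteqP; split=> y; rewrite /same_label/=; last first.
    by move=> yx; rewrite atom_nth -yx; exact: nth_x.
  rewrite atom_nth => h; apply/eqP; rewrite eqn_leq p_le//=; apply: p_le.
  have -> : nth set0 s (p y) = nth set0 s (p x); last exact: nth_x.
  by rewrite -atom_nth; exact: atomE pxi.2 (xi_nth x) h.
exists p; split=> //; last by exists (size s) => x; rewrite /p -has_find.
apply: mlabelP => k; have [[x pxk]|none] := pselect (exists x, p x = k).
  rewrite (_ : _ @^-1` _ = atom xi x); first by apply: mxi; exact: (atom_mem x pxi).1.
  by rewrite lab; apply/seteqP; split=> y; rewrite /same_label/= pxk.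
rewrite (_ : _ @^-1` _ = set0)//; apply/seteqP; split=> // x /= pxk.
by apply: none; exists x.
Qed.

(** Real logarithms can replace extended ones, as null atoms contribute 0 on
    both sides. *)
Lemma entropyE (R : realType) (nu : probability T R) xi : finite_measurable_partition xi ->
  (entropy nu xi = \int[nu]_x (- ln (fine (nu (atom xi x))))%:E)%E.
Proof.
move=> [fxi mxi pxi].
have nu_fin A : xi A -> nu A = (fine (nu A))%:E.
  by move=> /mxi mA; rewrite fineK//; exact: fin_num_measure.
have ln_fine0 A : xi A -> 0 <= - ln (fine (nu A)).
  move=> xiA; rewrite oppr_ge0 ln_le0// -lee_fin -nu_fin//.
  by apply: probability_le1; exact: mxi.
transitivity (\int[nu]_x (\sum_(A \in xi) (\1_A x)%:E * (- ln (fine (nu A)))%:E))%E; last first.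
  apply: eq_integral => x _.
  by rewrite (sum_atom x (fun A => (- ln (fine (nu A)))%:E)).
pose g A x := if A \in xi then ((\1_A x)%:E * (- ln (fine (nu A)))%:E)%E else 0%E : \bar R.
transitivity (\int[nu]_x (\sum_(A \in xi) g A x))%E; last first.
  by apply: eq_integral => x _; apply: eq_fsbigr => A Axi; rewrite /g Axi.
rewrite ge0_integral_fsum//; last 2 first.
- move=> A; rewrite /g; have [Axi|_] := boolP (A \in xi); last exact: measurable_cst.
  apply: emeasurable_funM => //; apply/measurable_EFinP/measurable_indic.
  by apply: mxi; rewrite inE in Axi.
- move=> A x _; rewrite /g; have [Axi|//] := boolP (A \in xi).
  by rewrite -EFinM lee_fin mulr_ge0// ln_fine0//; rewrite inE in Axi.
have termE A : xi A -> (\int[nu]_x g A x = (- (fine (nu A) * ln (fine (nu A))))%:E)%E.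
  move=> xiA; have Axi : A \in xi by rewrite inE.
  under eq_integral do rewrite /g Axi muleC.
  rewrite ge0_integralZl ?lee_fin ?ln_fine0//; last first.
    by apply/measurable_EFinP/measurable_indic; exact: mxi.
  rewrite integral_indic// ?setIT; last exact: mxi.
  by rewrite [X in (_ * X)%E]nu_fin// -EFinM mulNr mulrC.
have entE A : xi A -> (nu A * lne (nu A) = (fine (nu A) * ln (fine (nu A)))%:E)%E.
  move=> xiA; rewrite nu_fin//=; have [->|n0] := eqVneq (fine (nu A)) 0.
    by rewrite mul0e mul0r.
  by rewrite ifN ?EFinM// -ltNge lt_neqAle eq_sym n0 fine_ge0.
rewrite /entropy (eq_fsbigr (fun A => (fine (nu A) * ln (fine (nu A)))%:E)); last first.
  by move=> A; rewrite inE => /entE.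
rewrite [in RHS](eq_fsbigr (fun A => (- (fine (nu A) * ln (fine (nu A))))%:E)); last first.
  by move=> A; rewrite inE => /termE.
by rewrite !fsbig_finite// !sumEFin -EFinN sumrN.
Qed.

End finite_measurable_partitions.

(** * Information and entropy of a random system *)

Section information_of_a_random_system.
Context d d' (Om : measurableType d) (X : measurableType d') (R : realType).
Variables (P : probability Om R) (mu_ : R.-pker Om ~> X).
Variable mu : probability (Om * X)%type R.
Hypothesis mu_dis : disintegration P mu_ mu.
Variables (theta : Om -> Om) (f : Om -> X -> X).
Hypothesis theta_meas : measurable_fun setT theta.
Hypothesis theta_pres : invariant_measure P theta.
Hypothesis theta_inv : invertible theta.
Hypothesis f_meas : measurable_fun setT (fun z : Om * X => f z.1 z.2).
Local Notation Th := (skew_product theta f).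
Hypothesis mu_inv : invariant_measure mu Th.
Local Notation Z := (Om * X)%type.

Let mTh : measurable_fun setT (Th : Z -> Z) := measurable_skew_product theta_meas f_meas.

Lemma iter_skew n w x : iter n Th (w, x) = (iter n theta w, rds_iter theta f n w x).
Proof. by elim: n => [//|n IH]; rewrite iterS IH. Qed.

Lemma itinP (p : Z -> nat) n x y : itin theta f p n x = itin theta f p n y <->
  forall i, (i < n)%N -> p (iter i Th x) = p (iter i Th y).
Proof.
elim: n x y => [|n IH] x y /=; first by split.
split=> [[pxy /IH h] [//|i] ni|h]; first by rewrite !iterSr; exact: h.
by congr cons; [exact: (h 0%N)|apply/IH => i ni; rewrite -!iterSr; exact: h].
Qed.

Lemma itin2P (xi eta : Z -> nat) a b x y :
  itin2 theta f xi eta a b x = itin2 theta f xi eta a b y <->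
  (forall i, (i < a)%N -> xi (iter i Th x) = xi (iter i Th y)) /\
  (forall i, (i < b)%N -> eta (iter (a + i) Th x) = eta (iter (a + i) Th y)).
Proof.
elim: a x y => [|a IH] x y /=; first by rewrite itinP; split=> [|[]].
split=> [[pxy /IH[h1 h2]]|[h1 h2]].
  by split=> [[//|i] ni|i ni]; rewrite -?iterS !iterSr; [exact: h1|exact: h2].
congr cons; first exact: (h1 0%N).
apply/IH; split=> i ni; rewrite -!iterSr; first exact: h1.
by rewrite -addSn; exact: h2.
Qed.

Lemma atom_rds_pullback (alpha : set (set Z)) n w x :
  atom (rds_pullback theta f (fiber alpha) n w) x =
  xsection (iter n Th @^-1` atom alpha (iter n Th (w, x))) w.
Proof.
rewrite /rds_pullback atom_pullback atom_fiber -iter_skew.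
by apply/seteqP; split=> y; rewrite /= /xsection/= !inE/= !iter_skew.
Qed.

(** As alpha1 \/ alpha2 is observed up to time A1 and alpha2 alone from then on,
    the itinerary with the two alphabets names the atoms of the joined partition. *)
Lemma atom_two_rds_joins (xi eta : Z -> nat) (alpha1 alpha2 : set (set Z)) A1 A2 w x :
  labels xi (pjoin alpha1 alpha2) -> labels eta alpha2 -> (A1 <= A2)%N ->
  atom (pjoin (\pjoin_(n < A1) rds_pullback theta f (fiber alpha1) n w)
              (\pjoin_(n < A2) rds_pullback theta f (fiber alpha2) n w)) x =
  xsection (same_label (itin2 theta f xi eta A1 (A2 - A1)) (w, x)) w.
Proof.
move=> labxi labeta A12.
rewrite atom_pjoin (atom_big_pjoin A1 (fun n => rds_pullback theta f (fiber alpha1) n w)).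
rewrite (atom_big_pjoin A2 (fun n => rds_pullback theta f (fiber alpha2) n w)).
have xiE u v : xi v = xi u <-> atom alpha1 u v /\ atom alpha2 u v.
  have -> : (xi v = xi u) = same_label xi u v by [].
  by rewrite -labxi atom_pjoin.
have etaE u v : eta v = eta u <-> atom alpha2 u v.
  have -> : (eta v = eta u) = same_label eta u v by [].
  by rewrite -labeta.
have pull alpha n y : atom (rds_pullback theta f (fiber alpha) n w) x y <->
    atom alpha (iter n Th (w, x)) (iter n Th (w, y)).
  by rewrite atom_rds_pullback /xsection/= inE.
apply/seteqP; split=> y; rewrite /xsection/= inE/= /same_label/= itin2P.
  move=> [h1 h2]; split=> i ni.
    by apply/xiE; split; apply/pull; [exact: h1|apply: h2; exact: leq_trans A12].
  by apply/etaE/pull; apply: h2; rewrite -ltn_subRL.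
move=> [h1 h2]; split=> i ni; apply/pull; first by have /xiE[] := h1 i ni.
have [iA1|A1i] := ltnP i A1; first by have /xiE[] := h1 i iA1.
apply/etaE; have := h2 (i - A1)%N; rewrite subnKC//; apply.
by rewrite ltn_sub2r// (leq_ltn_trans A1i).
Qed.

Lemma info_label (L : Type) (r : Z -> L) (xi : set (set X)) w x :
  atom xi x = xsection (same_label r (w, x)) w -> measurable (same_label r (w, x)) ->
  0 < label_mass mu_ r (w, x) ->
  info (mu_ w) xi x = (- ln (label_mass mu_ r (w, x)))%:E.
Proof.
move=> atomE mr m0; rewrite /info atomE.
rewrite -[mu_ w _]fineK; last by apply: kernel_fin_num; exact: measurable_xsection.
by rewrite [fine _]/(label_mass mu_ r (w, x)) lne_EFin.
Qed.

Section one_partition.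
Variables (alpha : set (set Z)) (p : Z -> nat) (K : nat).
Hypotheses (part : finite_measurable_partition alpha).
Hypotheses (mp : mlabel p) (pK : forall z, (p z < K)%N) (lab : labels p alpha).

Let ppart : is_partition alpha. Proof. by case: part. Qed.

Lemma fiber_atom_label w x :
  atom (fiber alpha w) x = xsection (p @^-1` [set p (w, x)]) w.
Proof. by rewrite atom_fiber lab. Qed.

Let GG w := \bigcup_(n in [set n | (0 < n)%N]) rds_pullback theta f (fiber alpha) n w.

Let future n w x := itin theta f p n (Th (w, x)).

(** A generator of the future of alpha is known from finitely many future
    labels. *)
Lemma future_generator_label w B : GG w B -> exists n S, B = future n w @^-1` S.
Proof.
move=> [n /= n0 [_ [A aA <-] <-]]; exists n, (future n w @` (rds_iter theta f n w @^-1`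
  xsection A (iter n theta w))).
apply/seteqP; split=> y; first by exists y.
move=> [x Ax] /itinP/(_ n.-1); rewrite prednK// => /(_ (leqnn _)).
rewrite -!iterSr prednK// !iter_skew => pxy.
move: Ax; rewrite /xsection/= !inE => Ax.
rewrite -(atomE ppart.2 aA Ax) lab /same_label/=; exact/esym.
Qed.

Lemma future_label_generated n w S : <<s GG w >> (future n w @^-1` S).
Proof.
suff : forall m, mlabel (fun y : g_sigma_algebraType (GG w) =>
    itin theta f p n (iter m.+1 Th (w, y))) by move=> /(_ 0%N); apply.
have mp1 m : mlabel (fun y : g_sigma_algebraType (GG w) => p (iter m.+1 Th (w, y))).
  apply: mlabelP => k; have [[x pxk]|none] := pselect (exists x, p (iter m.+1 Th (w, x)) = k).
    apply: sub_gen_smallest; exists m.+1 => //.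
    exists (xsection (atom alpha (iter m.+1 Th (w, x))) (iter m.+1 theta w)).
      by exists (atom alpha (iter m.+1 Th (w, x))) => //; exact: (atom_mem _ ppart).1.
    rewrite lab -pxk; apply/seteqP; split=> y; rewrite /xsection/= inE /same_label/=;
      by rewrite -!iterS !iter_skew.
  rewrite (_ : _ @^-1` _ = set0); first exact: measurable0.
  by apply/seteqP; split=> // x /= pxk; apply: none; exists x.
elim: n => [|n IH] m; first by move=> S'; rewrite preimage_cst; case: ifP.
exact: (mlabel_comp (fun kl => kl.1 :: kl.2) (mlabel_pair (mp1 m) (IH m.+1))).
Qed.

Lemma condprob_future w : {ae mu_ w, forall x, forall k,
  condprob (mu_ w) (xsection (p @^-1` [set k]) w) (rds_future theta f (fiber alpha) w) x =
  (cprob_lim (fiber_prob mu_ w) (fun n y => itin theta f p n (Th (w, y)))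
     (xsection (p @^-1` [set k]) w) x)%:E}.
Proof.
rewrite fiber_probE; apply/ae_foralln => k; apply: condprob_ae.
- by move=> n; exact: mlabel_future_fiber.
- by move=> n x y; exact: itin_refine.
- by apply: measurable_xsection; exact: mp.
- exact: future_generator_label.
- by move=> n S; exact: future_label_generated.
Qed.

(** In almost every fibre, cinfo_lim is a version of the conditional
    information; as it is jointly measurable, a joint version exists. Any
    other one agrees with it almost everywhere in almost every fibre, hence
    mu-almost everywhere. *)
Lemma rds_cond_info_cinfo_lim :
  measurable_fun setT (rds_cond_info P mu_ theta f (fiber alpha)) /\
  {ae mu, forall z, rds_cond_info P mu_ theta f (fiber alpha) z =
    (cinfo_lim mu_ theta f p z)%:E}.
Proof.
have mc : measurable_fun setT (fun z => (cinfo_lim mu_ theta f p z)%:E).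
  by apply/measurable_EFinP; exact: measurable_cinfo_lim.
have aec : {ae P, forall w, {ae mu_ w, forall x, (cinfo_lim mu_ theta f p (w, x))%:E =
    cond_info (mu_ w) (fiber alpha w) (rds_future theta f (fiber alpha) w) x}}.
  pose N := [set z | future_cprob mu_ theta f p z <= 0].
  have mN : measurable N.
    by apply: measurable_set_le => //; exact: measurable_future_cprob.
  have N0 : mu N = 0%E.
    have [N' [mN' N'0 sub]] := future_cprob_gt0 mu_dis theta_meas f_meas mp.
    apply: (@subset_measure0 _ _ _ mu _ N') => // z /= h; apply: sub => /=.
    by apply/negP; rewrite -leNgt.
  apply: filterS (null_fibers mu_dis mN N0) => w Nw0.
  have pos : {ae mu_ w, forall x, 0 < future_cprob mu_ theta f p (w, x)}.
    exists (xsection N w); split=> //; first exact: measurable_xsection.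
    by move=> x /= /negP; rewrite -leNgt /xsection/= inE.
  apply: filterS2 pos (condprob_future w) => x pos_x cp.
  have [ff _ fp] := finite_measurable_partition_fiber w part.
  rewrite /cond_info (sum_atom x (fun A => lne (condprob (mu_ w) A _ x)) ff fp).
  by rewrite fiber_atom_label cp -future_cprob_fiberE lne_EFin.
rewrite /rds_cond_info.
have [mF aeF] := xgetPex (cst 0%E) (ex_intro [set F | measurable_fun setT F /\
    {ae P, forall w, {ae mu_ w, forall x, F (w, x) =
      cond_info (mu_ w) (fiber alpha w) (rds_future theta f (fiber alpha) w) x}}]
  _ (conj mc aec)).
rewrite -/(joint_version P mu_ _) in mF aeF *.
split=> //; apply: (ae_of_fibers mu_dis).
  rewrite -[X in measurable X]setTI; exact: measurable_eqe.
by apply: filterS2 aeF aec => w; apply: filterS2 => x -> ->.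
Qed.

Lemma fiber_entropy_itin n :
  (fiber_entropy P mu_ (\pjoin_(i < n) pullback (iter i Th) alpha) =
   \int[mu]_z (itin_info mu_ theta f p n z)%:E)%E.
Proof.
have mI : measurable_fun setT (label_mass mu_ (itin theta f p n)).
  by apply: measurable_label_mass; exact: mlabel_itin.
rewrite (ge0_integral_disintegration mu_dis); last 2 first.
- apply/measurable_EFinP; apply: measurableT_comp => //.
  exact: (measurableT_comp (@measurable_ln R)).
- by move=> z; rewrite lee_fin oppr_ge0 ln_le0// label_mass_le1//; exact: mlabel_itin.
have partn : finite_measurable_partition (\pjoin_(i < n) pullback (iter i Th) alpha).
  apply: (finite_measurable_partition_big_pjoin n (F := fun i => pullback (iter i Th) alpha)) => i.
  by apply: finite_measurable_partition_pullback => //; exact: measurable_iter.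
apply: eq_integral => w _; rewrite fiber_probE entropyE; last first.
  exact: finite_measurable_partition_fiber.
apply: eq_integral => x _; congr (- ln (fine (mu_ w _)))%:E.
rewrite atom_fiber (atom_big_pjoin n (fun i => pullback (iter i Th) alpha)).
apply/seteqP; split=> y; rewrite /xsection/= !inE/= /same_label/= itinP => h i ni.
  by have := h i ni; rewrite atom_pullback lab.
by rewrite atom_pullback lab; exact: h.
Qed.

(** The entropies of the joined partitions are sums of integrals of cinfo,
    whose averages converge to the limit of the summands. *)
Lemma rds_entropy_cinfo_lim :
  (rds_entropy P mu_ theta f alpha = \int[mu]_z (cinfo_lim mu_ theta f p z)%:E)%E.
Proof.
have [ilim _ _] := cinfo_integral_cvg mu_dis theta_meas f_meas mp pK.
have rate := entropy_rate_cvg mu_dis theta_meas f_meas mp pK.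
rewrite -[RHS]fineK; last exact: integrable_fin_num ilim.
apply: cvg_lim => //.
have -> : (fun n => (n%:R^-1)%:E *
      fiber_entropy P mu_ (\pjoin_(i < n) pullback (iter i Th) alpha))%E =
    EFin \o (fun n => n%:R^-1 * \sum_(k < n) \int[mu]_z cinfo mu_ theta f p k z).
  apply/funext => n; rewrite fiber_entropy_itin.
  by rewrite (integral_itin_info mu_dis theta_meas theta_pres theta_inv f_meas mu_inv mp pK).
by apply: cvg_EFin; [exact: nearW|exact: rate].
Qed.

End one_partition.

(** The limit info_cvg for the labels of alpha1 \/ alpha2 and of alpha2, in
    terms of conditional expectations and of entropies. *)
Lemma joint_information_cvg (alpha1 alpha2 : set (set Z)) (a1 a2 : R) :
  finite_measurable_partition alpha1 -> finite_measurable_partition alpha2 ->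
  0 < a1 -> 0 <= a2 ->
  let I_N (N : nat) (w : Om) (x : X) : \bar R :=
    info (mu_ w)
      (pjoin
        (\pjoin_(n < `|Num.ceil (a1 * N%:R)|%N)
          rds_pullback theta f (fiber alpha1) n w)
        (\pjoin_(n < `|Num.ceil ((a1 + a2) * N%:R)|%N)
          rds_pullback theta f (fiber alpha2) n w)) x in
  let F1 : Z -> \bar R :=
    rds_cond_info P mu_ theta f
      (fun w => pjoin (fiber alpha1 w) (fiber alpha2 w)) in
  let F2 : Z -> \bar R := rds_cond_info P mu_ theta f (fiber alpha2) in
  let I_mu := ae_invariant_sets mu Th in
  ({ae mu, forall z,
    (fun N => (N%:R^-1)%:E * I_N N z.1 z.2) @ \oo -->
      a1%:E * condexp mu I_mu F1 z + a2%:E * condexp mu I_mu F2 z} /\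
  (ergodic mu Th ->
    {ae mu, forall z,
      (fun N => (N%:R^-1)%:E * I_N N z.1 z.2) @ \oo -->
        a1%:E * rds_entropy P mu_ theta f (pjoin alpha1 alpha2) +
        a2%:E * rds_entropy P mu_ theta f alpha2}))%E.
Proof.
move=> part1 part2 a1_gt0 a2_ge0 I_N F1 F2 I_mu.
have part12 := finite_measurable_partition_pjoin part1 part2.
have [xi [mxi [K1 xiK] labxi]] := finite_measurable_partition_label part12.
have [eta [meta [K2 etaK] labeta]] := finite_measurable_partition_label part2.
have xi_eta x y : xi x = xi y -> eta x = eta y.
  move=> xy; have : same_label xi y x by [].
  by rewrite -labxi atom_pjoin labeta => -[].
pose A1 N := `|Num.ceil (a1 * N%:R)|%N; pose A2 N := `|Num.ceil ((a1 + a2) * N%:R)|%N.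
have A12 N : (A1 N <= A2 N)%N by apply: leq_ceil; [exact: ltW|rewrite lerDl].
have F1E : F1 = rds_cond_info P mu_ theta f (fiber (pjoin alpha1 alpha2)).
  by rewrite /F1; congr rds_cond_info; apply/funext => w; rewrite fiber_pjoin.
have [mF1 aeF1] := rds_cond_info_cinfo_lim part12 mxi labxi.
have [mF2 aeF2] := rds_cond_info_cinfo_lim part2 meta labeta.
rewrite -F1E in mF1 aeF1; rewrite -/F2 in mF2 aeF2.
have [ixi _ _] := cinfo_integral_cvg mu_dis theta_meas f_meas mxi xiK.
have [ieta _ _] := cinfo_integral_cvg mu_dis theta_meas f_meas meta etaK.
have xi0 := cinfo_lim_ge0 mu_ theta_meas f_meas mxi.
have eta0 := cinfo_lim_ge0 mu_ theta_meas f_meas meta.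
have lim : {ae mu, forall z, ((fun N => (N%:R^-1)%:E * I_N N z.1 z.2) @ \oo -->
    a1%:E * (birkhoff_lim Th (cinfo_lim mu_ theta f xi) z)%:E +
    a2%:E * (birkhoff_lim Th (cinfo_lim mu_ theta f eta) z)%:E)%E}.
  have aeJ : {ae mu, forall z, forall N,
      0 < label_mass mu_ (itin2 theta f xi eta (A1 N) (A2 N - A1 N)) z}.
    by apply/ae_foralln => N; apply: (label_mass_gt0 mu_dis);
      exact: (mlabel_itin2 theta_meas f_meas mxi meta).
  have := info_cvg mu_dis theta_meas theta_pres theta_inv f_meas mu_inv mxi xiK meta etaK
    xi_eta a1_gt0 a2_ge0 A12 (cvg_ceil_over_n (ltW a1_gt0))
    (cvg_ceil_over_n (addr_ge0 (ltW a1_gt0) a2_ge0)).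
  apply: filterS2 aeJ => -[w x] J cvg_J.
  have -> : (fun N => (N%:R^-1)%:E * I_N N w x)%E = EFin \o (fun N =>
      - ln (label_mass mu_ (itin2 theta f xi eta (A1 N) (A2 N - A1 N)) (w, x)) / N%:R).
    apply/funext => N; rewrite /I_N (info_label (atom_two_rds_joins w x labxi labeta (A12 N))).
    - by rewrite -EFinM/= mulrC.
    - by apply: measurable_same_label; exact: (mlabel_itin2 theta_meas f_meas mxi meta).
    - exact: J.
  by rewrite -!EFinM -EFinD; apply: cvg_EFin; [exact: nearW|exact: cvg_J].
split.
  have := condexp_invariant mTh mu_inv ixi xi0 mF1 aeF1.
  have := condexp_invariant mTh mu_inv ieta eta0 mF2 aeF2.
  by apply: filterS3 lim => z cz -> ->.
move=> erg.
have := birkhoff_lim_ergodic mTh mu_inv ixi xi0 erg.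
have := birkhoff_lim_ergodic mTh mu_inv ieta eta0 erg.
rewrite (rds_entropy_cinfo_lim part12 mxi xiK labxi).
rewrite (rds_entropy_cinfo_lim part2 meta etaK labeta).
by apply: filterS3 lim => z cz <- <-.
Qed.

End information_of_a_random_system.

Local Open Scope ereal_scope.

Theorem theorem6p3 (R : realType)
  (Om : completeMetricType R) (sepOm : separable Om)
  (P : probability (borel Om) R)
  (theta : borel Om -> borel Om)
  (theta_meas : measurable_fun setT theta)
  (theta_pres : invariant_measure P theta)
  (theta_inv : invertible theta)
  (theta_erg : ergodic P theta)
  (X : pointedMetricType R) (compactX : compact [set: X])
  (f : Om -> X -> X) (rds_f : continuous_bundle_rds P f)
  (mu : probability (borel Om * borel X)%type R)
  (mu_inv : invariant_measure mu (skew_product theta f))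
  (mu_marg : has_marginal P mu)
  (mu_ : R.-pker borel Om ~> borel X)
  (mu_dis : disintegration P mu_ mu)
  (alpha1 alpha2 : set (set (borel Om * borel X)))
  (part1 : finite_measurable_partition alpha1)
  (part2 : finite_measurable_partition alpha2)
  (a1 a2 : R) (a1_gt0 : (0 < a1)%R) (a2_ge0 : (0 <= a2)%R) :
  let I_N (N : nat) (w : borel Om) (x : borel X) : \bar R :=
    info (mu_ w)
      (pjoin
        (\pjoin_(n < `|Num.ceil (a1 * N%:R)|%N)
          rds_pullback theta f (fiber alpha1) n w)
        (\pjoin_(n < `|Num.ceil ((a1 + a2) * N%:R)|%N)
          rds_pullback theta f (fiber alpha2) n w)) x in
  let F1 : borel Om * borel X -> \bar R :=
    rds_cond_info P mu_ theta f
      (fun w => pjoin (fiber alpha1 w) (fiber alpha2 w)) in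
  let F2 : borel Om * borel X -> \bar R :=
    rds_cond_info P mu_ theta f (fiber alpha2) in
  let I_mu := ae_invariant_sets mu (skew_product theta f) in
  {ae mu, forall z,
    (fun N => (N%:R^-1)%:E * I_N N z.1 z.2) @ \oo -->
      a1%:E * condexp mu I_mu F1 z + a2%:E * condexp mu I_mu F2 z} /\
  (ergodic mu (skew_product theta f) ->
    {ae mu, forall z,
      (fun N => (N%:R^-1)%:E * I_N N z.1 z.2) @ \oo -->
        a1%:E * rds_entropy P mu_ theta f (pjoin alpha1 alpha2) +
        a2%:E * rds_entropy P mu_ theta f alpha2}).
Proof.
exact: (joint_information_cvg mu_dis theta_meas theta_pres theta_inv rds_f.1 mu_inv
  part1 part2 a1_gt0 a2_ge0).
Qed.
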